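(* Let $G\subset GL(m,\mathbb{R})$ be an $n$-dimensional real matrix Lie group with Lie algebra $\mathfrak{g}\subset\mathbb{R}^{m\times m}$, and let $\Lambda:\mathbb{R}^n\to\mathfrak{g}$, $\Lambda(x)=\sum_i x^i\tilde E_i$, be the linear isomorphism determined by a basis $\tilde E_1,\dots,\tilde E_n$ of $\mathfrak{g}$. Let $\theta\in\mathbb{R}^{n_\theta}$ be a parameter and let $f_\theta(g,t)=f(g,t,\theta)\in T_gG$ be a continuously differentiable, parameterized, time-dependent vector field on $G$. Fix $T>0$ and $g_0\in G$, let $\Psi^t_{f_\theta}:G\to G$ denote the flow of $\dot g=f_\theta(g,t)$ from time $0$ to time $t$, and define the cost $$C^T_{f_\theta}(g_0,\theta)=F\big(\Psi^T_{f_\theta}(g_0),\theta\big)+\int_0^T r\big(\Psi^s_{f_\theta}(g_0),\theta,s\big)\,\mathrm{d}s,$$ where $F:G\times\mathbb{R}^{n_\theta}\to\mathbb{R}$ and $r:G\times\mathbb{R}^{n_\theta}\times\mathbb{R}\to\mathbb{R}$ are continuously differentiable. Denote $\tilde f_\theta(g,t):=g^{-1}f_\theta(g,t)\in\mathfrak{g}$. Then $$\frac{\partial}{\partial\theta}C^T_{f_\theta}(g_0,\theta)=\frac{\partial F}{\partial\theta}\big(g(T),\theta\big)+\int_0^T\Big[\frac{\partial}{\partial\theta}\big(\lambda_g^\top\Lambda^{-1}(\tilde f_\theta(g,t))\big)+\frac{\partial r}{\partial\theta}(g,\theta,t)\Big]\,\mathrm{d}t,$$ where the partial derivatives in $\theta$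 are taken with $g=g(t)$ and $\lambda_g=\lambda_g(t)$ held fixed, and where $g(t)\in G$ and $\lambda_g(t)\in\mathbb{R}^n$ solve $$\dot g=f_\theta(g,t),\quad g(0)=g_0,$$ $$\dot\lambda_g=-\mathrm{d}_g\big(\lambda_g^\top\Lambda^{-1}(\tilde f_\theta)+r\big)+\mathrm{ad}_{\Lambda^{-1}(\tilde f_\theta)}^\top\lambda_g,\quad \lambda_g(T)=\mathrm{d}_gF\big(g(T),\theta\big),$$ with $\mathrm{d}_g$ applied to the indicated function of $g$ with $\lambda_g$, $\theta$, $t$ held fixed.
   Context: For $A\in\mathbb{R}^n$, $\mathrm{ad}_A\in\mathbb{R}^{n\times n}$ denotes the matrix of the linear map $B\mapsto\Lambda^{-1}\big(\Lambda(A)\Lambda(B)-\Lambda(B)\Lambda(A)\big)$, and $\mathrm{ad}_A^\top$ its transpose. For a continuously differentiable $V:G\to\mathbb{R}$ and $g\in G$, the gradient $\mathrm{d}_gV\in\mathbb{R}^n$ is defined by $\mathrm{d}_gV=\frac{\partial}{\partial q}V\big(g\exp(\Lambda(q))\big)\big|_{q=0}$, where $\exp$ is the matrix exponential (equivalently $\frac{\partial}{\partial q}V\big(g(I+\Lambda(q))\big)|_{q=0}$ when $V$ is the restriction of a differentiable function on $\mathbb{R}^{m\times m}$). *)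

(* Defs.v *)
From HB Require Import structures.
From mathcomp Require Import all_boot all_order all_algebra.
From mathcomp Require Import all_classical all_reals all_analysis.
Set Implicit Arguments. Unset Strict Implicit. Unset Printing Implicit Defensive.
Import Order.TTheory GRing.Theory Num.Theory.
Import numFieldNormedType.Exports.
Local Open Scope classical_set_scope.
Local Open Scope ring_scope.

Definition expm (R : realType) (m : nat) (A : 'M[R]_m) : 'M[R]_m :=
  limn (fun N => \sum_(k < N) ((k`!)%:R^-1 *: A ^+ k)).

Definition matrix_Lie_group (R : realType) (m : nat) (G : set 'M[R]_m) : Prop :=
  [/\ (forall A, G A -> A \in unitmx),
      G 1%:M,
      (forall A B, G A -> G B -> G (A *m B)),
      (forall A, G A -> G (invmx A)) &
      (forall A, closure G A -> A \in unitmx -> G A)].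

Definition lie_algebra (R : realType) (m : nat) (G : set 'M[R]_m) : set 'M[R]_m :=
  [set X | forall t : R, G (expm (t *: X))].

Definition Lam (R : realType) (m n : nat) (E : 'I_n -> 'M[R]_m) (x : 'cV[R]_n)
  : 'M[R]_m := \sum_(i < n) x i 0 *: E i.

(* Lambda^{-1} (on the Lie algebra, where Lam is bijective) *)
Definition Laminv (R : realType) (m n : nat) (E : 'I_n -> 'M[R]_m) (X : 'M[R]_m)
  : 'cV[R]_n := xget 0 [set x | Lam E x = X].

Definition is_basis_of (R : realType) (m n : nat) (E : 'I_n -> 'M[R]_m)
  (g : set 'M[R]_m) : Prop :=
  (forall x y, Lam E x = Lam E y -> x = y) /\
  (forall X, g X <-> exists x, X = Lam E x).

Definition ev (R : realType) (n : nat) (i : 'I_n) : 'cV[R]_n := delta_mx i 0.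
Arguments ev {R n}.

Definition adm (R : realType) (m n : nat) (E : 'I_n -> 'M[R]_m) (A : 'cV[R]_n)
  : 'M[R]_n :=
  \matrix_(i < n, j < n)
    Laminv E (Lam E A *m Lam E (ev j) - Lam E (ev j) *m Lam E A) i 0.

Definition dotv (R : realType) (n : nat) (x y : 'cV[R]_n) : R := (x^T *m y) 0 0.

Definition dg (R : realType) (m n : nat) (E : 'I_n -> 'M[R]_m)
  (V : 'M[R]_m -> R) (g : 'M[R]_m) : 'cV[R]_n :=
  \col_(i < n) 'D_(ev i) (fun q : 'cV[R]_n => V (g *m expm (Lam E q))) 0.

(* continuously differentiable on a finite-dimensional normed space:
   all directional (in particular all partial) derivatives exist
   everywhere and are continuous *)
Definition C1 (R : realType) (V W : normedModType R) (phi : V -> W) : Prop :=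
  forall v : V, (forall x, derivable phi x v) /\ continuous ('D_v phi).

(* phi : G x W -> Y is continuously differentiable: in the charts
   q |-> g exp(Lam q) around every point g of G *)
Definition C1_on_group (R : realType) (m n : nat) (G : set 'M[R]_m)
  (E : 'I_n -> 'M[R]_m) (W Y : normedModType R) (phi : 'M[R]_m -> W -> Y) : Prop :=
  forall g, G g ->
    C1 (fun p : 'cV[R]_n * W => phi (g *m expm (Lam E p.1)) p.2).

(* Main.v *)
(* Let g be the reference trajectory and g_c the one for the parameter
   theta + c e_j. By the closed subgroup theorem, g^-1 g_c = exp(Lam q) for a
   small q(t) as soon as g^-1 g_c is close to 1, and Gronwall's lemma bounds q by
   a multiple of |c|, uniformly in t. The costate equation is such that the
   derivative of lam . Lam^-1(g^-1 g_c - 1), where Lam^-1 stands for a linear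
   extension to all matrices, is
     c lam . d_theta u - d_g r . q + o(c),   u = Lam^-1 (g^-1 f),
   because the terms d_g u q and ad_u q cancel. Adding the increment of the
   running cost, integrating over [0, T], and using lam(T) = d_g F gives the
   first-order expansion of the cost. Only the size of q is used: the
   differentiability of the flow in theta is never needed. *)
Require Import Defs.
From HB Require Import structures.
From mathcomp Require Import all_boot all_order all_algebra.
From mathcomp Require Import all_classical all_reals all_analysis.
From mathcomp Require Import ring lra.
Set Implicit Arguments. Unset Strict Implicit. Unset Printing Implicit Defensive.
Import Order.TTheory GRing.Theory Num.Theory.
Import numFieldNormedType.Exports.
Local Open Scope classical_set_scope.
Local Open Scope ring_scope.

(** * Matrix norms and the exponential *)

(** The regularity hypotheses speak of one chart at a time and, through continuous directional
    derivatives, of one direction at a time. The cost needs a first-order expansion that is uniform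
    along the whole trajectory, where the center of the chart moves with t. Strict differentiability
    bridges the gap: it follows from C1 by moving along one direction after another, it passes to
    charts centered at nearby points of the curve, and compactness of [0, T] then yields one radius
    for all t. The coordinate q is chosen for each t separately, so nothing is known about its
    dependence on t; only the matrix g^-1 g_c is ever differentiated. The linear coordinates of g^-1
    g_c - 1 differ from q by O(|q|^2), which is harmless at first order. The parameter moves only
    along theta + c e_j, so that every function is expanded in three variables: the chart
    coordinate, the time and the scalar c. *)

Lemma mx_entry_le (R : realType) m n (A : 'M[R]_(m, n)) i j : `|A i j| <= `|A|.
Proof.
rewrite [leRHS]/Num.Def.normr/= mx_normrE.
exact: (le_bigmax _ (fun ij : 'I_m * 'I_n => `|A ij.1 ij.2|) (i, j)).
Qed.

Lemma mx_norm_le (R : realType) m n (A : 'M[R]_(m, n)) (e : R) : 0 <= e ->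
  (forall i j, `|A i j| <= e) -> `|A| <= e.
Proof.
move=> e0 H; rewrite [leLHS]/Num.Def.normr/= mx_normrE.
by apply: bigmax_le => // -[i j] _; exact: H.
Qed.

(** The norm is the largest absolute value of an entry and is not submultiplicative: the inner
    dimension enters as a factor in every product estimate below. *)
Lemma mulmx_norm_le (R : realType) m n p (A : 'M[R]_(m, n)) (B : 'M[R]_(n, p)) :
  `|A *m B| <= n%:R * `|A| * `|B|.
Proof.
apply: mx_norm_le => [|i j]; first by rewrite !mulr_ge0.
rewrite mxE (le_trans (ler_norm_sum _ _ _))//.
apply: (@le_trans _ _ (\sum_(k < n) `|A| * `|B|)).
  by apply: ler_sum => k _; rewrite normrM ler_pM// mx_entry_le.
by rewrite sumr_const card_ord -[X in X <= _]mulr_natl mulrA.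
Qed.

Lemma continuous_norm (R : realType) (V W : normedModType R) (f : V -> W) :
  (forall x e, 0 < e -> exists2 d, 0 < d & forall y, `|x - y| < d -> `|f x - f y| <= e) ->
  continuous f.
Proof.
move=> H x; apply/cvgrPdist_le => e e0; have [d d0 Hd] := H x e e0.
by apply/nbhs_ballP; exists d => // y; rewrite -ball_normE/=; exact: Hd.
Qed.

Lemma cvg_mxP (R : realType) m n (T : Type) (F : set_system T) {FF : Filter F}
   (U : T -> 'M[R]_(m, n)) (A : 'M[R]_(m, n)) :
  (U @ F --> A) <-> (forall i j, (fun t => U t i j) @ F --> A i j).
Proof.
split=> [UA i j|UA].
  apply/cvgrPdist_le => e e0; near=> t.
  have : `|A - U t| <= e by near: t; move/cvgrPdist_le : UA; exact.
  by apply: le_trans; have := mx_entry_le (A - U t) i j; rewrite !mxE.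
apply/cvgrPdist_le => e e0; near=> t; apply: mx_norm_le; first exact: ltW.
move=> i j; rewrite !mxE.
have : forall ij : 'I_m * 'I_n, `|A ij.1 ij.2 - U t ij.1 ij.2| <= e.
  near: t; apply: filter_forall => -[i' j'] /=.
  by have /cvgrPdist_le := UA i' j'; exact.
by move=> /(_ (i, j)).
Unshelve. all: by end_near. Qed.

Lemma cvg_mulmx (R : realType) m n p (T : Type) (F : set_system T) {FF : Filter F}
  (U : T -> 'M[R]_(m, n)) (V : T -> 'M[R]_(n, p)) (A : 'M[R]_(m, n)) (B : 'M[R]_(n, p)) :
  U @ F --> A -> V @ F --> B -> (fun t => U t *m V t) @ F --> A *m B.
Proof.
move=> /cvg_mxP UA /cvg_mxP VB; apply/cvg_mxP => i j; rewrite mxE.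
under eq_fun do rewrite mxE.
apply: cvg_big => [|k _]; [exact: add_continuous|exact: cvgM].
Qed.

Section expm_theory.
Variables (R : realType) (m : nat).
Implicit Types A B : 'M[R]_m.

Local Notation psum A := (fun N => \sum_(k < N) ((k`!)%:R^-1 *: (A : 'M[R]_m) ^+ k)).

Lemma norm_scalar1_le1 : `|1%:M : 'M[R]_m| <= 1.
Proof.
by apply: mx_norm_le => // i j; rewrite mxE; case: (_ == _); rewrite ?normr1 ?normr0.
Qed.

Lemma norm_expmx_le A k : `|A ^+ k| <= (m%:R * `|A|) ^+ k.
Proof.
elim: k => [|k IH]; first by rewrite !expr0 -[1]/(1%:M) norm_scalar1_le1.
rewrite !exprS -mulmxE (le_trans (mulmx_norm_le _ _))//.
by rewrite ler_wpM2l// mulr_ge0.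
Qed.

(** Compared with [norm_expmx_le] the left-hand side carries one more factor [m], the one that a
    further product with [A - B] costs in [expmx_lip]. It needs an exponent of at least 1. *)
Lemma norm_expmxS_le A k : m%:R * `|A ^+ k.+1| <= (m%:R * `|A|) ^+ k.+1.
Proof.
elim: k => [|k IH]; first by rewrite !expr1.
rewrite exprS [leRHS]exprS -mulmxE.
apply: (@le_trans _ _ (m%:R * (m%:R * `|A| * `|A ^+ k.+1|))).
  by rewrite ler_wpM2l// mulmx_norm_le.
by rewrite mulrCA ler_wpM2l// mulr_ge0.
Qed.

Lemma psum_exp_coeff_le (x : R) N : 0 <= x ->
  \sum_(k < N) (k`!)%:R^-1 * x ^+ k <= expR x.
Proof.
move=> x0; have -> : \sum_(k < N) (k`!)%:R^-1 * x ^+ k = series (exp_coeff x) N.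
  by rewrite /series /= big_mkord; apply: eq_bigr => k _; rewrite mulrC.
apply: nondecreasing_cvgn_le; last exact: is_cvg_series_exp_coeff.
by apply: nondecreasing_series => k _ _; exact: exp_coeff_ge0.
Qed.

(** Entry by entry the series is dominated by the real exponential series at [m * |A|]. Only now
    does the [limn] in [expm] denote a genuine limit. *)
Lemma cvg_expm A : psum A @ \oo --> expm A.
Proof.
suff: cvgn (psum A) by [].
pose M : 'M[R]_m := \matrix_(i, j) limn (fun N => psum A N i j).
suff : psum A @ \oo --> M by move=> ?; apply/cvg_ex; exists M.
apply/cvg_mxP => i j; rewrite mxE.
have -> : (fun N => psum A N i j) = series (fun k => k`!%:R^-1 * (A ^+ k) i j).
  apply/funext => N; rewrite /series/= big_mkord summxE.
  by apply: eq_bigr => k _; rewrite mxE.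
apply: normed_cvg; rewrite /=.
apply: (@series_le_cvg _ _ (exp_coeff (m%:R * `|A|))).
- by move=> k /=; rewrite normr_ge0.
- by move=> k; apply: exp_coeff_ge0; rewrite mulr_ge0.
- move=> k /=; rewrite normrM ger0_norm// mulrC ler_wpM2r//.
  by rewrite (le_trans _ (norm_expmx_le _ _))// mx_entry_le.
- exact: is_cvg_series_exp_coeff.
Qed.

Lemma expm0 : expm (0 : 'M[R]_m) = 1%:M.
Proof.
rewrite /expm; apply/cvg_lim => //; apply: cvg_near_cst.
near=> N; have : (0 < N)%N by near: N; exact: nbhs_infty_gt.
move=> /prednK <-; rewrite big_ord_recl /= fact0 invr1 scale1r expr0.
by rewrite big1 ?addr0// => i _; rewrite exprS mul0r scaler0.
Unshelve. all: by end_near. Qed.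

Lemma expmx_lip A B (a : R) k : m%:R * `|A| <= a -> m%:R * `|B| <= a ->
  `|A ^+ k.+1 - B ^+ k.+1| <= k.+1%:R * a ^+ k * `|A - B|.
Proof.
move=> Aa Ba; elim: k => [|k IH]; first by rewrite !expr1 expr0 !mul1r.
have a0 : 0 <= a by rewrite (le_trans _ Aa)// mulr_ge0.
have -> : A ^+ k.+2 - B ^+ k.+2 = A ^+ k.+1 *m (A - B) + (A ^+ k.+1 - B ^+ k.+1) *m B.
  by rewrite !mulmxE mulrBr mulrBl -!exprSr addrA subrK.
rewrite (le_trans (ler_normD _ _))//.
have -> : k.+2%:R * a ^+ k.+1 * `|A - B| =
   a ^+ k.+1 * `|A - B| + k.+1%:R * a ^+ k * `|A - B| * a.
  by rewrite -[k.+2]addn1 natrD exprS; ring.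
apply: lerD.
  apply: (le_trans (mulmx_norm_le _ _)); rewrite ler_wpM2r//.
  by rewrite (le_trans (norm_expmxS_le _ _))// lerXn2r ?nnegrE// mulr_ge0.
apply: (le_trans (mulmx_norm_le _ _)).
by rewrite mulrAC [leLHS]mulrC ler_pM// mulr_ge0.
Qed.

(** The terms of degree 0 and 1 contribute exactly [A - B], hence the shift [N.+2]. In degree k+2
    the factor k+2 of [expmx_lip] cancels against the factorial, and one power of [a] remains in
    front of a partial sum of exp(a). *)
Lemma psum_lip A B (a : R) N : m%:R * `|A| <= a -> m%:R * `|B| <= a ->
  `|psum A N.+2 - psum B N.+2 - (A - B)| <= a * expR a * `|A - B|.
Proof.
move=> Aa Ba; have a0 : 0 <= a by rewrite (le_trans _ Aa)// mulr_ge0.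
have psumE C : psum C N.+2 = 1%:M + C + \sum_(k < N) ((k.+2`!)%:R^-1 *: C ^+ k.+2).
  rewrite 2!big_ord_recl /= /bump /= !fact0 invr1 !scale1r expr0 expr1 addrA.
  by congr (_ + _).
have -> : psum A N.+2 - psum B N.+2 - (A - B) =
    \sum_(k < N) (k.+2`!)%:R^-1 *: (A ^+ k.+2 - B ^+ k.+2).
  rewrite !psumE; under [RHS]eq_bigr do rewrite scalerBr.
  by rewrite sumrB; apply/matrixP => i j; rewrite !mxE; ring.
apply: (le_trans (ler_norm_sum _ _ _)).
apply: (@le_trans _ _ (a * (\sum_(k < N) k`!%:R^-1 * a ^+ k) * `|A - B|)).
  rewrite mulr_sumr mulr_suml; apply: ler_sum => k _.
  rewrite normrZ ger0_norm ?invr_ge0//.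
  apply: (@le_trans _ _ (k.+2`!%:R^-1 * (k.+2%:R * a ^+ k.+1 * `|A - B|))).
    by rewrite ler_wpM2l ?invr_ge0// expmx_lip.
  rewrite factS natrM invfM.
  have -> : (k.+2%:R^-1 * k.+1`!%:R^-1 * (k.+2%:R * a ^+ k.+1 * `|A - B|) =
     a * (k.+1`!%:R^-1 * a ^+ k) * `|A - B|).
    have : k.+2%:R^-1 * k.+2%:R = 1 :> R by rewrite mulVf ?pnatr_eq0.
    set u : R := k.+2%:R^-1; set v : R := k.+2%:R; set w : R := k.+1`!%:R^-1 => uv.
    rewrite exprS.
    by transitivity (u * v * (a * (w * a ^+ k) * `|A - B|)); [ring|rewrite uv mul1r].
  rewrite ler_wpM2r// ler_wpM2l// ler_wpM2r ?exprn_ge0//.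
  by rewrite lef_pV2 ?posrE ?ltr0n ?fact_gt0// ler_nat factS leq_pmull.
by rewrite ler_wpM2r// ler_wpM2l// psum_exp_coeff_le.
Qed.

Lemma norm_cvg_le (V : normedModType R) (T : Type) (F : set_system T)
  {FF : ProperFilter F} (U : T -> V) (x : V) (e : R) :
  U @ F --> x -> (\forall t \near F, `|U t| <= e) -> `|x| <= e.
Proof.
move=> Ux Ue; apply/ler_addgt0Pl => d d0.
have /cvgrPdist_le/(_ _ d0) Ud := Ux.
have [t [H1 H2]] := filter_ex (filterI Ue Ud).
rewrite -[x](subrK (U t)) (le_trans (ler_normD _ _))// lerD//.
Qed.

(** Since a exp(a) tends to 0 with [a], exp is near 0 a small Lipschitz perturbation of a
    translation. With [B = 0] this is the quadratic remainder of exp; with two free points it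
    controls changes of chart. *)
Lemma expm_lip A B (a : R) : m%:R * `|A| <= a -> m%:R * `|B| <= a ->
  `|expm A - expm B - (A - B)| <= a * expR a * `|A - B|.
Proof.
move=> Aa Ba.
have H : (fun N => psum A N.+2 - psum B N.+2 - (A - B)) @ \oo -->
    expm A - expm B - (A - B).
  apply: cvgB; last exact: cvg_cst.
  have shift2 C : (fun N => psum C N.+2) @ \oo --> expm C.
    rewrite (cvg_shiftS (fun N => psum C N.+1)) (cvg_shiftS (fun N => psum C N)).
    exact: cvg_expm.
  by apply: cvgB.
by apply: (norm_cvg_le H); near=> N; exact: psum_lip.
Unshelve. all: by end_near. Qed.

Lemma expm_conj (g : 'M[R]_m) A : g \in unitmx ->
  expm (g *m A *m invmx g) = g *m expm A *m invmx g.
Proof.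
move=> gu; rewrite /expm; apply/cvg_lim => //.
have -> : psum (g *m A *m invmx g) = (fun N => g *m psum A N *m invmx g).
  apply/funext => N; rewrite mulmx_sumr mulmx_suml; apply: eq_bigr => k _.
  rewrite -scalemxAr -scalemxAl; congr (_ *: _); elim: (nat_of_ord k) => [|k' IH].
    by rewrite !expr0 mulmx1 mulmxV.
  by rewrite exprS IH -mulmxE !mulmxA mulmxKV// exprS -mulmxE !mulmxA.
apply: cvg_mulmx; last exact: cvg_cst.
by apply: cvg_mulmx; [exact: cvg_cst|exact: cvg_expm].
Qed.

End expm_theory.

(** * The exponential along a line is a homomorphism *)

Section exp_product.
Variables (R : realType) (V : lmodType R).
Implicit Types (X : nat -> V) (s t : R).

Lemma triangular_sum (F : nat -> nat -> V) N :
  \sum_(0 <= i < N) \sum_(0 <= j < N | (i + j < N)%N) F i j =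
  \sum_(0 <= k < N) \sum_(0 <= i < k.+1) F i (k - i)%N.
Proof.
transitivity (\sum_(0 <= k < N) \sum_(0 <= i < N | (i <= k)%N) F i (k - i)%N); last first.
  rewrite !big_nat; apply: eq_bigr => k /andP[_ kN].
  by rewrite (big_nat_widen _ _ _ _ _ kN).
rewrite [RHS](exchange_big_dep_nat xpredT)//=.
rewrite big_nat [RHS]big_nat; apply: eq_bigr => i /andP[_ iN].
transitivity (\sum_(0 + i <= k < N) F i (k - i)%N).
  rewrite big_addn [RHS](big_nat_widen _ _ N) ?leq_subr//.
  rewrite big_nat_cond [RHS]big_nat_cond; apply: eq_big => j /=.
    by rewrite ltn_subRL.
  by rewrite addnK addnC.
by rewrite add0n (big_nat_widenl _ 0).
Qed.

(** A Cauchy product of partial sums that keeps the terms outside the triangle as an explicit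
    remainder. The sequence [X] is abstract, so that the identity serves both for the powers of a
    matrix and for those of a real number. *)
Lemma exp_psum_prod X s t N :
  \sum_(0 <= i < N) \sum_(0 <= j < N) (i`!%:R^-1 * s ^+ i * (j`!%:R^-1 * t ^+ j)) *: X (i + j)%N =
  \sum_(0 <= k < N) (k`!%:R^-1 * (s + t) ^+ k) *: X k +
  \sum_(0 <= i < N) \sum_(0 <= j < N | (N <= i + j)%N)
     (i`!%:R^-1 * s ^+ i * (j`!%:R^-1 * t ^+ j)) *: X (i + j)%N.
Proof.
have -> : \sum_(0 <= k < N) (k`!%:R^-1 * (s + t) ^+ k) *: X k =
   \sum_(0 <= k < N) \sum_(0 <= i < k.+1)
     (i`!%:R^-1 * s ^+ i * ((k - i)`!%:R^-1 * t ^+ (k - i))) *: X (i + (k - i))%N.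
  apply: eq_bigr => k _.
  rewrite addrC exprDn mulr_sumr scaler_suml big_mkord; apply: eq_bigr => i _.
  have ik : (i <= k)%N by rewrite -ltnS.
  rewrite subnKC//; congr (_ *: _).
  have -> : i`!%:R^-1 * s ^+ i * ((k - i)`!%:R^-1 * t ^+ (k - i)) =
     (i`! * (k - i)`!)%:R^-1 * (t ^+ (k - i) * s ^+ i).
    by rewrite natrM invfM; ring.
  rewrite -(bin_fact ik) natrM [in LHS]invfM -[X in _ * X = _]mulr_natr.
  have b0 : ('C(k, i))%:R != 0 :> R by rewrite pnatr_eq0 -lt0n bin_gt0.
  set b : R := ('C(k, i))%:R in b0 *; set f : R := (_ * _)%:R^-1.
  set y := t ^+ _; set z := s ^+ _.
  by transitivity (b^-1 * b * (f * (y * z))); [ring|rewrite mulVf// mul1r].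
have /= <- := triangular_sum (fun i j =>
  (i`!%:R^-1 * s ^+ i * (j`!%:R^-1 * t ^+ j)) *: X (i + j)%N) N.
rewrite -big_split /=; apply: eq_bigr => i _.
rewrite (bigID (fun j => (i + j < N)%N))/=; congr (_ + _).
by apply: eq_bigl => j; rewrite -leqNgt.
Qed.

End exp_product.

(** The remainder of the matrix Cauchy product is dominated by the remainder [T] of the scalar one
    at [a = m * |A|], and the latter tends to 0 because the real exponential is already known to be
    multiplicative. *)
Lemma expmD (R : realType) m (A : 'M[R]_m) (s t : R) :
  expm ((s + t) *: A) = expm (s *: A) *m expm (t *: A).
Proof.
pose S (x : R) N := \sum_(0 <= k < N) (k`!%:R^-1 * x ^+ k) *: A ^+ k.
have SE x N : \sum_(k < N) (k`!%:R^-1 *: (x *: A) ^+ k) = S x N.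
  rewrite /S big_mkord; apply: eq_bigr => k _; rewrite -scalerA; congr (_ *: _).
  elim: (nat_of_ord k) => [|k' IH]; first by rewrite !expr0 scale1r.
  by rewrite !exprS IH -!mulmxE -scalemxAl -scalemxAr scalerA.
have cS x : S x @ \oo --> expm (x *: A).
  by rewrite (_ : S x = fun N => \sum_(k < N) (k`!%:R^-1 *: (x *: A) ^+ k));
    [exact: cvg_expm|apply/funext => N; rewrite SE].
pose a := m%:R * `|A|.
have a0 : 0 <= a by rewrite mulr_ge0.
pose e (x : R) N := \sum_(0 <= k < N) (k`!%:R^-1 * x ^+ k) *: (a ^+ k : R^o).
have ce x : e x @ \oo --> expR (x * a).
  rewrite (_ : e x = series (exp_coeff (x * a))); first exact: is_cvg_series_exp_coeff.
  apply/funext => N; apply: eq_bigr => k _; rewrite [RHS]mulrC [(x * a) ^+ k]exprMn.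
  by rewrite [RHS]mulrA.
pose T x y N := \sum_(0 <= i < N) \sum_(0 <= j < N | (N <= i + j)%N)
     (i`!%:R^-1 * x ^+ i * (j`!%:R^-1 * y ^+ j)) *: (a ^+ (i + j) : R^o).
have eT x y N : e x N * e y N = e (x + y) N + T x y N.
  rewrite /e /T -exp_psum_prod big_distrlr/=.
  apply: eq_bigr => i _; apply: eq_bigr => j _.
  by rewrite exprD mulrACA.
have Tto0 x y : T x y @ \oo --> (0 : R^o).
  have -> : T x y = (fun N => e x N * e y N - e (x + y) N).
    by apply/funext => N; rewrite eT addrAC subrr add0r.
  rewrite (_ : 0 = expR (x * a) * expR (y * a) - expR ((x + y) * a)); last first.
    by rewrite mulrDl expRD subrr.
  by apply: cvgB; [apply: cvgM|]; exact: ce.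
have ST N : `|S s N *m S t N - S (s + t) N| <= T `|s| `|t| N.
  have -> : S s N *m S t N = \sum_(0 <= i < N) \sum_(0 <= j < N)
    (i`!%:R^-1 * s ^+ i * (j`!%:R^-1 * t ^+ j)) *: A ^+ (i + j)%N.
    rewrite mulmxE big_distrlr/=; apply: eq_bigr => i _; apply: eq_bigr => j _.
    by rewrite exprD -!mulmxE -scalemxAl -scalemxAr scalerA.
  rewrite exp_psum_prod addrAC subrr add0r.
  apply: (le_trans (ler_norm_sum _ _ _)); apply: ler_sum => i _.
  apply: (le_trans (ler_norm_sum _ _ _)); apply: ler_sum => j _.
  rewrite normrZ !normrM !normfV !normr_nat !normrX.
  rewrite ler_wpM2l; first by [].
    by rewrite !mulr_ge0 ?invr_ge0// exprn_ge0.
  exact: norm_expmx_le.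
have H : (fun N => S s N *m S t N - S (s + t) N) @ \oo -->
    expm (s *: A) *m expm (t *: A) - expm ((s + t) *: A).
  by apply: cvgB => //; apply: cvg_mulmx.
apply/esym/eqP; rewrite -subr_eq0 -normr_le0; apply/ler_addgt0Pl => d d0.
rewrite addr0; apply: (norm_cvg_le H).
have /cvgr0Pnorm_le/(_ _ d0) := Tto0 `|s| `|t|; apply: filterS => N TN.
by rewrite (le_trans (ST N))// (le_trans (ler_norm _)).
Qed.

Lemma expmN (R : realType) m (A : 'M[R]_m) : expm A *m expm (- A) = 1%:M.
Proof.
have := expmD A 1 (-1); rewrite subrr scale0r expm0 scale1r scaleN1r.
by move=> <-.
Qed.

Lemma expm_unit (R : realType) m (A : 'M[R]_m) : expm A \in unitmx.
Proof. by have /mulmx1_unit[] := expmN A. Qed.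

Lemma expm_inv (R : realType) m (A : 'M[R]_m) : invmx (expm A) = expm (- A).
Proof.
by rewrite -[LHS]mulmx1 -(expmN A) mulKmx// expm_unit.
Qed.

Lemma expm_pow (R : realType) m (A : 'M[R]_m) k : expm A ^+ k = expm (k%:R *: A).
Proof.
elim: k => [|k IH]; first by rewrite scale0r expm0 expr0.
by rewrite exprS IH -mulmxE -{1}[A]scale1r -expmD -natr1 addrC.
Qed.

(** * Coordinates on the Lie algebra *)

Section Lam_theory.
Variables (R : realType) (m n : nat) (E : 'I_n -> 'M[R]_m).

Lemma LamD x y : Lam E (x + y) = Lam E x + Lam E y.
Proof. by rewrite /Lam -big_split; apply: eq_bigr => i _; rewrite mxE scalerDl. Qed.

Lemma LamZ a x : Lam E (a *: x) = a *: Lam E x.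
Proof. by rewrite /Lam scaler_sumr; apply: eq_bigr => i _; rewrite mxE scalerA. Qed.

Lemma Lam0 : Lam E 0 = 0.
Proof. by rewrite -(scale0r 0) LamZ scale0r. Qed.

Lemma LamN x : Lam E (- x) = - Lam E x.
Proof. by rewrite -scaleN1r LamZ scaleN1r. Qed.

Lemma LamB x y : Lam E (x - y) = Lam E x - Lam E y.
Proof. by rewrite LamD LamN. Qed.

Lemma Lam_ev i : Lam E (ev i) = E i.
Proof.
rewrite /Lam (bigD1 i)//= big1 ?addr0 => [|j ji]; rewrite /ev mxE !eqxx.
  by rewrite scale1r.
by rewrite (negbTE ji) scale0r.
Qed.

Lemma Lam_norm_le x : `|Lam E x| <= (\sum_i `|E i|) * `|x|.
Proof.
rewrite (le_trans (ler_norm_sum _ _ _))// mulr_suml; apply: ler_sum => i _.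
by rewrite normrZ mulrC ler_wpM2l// mx_entry_le.
Qed.

End Lam_theory.

Section coords.
Variables (R : realType) (m n : nat).

(** The i-th coordinate is the entrywise pairing with [B i]. Unlike [Laminv], which is 0 outside the
    range of [Lam], this is linear on all matrices, and can be applied to X - 1 and
    differentiated. *)
Definition coords (B : 'I_n -> 'M[R]_m) (X : 'M[R]_m) : 'cV[R]_n :=
  \col_i \sum_j \sum_k B i j k * X j k.

Lemma coordsD B X Y : coords B (X + Y) = coords B X + coords B Y.
Proof.
apply/colP => i; rewrite !mxE -big_split; apply: eq_bigr => j _.
by rewrite -big_split; apply: eq_bigr => k _; rewrite mxE mulrDr.
Qed.

Lemma coordsZ B a X : coords B (a *: X) = a *: coords B X.
Proof.
apply/colP => i; rewrite !mxE mulr_sumr; apply: eq_bigr => j _.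
by rewrite mulr_sumr; apply: eq_bigr => k _; rewrite mxE mulrCA.
Qed.

Lemma coords0 B : coords B 0 = 0.
Proof. by rewrite -(scale0r (0 : 'M[R]_m)) coordsZ scale0r. Qed.

Lemma coordsB B X Y : coords B (X - Y) = coords B X - coords B Y.
Proof. by rewrite coordsD -scaleN1r coordsZ scaleN1r. Qed.

Lemma coords_norm_le B X :
  `|coords B X| <= (\sum_i \sum_j \sum_k `|B i j k|) * `|X|.
Proof.
have H i : `|coords B X i 0| <= (\sum_j \sum_k `|B i j k|) * `|X|.
  rewrite mxE (le_trans (ler_norm_sum _ _ _))// mulr_suml; apply: ler_sum => j _.
  rewrite (le_trans (ler_norm_sum _ _ _))// mulr_suml; apply: ler_sum => k _.
  by rewrite normrM ler_wpM2l// mx_entry_le.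
apply: mx_norm_le => [|i j].
  by rewrite mulr_ge0// !sumr_ge0// => *; rewrite !sumr_ge0// => *; rewrite !sumr_ge0.
rewrite ord1 (le_trans (H i))// ler_wpM2r// (bigD1 i)//= lerDl.
by rewrite !sumr_ge0// => *; rewrite !sumr_ge0// => *; rewrite !sumr_ge0.
Qed.

(** Injectivity of [Lam] makes the flattened [E i] the rows of a matrix of full row rank; the
    columns of a right inverse are the flattened [B i]. *)
Lemma coords_exists (E : 'I_n -> 'M[R]_m) :
  (forall x y, Lam E x = Lam E y -> x = y) ->
  exists B, forall x, coords B (Lam E x) = x.
Proof.
move=> Einj; pose L : 'M[R]_(n, m * m) := \matrix_i mxvec (E i).
have LamE v : mxvec (Lam E v^T) = v *m L.
  rewrite linear_sum/= mulmx_sum_row; apply: eq_bigr => i _.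
  by rewrite linearZ/= rowK mxE.
have : row_free L.
  apply: inj_row_free => v vL; apply: trmx_inj; apply: Einj.
  by apply: (can_inj mxvecK); rewrite LamE vL trmx0 Lam0 linear0.
move=> /row_freeP[C LC].
exists (fun i => \matrix_(j, k) C (mxvec_index j k) i) => x.
have : mxvec (Lam E x) *m C = x^T by rewrite -{1}[x]trmxK LamE -mulmxA LC mulmx1.
move=> H; apply/colP => i; rewrite mxE.
have -> : x i 0 = (mxvec (Lam E x) *m C) 0 i by rewrite H mxE.
rewrite mxE (reindex _ (curry_mxvec_bij m m))/= pair_bigA/=.
apply: eq_bigr => -[j k] _ /=; rewrite mxE mxvecE mulrC //.
Qed.

End coords.

Section seq_compact.
Variables (R : realType) (m : nat).

(** Bolzano-Weierstrass for the flattened matrices, with a cluster point that is approached at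
    arbitrarily large indices instead of a subsequence. *)
Lemma bounded_seq_cluster (U : nat -> 'M[R]_m) : (forall k, `|U k| <= 1) ->
  exists W : 'M[R]_m, forall d N, 0 < d -> exists2 k, (N <= k)%N & `|U k - W| < d.
Proof.
move=> U1; pose V k := mxvec (U k).
have cA : compact [set v : 'rV[R]_(m * m) | forall i, `[(-1 : R), 1]%classic (v ord0 i)].
  by apply: (@rV_compact R _ (fun=> `[(-1 : R), 1]%classic)) => i; exact: segment_compact.
have [|v [_ clv]] := cA (V @ \oo) _.
  rewrite /fmap/=; apply: filterE => k /= i; case/mxvec_indexP: i => i j.
  have -> : V k ord0 (mxvec_index i j) = U k i j by exact: mxvecE.
  rewrite in_itv/= -ler_norml.
  by rewrite (le_trans (mx_entry_le _ _ _)).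
exists (vec_mx v) => d N d0.
have [] := clv (V @` [set k | (N <= k)%N]) (ball v d).
- by exists N => // k /= Nk; exists k.
- exact: nbhsx_ballx.
move=> _ [[k /= Nk <-]]; rewrite -ball_normE/= => vk.
exists k => //; rewrite (le_lt_trans _ vk)//; apply: mx_norm_le => // i j.
apply: le_trans (mx_entry_le (v - V k) ord0 (mxvec_index i j)).
have -> : (v - V k) ord0 (mxvec_index i j) = vec_mx v i j - U k i j.
  by rewrite !mxE; congr (_ - _); exact: mxvecE.
by rewrite !mxE distrC.
Qed.

End seq_compact.

Section expm_more.
Variables (R : realType) (m : nat).
Implicit Types A W Y Z : 'M[R]_m.

Lemma norm_expm A : `|expm A| <= expR (m%:R * `|A|).
Proof.
apply: (norm_cvg_le (@cvg_expm _ _ A)); apply: nearW => N.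
rewrite (le_trans (ler_norm_sum _ _ _))//.
apply: le_trans (@psum_exp_coeff_le _ (m%:R * `|A|) N _); last by rewrite mulr_ge0.
apply: ler_sum => k _.
by rewrite normrZ ger0_norm ?invr_ge0// ler_wpM2l ?invr_ge0// norm_expmx_le.
Qed.

Lemma expm_sub_le A B (a : R) : m%:R * `|A| <= a -> m%:R * `|B| <= a ->
  `|expm A - expm B| <= (1 + a * expR a) * `|A - B|.
Proof.
move=> Aa Ba; rewrite -[expm A - expm B](subrK (A - B)) mulrDl mul1r [leRHS]addrC.
by rewrite (le_trans (ler_normD _ _))// lerD// expm_lip.
Qed.

(** The exponent [j] will tend to infinity, so a factor [m] per multiplication would be fatal.
    Splitting 1 + Z into the identity and [Z] replaces it by 1 + m |Z|, and the powers of [Q] are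
    bounded by assumption instead of through the norm of [Q]. *)
Lemma pow_sub_le Z (Q : 'M[R]_m) (c : R) j : (forall i, (i < j)%N -> `|Q ^+ i| <= c) ->
  `|(1%:M + Z) ^+ j - Q ^+ j| <=
  j%:R * ((1 + m%:R * `|Z|) ^+ j * (m%:R * c * `|1%:M + Z - Q|)).
Proof.
elim: j => [_|j IH Qc]; first by rewrite !expr0 subrr normr0 mul0r.
have c0 : 0 <= c by rewrite (le_trans _ (Qc 0%N _)).
set b := 1 + m%:R * `|Z|; set k := m%:R * c * _.
have b1 : 1 <= b by rewrite lerDl mulr_ge0.
have k0 : 0 <= k by rewrite !mulr_ge0.
have -> : (1%:M + Z) ^+ j.+1 - Q ^+ j.+1 =
   ((1%:M + Z) ^+ j - Q ^+ j) + Z *m ((1%:M + Z) ^+ j - Q ^+ j) +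
   (1%:M + Z - Q) *m Q ^+ j.
  have -> W : W + Z *m W = (1%:M + Z) *m W by rewrite mulmxDl mul1mx.
  by rewrite mulmxBr mulmxBl !exprS -!mulmxE addrA subrK.
rewrite (le_trans (ler_normD _ _))//.
apply: (@le_trans _ _ (b * (j%:R * (b ^+ j * k)) + k)).
  apply: lerD.
    rewrite (le_trans (ler_normD _ _))// mulrDl mul1r lerD//.
      by apply: IH => i ij; apply: Qc; rewrite ltnW.
    rewrite (le_trans (mulmx_norm_le _ _))// ler_wpM2l ?mulr_ge0//.
    by apply: IH => i ij; apply: Qc; rewrite ltnW.
  rewrite (le_trans (mulmx_norm_le _ _))// /k mulrAC ler_wpM2r//.
  by rewrite ler_wpM2l// Qc.
have -> : j.+1%:R * (b ^+ j.+1 * k) = b * (j%:R * (b ^+ j * k)) + b ^+ j.+1 * k.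
  by rewrite exprS -natr1; ring.
by rewrite lerD2l ler_peMl// exprn_ege1.
Qed.

End expm_more.

(** * The closed subgroup theorem *)

Section Lie_group.
Variables (R : realType) (m : nat) (G : set 'M[R]_m).
Hypothesis HG : matrix_Lie_group G.

Lemma Lie_group_unit A : G A -> A \in unitmx. Proof. by case: HG => H _ _ _ _; exact: H. Qed.
Lemma Lie_group1 : G 1%:M. Proof. by case: HG. Qed.
Lemma Lie_groupM A B : G A -> G B -> G (A *m B). Proof. by case: HG => _ _ H _ _; exact: H. Qed.
Lemma Lie_groupV A : G A -> G (invmx A). Proof. by case: HG => _ _ _ H _; exact: H. Qed.
Lemma Lie_group_closure A : closure G A -> A \in unitmx -> G A.
Proof. by case: HG => _ _ _ _; exact. Qed.

Lemma Lie_groupX A k : G A -> G (A ^+ k).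
Proof.
move=> GA; elim: k => [|k IH]; first by rewrite expr0; exact: Lie_group1.
by rewrite exprS -mulmxE; exact: Lie_groupM.
Qed.

(** Compare with exp(sW)^j = exp(jsW), where j is the integer part of t/s. One factor is wrong by
    O(s d), so j factors are wrong by O(t d), and replacing js by t costs O(s), hence O(d). [M]
    bounds the powers of both bases, because |Z| <= 2s and js <= t. *)
Lemma expm_approx_pow (W Z : 'M[R]_m) (t s d c M : R) :
  c = m%:R -> M = expR (2 * c * t) -> `|W| <= 1 -> 0 <= t ->
  0 < s -> s < d -> d <= 1 -> `|Z - s *: W| <= s * d ->
  `|(1%:M + Z) ^+ Num.truncn (t / s) - expm (t *: W)| <=
    (t * (M * (c * M * (1 + c * expR c))) + (1 + c * t * expR (c * t))) * d.
Proof.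
move=> cE ME W1 t0 s0 sd d1 Zs.
set j := Num.truncn (t / s).
have c0 : 0 <= c by rewrite cE.
have d0 : 0 < d by rewrite (lt_trans s0).
have js : j%:R * s <= t.
  by rewrite -ler_pdivlMr// truncn_le// divr_ge0// ltW.
have tjs : t < (j%:R + 1) * s.
  by rewrite -ltr_pdivrMr// natr1 truncnS_gt.
have Z2 : `|Z| <= 2 * s.
  rewrite -[Z](subrK (s *: W)) (le_trans (ler_normD _ _))// normrZ gtr0_norm//.
  by nra.
have M0 : 0 < M by rewrite ME expR_gt0.
have powM : (1 + c * `|Z|) ^+ j <= M.
  apply: (@le_trans _ _ (expR (2 * c * s) ^+ j)).
    rewrite lerXn2r ?nnegrE ?expR_ge0 ?addr_ge0 ?mulr_ge0//.
    by rewrite (le_trans _ (expR_ge1Dx _))// lerD2l; nra.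
  rewrite -expRM_natr ME ler_expR; nra.
have QM i : (i < j)%N -> `|expm (s *: W) ^+ i| <= M.
  move=> ij; rewrite expm_pow (le_trans (norm_expm _))// -cE ME ler_expR scalerA normrZ.
  have ij' : (i%:R : R) <= j%:R by rewrite ler_nat ltnW.
  rewrite ger0_norm ?mulr_ge0 ?(ltW s0)//.
  apply: (@le_trans _ _ (c * t)); last by nra.
  rewrite ler_wpM2l//; apply: le_trans js.
  by rewrite -[leRHS]mulr1 ler_pM ?mulr_ge0 ?(ltW s0)// ler_wpM2r// ltW.
have IZQ : `|1%:M + Z - expm (s *: W)| <= s * d * (1 + c * expR c).
  have -> : 1%:M + Z - expm (s *: W) = (Z - s *: W) -
     (expm (s *: W) - expm 0 - (s *: W - 0)).
    by rewrite expm0; apply/matrixP => i k; rewrite !mxE; ring.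
  rewrite (le_trans (ler_normB _ _))// mulrDr mulr1 lerD//.
  have sW : `|s *: W| <= s by rewrite normrZ gtr0_norm// ler_piMr// ltW.
  apply: le_trans.
    apply: (@expm_lip _ _ _ _ (c * s)); rewrite -cE; last by rewrite normr0 mulr0 mulr_ge0// ltW.
    by rewrite ler_wpM2l.
  rewrite subr0.
  apply: (@le_trans _ _ (c * s * expR c * d)).
    apply: ler_pM => //; first by rewrite !mulr_ge0 ?expR_ge0// ltW.
      by rewrite ler_wpM2l ?mulr_ge0 ?(ltW s0)// ler_expR ler_piMr//; lra.
    by rewrite (le_trans sW)// ltW.
  by rewrite le_eqVlt; apply/orP; left; apply/eqP; ring.
have H1 := pow_sub_le Z QM; rewrite -cE in H1.
have H2 : `|expm (s *: W) ^+ j - expm (t *: W)| <= (1 + c * t * expR (c * t)) * d.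
  rewrite expm_pow scalerA.
  apply: le_trans.
    apply: (@expm_sub_le _ _ _ _ (c * t)); rewrite -cE normrZ ler_wpM2l//.
      rewrite ger0_norm ?mulr_ge0 ?(ltW s0)//.
      by rewrite -[leRHS]mulr1 ler_pM ?mulr_ge0 ?(ltW s0).
    by rewrite ger0_norm// ler_piMr.
  rewrite ler_wpM2l//; first by rewrite addr_ge0// !mulr_ge0// expR_ge0.
  rewrite -scalerBl normrZ -[leRHS]mulr1 ler_pM// ler_norml; apply/andP; split; nra.
rewrite -(subrKA (expm (s *: W) ^+ j)) (le_trans (ler_normD _ _))// mulrDl lerD//.
apply: (le_trans H1).
set b := (1 + _) ^+ j in powM *.
apply: (@le_trans _ _ (j%:R * (M * (c * M * (s * d * (1 + c * expR c)))))).
  rewrite ler_wpM2l// ler_pM//.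
  - by rewrite exprn_ge0// addr_ge0// mulr_ge0.
  - by rewrite !mulr_ge0// ltW.
  - by rewrite ler_wpM2l// mulr_ge0// ltW.
set D := 1 + c * expR c.
have D0 : 0 <= D by rewrite addr_ge0// mulr_ge0// expR_ge0.
have -> : j%:R * (M * (c * M * (s * d * D))) = (j%:R * s) * (M * (c * M * D) * d) by ring.
have -> : t * (M * (c * M * D)) * d = t * (M * (c * M * D) * d) by ring.
by rewrite ler_wpM2r// !mulr_ge0// ltW.
Qed.

(* Closedness of G: the powers (1 + s W')^(t/s) of elements of G, with W' close
   to W, converge to exp(t W). *)
Lemma lie_algebra_approx (W : 'M[R]_m) : `|W| <= 1 ->
  (forall d, 0 < d -> exists Y s, [/\ G Y, 0 < s, s < d & `|Y - 1%:M - s *: W| <= s * d]) ->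
  lie_algebra G W.
Proof.
move=> W1 HW.
have pos t : 0 <= t -> G (expm (t *: W)).
  move=> t0; apply: Lie_group_closure; last exact: expm_unit.
  move=> B /nbhs_ballP[e /= e0 eB].
  set K := (t * (expR (2 * m%:R * t) * (m%:R * expR (2 * m%:R * t) * (1 + m%:R * expR m%:R)))
    + (1 + m%:R * t * expR (m%:R * t))) : R.
  have K0 : 0 < K.
    rewrite ltr_wpDl//; first by rewrite !(mulr_ge0, addr_ge0, expR_ge0).
    by rewrite ltr_pwDl// !mulr_ge0// expR_ge0.
  have [|Y [s [GY s0 sd Ys]]] := HW (Num.min 1 (e / (2 * K))).
    by rewrite lt_min ltr01/= divr_gt0// mulr_gt0.
  exists (Y ^+ Num.truncn (t / s)); split; first exact: Lie_groupX.
  apply: eB; rewrite -ball_normE/= distrC.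
  have := @expm_approx_pow W (Y - 1%:M) t s _ _ _ erefl erefl W1 t0 s0 sd _ Ys.
  rewrite (_ : 1%:M + (Y - 1%:M) = Y); last by rewrite addrC subrK.
  rewrite ge_min lexx/= => /(_ isT) /le_lt_trans; apply.
  rewrite -/K (@le_lt_trans _ _ (K * (e / (2 * K))))//.
    by rewrite ler_wpM2l ?(ltW K0)// ge_min lexx orbT.
  have -> : K * (e / (2 * K)) = e / 2 by field; rewrite gt_eqF.
  by rewrite ltr_pdivrMr// ltr_pMr// ltr1n.
move=> t; have [t0|t0] := leP 0 t; first exact: pos.
rewrite -[t]opprK scaleNr -expm_inv; apply: Lie_groupV; apply: pos.
by rewrite oppr_ge0 ltW.
Qed.

(** Otherwise there are elements Y_k of G tending to 1 from which the Lie algebra keeps a relative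
    distance [e]. The normalised directions (Y_k - 1) / |Y_k - 1| have a cluster point W, which lies
    in the Lie algebra by [lie_algebra_approx], and its multiple by |Y_k - 1| comes too close to Y_k
    - 1 for some k. *)
Lemma lie_algebra_tangent (e : R) : 0 < e -> exists2 d, 0 < d &
  forall Y, G Y -> `|Y - 1%:M| < d ->
  exists2 W, lie_algebra G W & `|Y - 1%:M - W| <= e * `|Y - 1%:M|.
Proof.
move=> e0; apply: contrapT => Hn.
have {}Hn k : exists Y, [/\ G Y, `|Y - 1%:M| < k.+1%:R^-1 &
   forall W, lie_algebra G W -> e * `|Y - 1%:M| < `|Y - 1%:M - W|].
  apply: contrapT => Hk; apply: Hn; exists k.+1%:R^-1 => // Y GY Yk.
  apply: contrapT => HY; apply: Hk; exists Y; split => // W LW.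
  by rewrite ltNge; apply/negP => H; apply: HY; exists W.
(* Since 0 is a candidate for [W], the failure expressed by [Hn] excludes [Y k = 1]; this is what
   allows the division by [s k]. *)
have lie0 : lie_algebra G 0.
  by move=> t; rewrite scaler0 expm0; exact: Lie_group1.
pose Y k := projT1 (cid (Hn k)).
have YP k : [/\ G (Y k), `|Y k - 1%:M| < k.+1%:R^-1 &
   forall W, lie_algebra G W -> e * `|Y k - 1%:M| < `|Y k - 1%:M - W|].
  exact: (projT2 (cid (Hn k))).
pose s k := `|Y k - 1%:M|.
have s0 k : 0 < s k.
  rewrite /s lt_neqAle normr_ge0 andbT eq_sym; apply/eqP => sk0.
  have [_ _ /(_ _ lie0)] := YP k; rewrite subr0 sk0 mulr0 ltxx //.
pose U k := (s k)^-1 *: (Y k - 1%:M).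
have U1 k : `|U k| <= 1.
  by rewrite normrZ normfV gtr0_norm// -/(s k) mulVf// gt_eqF.
have UE k : s k *: U k = Y k - 1%:M by rewrite scalerA mulfV ?scale1r// gt_eqF.
have [W clW] := bounded_seq_cluster U1.
have W1 : `|W| <= 1.
  apply/ler_addgt0Pl => d d0; have [k _ Uk] := clW d 0%N d0.
  rewrite -[W](subrK (U k)) (le_trans (ler_normD _ _))// lerD// distrC ltW//.
have LW : forall a, lie_algebra G (a *: W).
  suff LW : lie_algebra G W by move=> a t; rewrite scalerA; exact: LW.
  apply: lie_algebra_approx => // d d0.
  have [N Nd] : exists N : nat, (N.+1%:R)^-1 < d.
    exists (Num.truncn d^-1); rewrite invf_plt ?posrE//; exact: truncnS_gt.
  have [k Nk Uk] := clW d N d0.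
  have [GY Yk _] := YP k; exists (Y k), (s k); split => //.
    rewrite (lt_le_trans Yk)// (le_trans _ (ltW Nd))// lef_pV2 ?posrE//.
    by rewrite ler_nat.
  by rewrite -UE -scalerBr normrZ gtr0_norm// ler_wpM2l ?(ltW (s0 k))// ltW.
have [k _ Uk] := clW e 0%N e0.
have [_ _ /(_ _ (LW (s k)))] := YP k.
rewrite -{2}UE -scalerBr normrZ gtr0_norm// mulrC -/(s k) ltr_pM2l//.
by rewrite ltNge ltW.
Qed.

End Lie_group.

(** One constant for all estimates; being at least 1, it lets every power of [K] be replaced by the
    largest one that occurs. *)
Definition chart_const (R : realType) m n (E B : 'I_n -> 'M[R]_m) (K : R) : Prop :=
  [/\ 1 <= K,
    (forall X, `|coords B X| <= K * `|X|),
    (forall x, `|Lam E x| <= K * `|x|),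
    (forall X Y : 'M[R]_m, `|X *m Y| <= K * `|X| * `|Y|) &
    (forall x y d, `|x| <= d -> `|y| <= d -> d <= 1 ->
       `|expm (Lam E x) - expm (Lam E y) - Lam E (x - y)| <= K * d * `|x - y|)].

Lemma chart_const_exists (R : realType) m n (E B : 'I_n -> 'M[R]_m) :
  exists K, chart_const E B K.
Proof.
set b := \sum_i \sum_j \sum_k `|B i j k|; set l := \sum_i `|E i|.
set c : R := m%:R.
have b0 : 0 <= b by rewrite !sumr_ge0// => *; rewrite !sumr_ge0// => *; rewrite !sumr_ge0.
have l0 : 0 <= l by rewrite !sumr_ge0.
have c0 : 0 <= c by rewrite ler0n.
set e := (c * l) * expR (c * l) * l.
have e0 : 0 <= e by rewrite !mulr_ge0// expR_ge0.
exists (1 + b + l + c + e); split.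
- by lra.
- by move=> X; rewrite (le_trans (coords_norm_le _ _))// -/b ler_wpM2r//; lra.
- by move=> x; rewrite (le_trans (Lam_norm_le _ _))// -/l ler_wpM2r//; lra.
- by move=> X Y; rewrite (le_trans (mulmx_norm_le _ _))// -/c ler_wpM2r// ler_wpM2r//; lra.
move=> x y d xd yd d1.
have d0 : 0 <= d by rewrite (le_trans _ xd).
have aux z : `|z| <= d -> m%:R * `|Lam E z| <= c * l * d.
  by move=> zd; rewrite -mulrA ler_wpM2l// (le_trans (Lam_norm_le _ _))// ler_wpM2l.
rewrite LamB; apply: (le_trans (expm_lip (aux _ xd) (aux _ yd))).
rewrite -LamB.
apply: (@le_trans _ _ (e * d * `|x - y|)); last first.
  by rewrite ler_wpM2r// ler_wpM2r//; lra.
have -> : e * d * `|x - y| = (c * l * d * expR (c * l)) * (l * `|x - y|) by rewrite /e; ring.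
apply: ler_pM => //; first by rewrite !mulr_ge0// expR_ge0.
  by rewrite ler_wpM2l ?mulr_ge0// ler_expR ler_piMr// mulr_ge0.
exact: Lam_norm_le.
Qed.

(** * The exponential chart and the Lie bracket *)

Section chart.
Variables (R : realType) (m n : nat) (G : set 'M[R]_m) (E B : 'I_n -> 'M[R]_m) (K : R).
Hypothesis HG : matrix_Lie_group G.
Hypothesis HE : is_basis_of E (lie_algebra G).
Hypothesis EB : forall x, coords B (Lam E x) = x.
Hypothesis HK : chart_const E B K.

Let K1 : 1 <= K. Proof. by case: HK. Qed.
Let K0 : 0 <= K. Proof. exact: le_trans K1. Qed.
Let Kcoords X : `|coords B X| <= K * `|X|. Proof. by case: HK. Qed.
Let KLam x : `|Lam E x| <= K * `|x|. Proof. by case: HK. Qed.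
Let Kmul (X Y : 'M[R]_m) : `|X *m Y| <= K * `|X| * `|Y|. Proof. by case: HK. Qed.
Let Kexp x y d : `|x| <= d -> `|y| <= d -> d <= 1 ->
  `|expm (Lam E x) - expm (Lam E y) - Lam E (x - y)| <= K * d * `|x - y|.
Proof. by case: HK => _ _ _ _; exact. Qed.

Lemma lie_algebra_Lam x : lie_algebra G (Lam E x).
Proof. by have [_ ->] := HE; exists x. Qed.

Lemma G_expm_Lam x : G (expm (Lam E x)).
Proof. by have := lie_algebra_Lam x 1; rewrite scale1r. Qed.

Lemma norm_le_Lam x : `|x| <= K * `|Lam E x|.
Proof. by rewrite -{1}[x]EB. Qed.

Lemma expm_Lam1 x : `|x| <= 1 -> `|expm (Lam E x) - 1%:M - Lam E x| <= K * `|x| * `|x|.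
Proof.
move=> x1; have := @Kexp x 0 `|x| (lexx _).
by rewrite normr0 normr_ge0 Lam0 expm0 subr0 => /(_ isT x1).
Qed.

(** The radius (2 K^2)^-1 makes the quadratic remainder of exp, once multiplied by [K], at most half
    of |x|, so that it can be absorbed into the left-hand side. *)
Lemma norm_le_expm x : `|x| <= (2 * K ^+ 2)^-1 -> `|x| <= 2 * K * `|expm (Lam E x) - 1%:M|.
Proof.
have K2 : 1 <= K ^+ 2 by rewrite exprn_ege1.
move=> xK; have x1 : `|x| <= 1.
  by rewrite (le_trans xK)// invf_le1; lra.
have H1 := expm_Lam1 x1; have H2 := norm_le_Lam x.
have H3 : `|Lam E x| <= `|expm (Lam E x) - 1%:M| + K * `|x| * `|x|.
  rewrite -[Lam E x in leLHS](subKr (expm (Lam E x) - 1%:M)).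
  by rewrite (le_trans (ler_normB _ _))// lerD.
have H4 : K ^+ 2 * `|x| <= 2^-1.
  rewrite -ler_pdivlMl; last by lra.
  by rewrite -invfM mulrC.
have : K * (K * `|x| * `|x|) <= 2^-1 * `|x| by rewrite !mulrA -expr2 ler_wpM2r.
have : K * `|Lam E x| <= K * (`|expm (Lam E x) - 1%:M| + K * `|x| * `|x|) by rewrite ler_wpM2l.
by lra.
Qed.

Lemma norm_expm_Lam x : `|x| <= 1 -> `|expm (Lam E x)| <= 3 * K.
Proof.
move=> x1; have H := expm_Lam1 x1.
have -> : expm (Lam E x) = (expm (Lam E x) - 1%:M - Lam E x) + (1%:M + Lam E x).
  by apply/matrixP => i j; rewrite !mxE; ring.
have := ler_normD (expm (Lam E x) - 1%:M - Lam E x) (1%:M + Lam E x).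
have := ler_normD (1%:M) (Lam E x).
have := KLam x; have := norm_scalar1_le1 R m.
have : K * `|x| <= K by rewrite ler_piMr.
have : K * `|x| * `|x| <= K * `|x| by rewrite ler_piMr// mulr_ge0.
have := K1; lra.
Qed.

Lemma expm_Lam_continuous x e : 0 < e ->
  exists2 d, 0 < d & forall y, `|x - y| < d -> `|expm (Lam E x) - expm (Lam E y)| <= e.
Proof.
move=> e0.
set a := m%:R * (K * (`|x| + 1)).
have a0 : 0 <= a by rewrite !mulr_ge0// addr_ge0.
set b := (1 + a * expR a) * K.
have b0 : 0 < b by rewrite mulr_gt0 ?(lt_le_trans ltr01 K1)// ltr_wpDr// mulr_ge0// expR_ge0.
exists (Num.min 1 (e / b)) => [|y]; first by rewrite lt_min ltr01 divr_gt0.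
rewrite lt_min => /andP[/ltW xy1 /ltW xye].
have Ha z : `|z| <= `|x| + 1 -> m%:R * `|Lam E z| <= a.
  by move=> zx; rewrite ler_wpM2l// (le_trans (KLam _))// ler_wpM2l.
apply: le_trans.
  apply: (@expm_sub_le _ _ _ _ a); apply: Ha; first by rewrite lerDl.
  rewrite -[y](subrK x) (le_trans (ler_normD _ _))// addrC lerD2l distrC //.
rewrite -LamB (@le_trans _ _ (b * `|x - y|))//.
  by rewrite /b -mulrA ler_wpM2l// addr_ge0// mulr_ge0// expR_ge0.
by rewrite mulrC -ler_pdivlMr.
Qed.

Lemma ball_argmin (f : 'cV[R]_n -> R) (r : R) : 0 <= r -> continuous f ->
  exists2 q, `|q| <= r & forall x, `|x| <= r -> f q <= f x.
Proof.
move=> r0 cf.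
pose A := [set v : 'rV[R]_n | forall i, `[(- r), r]%classic (v ord0 i)].
have cA : compact A.
  by apply: (@rV_compact R _ (fun=> `[(- r), r]%classic)) => i; exact: segment_compact.
have AE v : A v <-> `|v^T| <= r.
  split=> [Av|vr i].
    by apply: mx_norm_le => // i j; rewrite mxE ord1; have := Av i; rewrite /= in_itv/= ler_norml.
  by rewrite /= in_itv/= -ler_norml (le_trans _ vr)//; have := mx_entry_le v^T i ord0; rewrite mxE.
have tr_cont : continuous (fun v : 'rV[R]_n => v^T).
  apply: continuous_norm => v e e0; exists e => // w /ltW vw.
  rewrite -linearB/=; apply: mx_norm_le => [|i j]; first exact: ltW.
  by rewrite mxE (le_trans (mx_entry_le _ _ _)).
have [||q qA qmin] := @compact_EVT_min _ _ (fun v : 'rV[R]_n => f v^T) A _ cA.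
- by exists 0; apply/AE; rewrite trmx0 normr0.
- by apply: continuous_subspaceT => v; apply: continuous_comp; [exact: tr_cont|exact: cf].
exists q^T; first by apply/AE; exact: set_mem.
move=> x xr; have := qmin x^T; rewrite trmxK; apply; apply/mem_set/AE.
by rewrite trmxK.
Qed.

(* Cartan's closed subgroup theorem: a minimiser q of |exp(-Lam q) X - 1| leaves
   a residue Y in G that the next tangent direction would shrink, so Y = 1. *)
Lemma Lie_group_chart : exists2 d, 0 < d & forall X, G X -> `|X - 1%:M| < d ->
  exists2 q, X = expm (Lam E q) & `|q| <= 2 * K * `|X - 1%:M|.
Proof.
have [dA dA0 HA] := lie_algebra_tangent HG (e := 4^-1) ltac:(by rewrite invr_gt0).
have K0' : 0 < K := lt_le_trans ltr01 K1.
(* The number 84 is 2 (40 + 2), with the 40 and 2 of [B2] and [B1]: these two errors then amount to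
   at most s / 2, the tangent approximation adds s / 4, and minimality of [s] is contradicted. *)
pose d := Num.min dA (84 * K ^+ 6)^-1.
have d0 : 0 < d by rewrite lt_min dA0 invr_gt0 mulr_gt0// exprn_gt0.
exists d => // X GX Xd.
have dK6 : K ^+ 6 * d <= 84^-1.
  rewrite -ler_pdivlMl ?exprn_gt0// -invfM mulrC ge_min; apply/orP; right.
  by rewrite mulrC.
have dKi i : (i <= 6)%N -> K ^+ i * d <= 84^-1.
  move=> i6; apply: le_trans dK6; rewrite ler_wpM2r ?(ltW d0)//.
  by rewrite ler_weXn2l.
have dd := dKi 0%N isT; rewrite expr0 mul1r in dd.
pose r0 := (2 * K ^+ 2)^-1.
have r00 : 0 < r0 by rewrite invr_gt0 mulr_gt0// exprn_gt0.
have r01 : r0 <= 1.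
  have K2 : 1 <= K ^+ 2 by rewrite exprn_ege1.
  by rewrite invf_le1; lra.
have [|q qr qmin] := @ball_argmin (fun q => `|expm (Lam E (- q)) *m X - 1%:M|) r0 (ltW r00).
  apply: continuous_norm => x e e0.
  have e0' : 0 < e / (K * `|X| + 1) by rewrite divr_gt0// ltr_wpDl// mulr_ge0.
  have [d' d'0 Hd'] := expm_Lam_continuous (- x) e0'.
  exists d' => // y xy; rewrite (le_trans (ler_dist_dist _ _))//.
  rewrite opprB addrA subrK -mulmxBl (le_trans (Kmul _ _))//.
  rewrite mulrAC (@le_trans _ _ ((K * `|X| + 1) * (e / (K * `|X| + 1))))//; last first.
    by rewrite mulrC mulfVK// gt_eqF// ltr_wpDl// mulr_ge0.
  rewrite ler_pM ?mulr_ge0//; first by rewrite lerDl.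
  by apply: Hd'; rewrite -opprD normrN.
set Y := expm (Lam E (- q)) *m X in qmin.
have GY : G Y by apply: Lie_groupM => //; exact: G_expm_Lam.
have XE : X = expm (Lam E q) *m Y by rewrite /Y LamN mulmxA expmN mul1mx.
pose s := `|Y - 1%:M|.
have sX : s <= `|X - 1%:M|.
  by have := qmin 0; rewrite normr0 oppr0 Lam0 expm0 mul1mx; apply; exact: ltW.
have [s0|s0] := eqVneq s 0.
  have Y1 : Y = 1%:M by apply/eqP; rewrite -subr_eq0 -normr_eq0 -/s s0.
  have Xq : X = expm (Lam E q) by rewrite XE Y1 mulmx1.
  by exists q => //; rewrite Xq; exact: norm_le_expm.
exfalso.
have {}s0 : 0 < s by rewrite lt_neqAle eq_sym s0 normr_ge0.
have sd : s <= d by rewrite (le_trans sX)// ltW.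
have q1 : `|q| <= 1 by exact: le_trans qr _.
have Kd : d <= K ^+ 2 * d by rewrite ler_peMl ?(ltW d0)// exprn_ege1.
have Eq : `|expm (Lam E q) - 1%:M| <= 4 * (K ^+ 2 * d).
  have -> : expm (Lam E q) - 1%:M = (X - 1%:M) - expm (Lam E q) *m (Y - 1%:M).
    by rewrite mulmxBr -XE mulmx1; apply/matrixP => i j; rewrite !mxE; ring.
  rewrite (le_trans (ler_normB _ _))//.
  have : `|expm (Lam E q) *m (Y - 1%:M)| <= K * (3 * K) * d.
    rewrite (le_trans (Kmul _ _))// ler_pM ?mulr_ge0//.
    by rewrite ler_wpM2l// norm_expm_Lam.
  by rewrite -[K * (3 * K)]mulrCA -expr2; lra.
(* The minimiser is only known to lie in the ball of radius [r0]; being in fact of size O(d), it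
   leaves room for the competitor [q + w] in that ball. *)
have q8 : `|q| <= 8 * (K ^+ 3 * d).
  rewrite (le_trans (norm_le_expm qr))//.
  apply: (@le_trans _ _ (2 * K * (4 * (K ^+ 2 * d)))); first by rewrite ler_wpM2l// mulr_ge0.
  by rewrite le_eqVlt; apply/orP; left; apply/eqP; ring.
have [|W LW YW] := HA Y GY.
  by rewrite -/s (le_lt_trans sX)// (lt_le_trans Xd)// ge_min lexx.
have [w wE] : exists w, W = Lam E w by apply/(proj2 HE).
rewrite wE -/s in YW.
have Lw : `|Lam E w| <= 2 * s.
  rewrite -[Lam E w](subKr (Y - 1%:M)) (le_trans (ler_normB _ _))// -/s; lra.
have w2 : `|w| <= 2 * (K * s).
  by rewrite (le_trans (norm_le_Lam w))// mulrCA ler_wpM2l.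
pose p := 10 * (K ^+ 3 * d).
have K3d : K * d <= K ^+ 3 * d by rewrite ler_wpM2r ?(ltW d0)// -{1}[K]expr1 ler_weXn2l.
have w2' : `|w| <= 2 * (K * d) by rewrite (le_trans w2)// ler_wpM2l// ler_wpM2l.
have qp : `|q| <= p by have := mulr_ge0 (exprn_ge0 3 K0) (ltW d0); rewrite /p; lra.
have qwp : `|q + w| <= p by rewrite (le_trans (ler_normD _ _))// /p; lra.
have p1 : p <= 1 by have := dKi 3 isT; rewrite /p; lra.
have pr0 : p <= r0.
  rewrite /p /r0 -[leRHS]mul1r ler_pdivlMr ?mulr_gt0 ?exprn_gt0//.
  have -> : 10 * (K ^+ 3 * d) * (2 * K ^+ 2) = 20 * (K ^+ 5 * d) by ring.
  by have := dKi 5 isT; lra.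
have H : s <= `|expm (Lam E (- (q + w))) *m X - 1%:M|.
  by apply: qmin; rewrite (le_trans qwp).
have kq := @Kexp (- (q + w)) (- q) p; rewrite !normrN in kq.
have {}kq := kq qwp qp p1.
have NE : - (q + w) - - q = - w by rewrite opprK opprD addrAC addNr add0r.
rewrite NE LamN normrN opprK in kq.
set Rm := _ + Lam E w in kq.
(* Replacing [q] by [q + w] subtracts [Lam E w] from [Y - 1] up to two products, each of size d
   times [s]: [Rm] is the remainder of exp between [-q] and [-(q + w)]. *)
have EE : expm (Lam E (- (q + w))) *m X - 1%:M =
   (Y - 1%:M - Lam E w) + (Rm *m X - Lam E w *m (X - 1%:M)).
  rewrite /Rm /Y mulmxDl mulmxBl mulmxBr mulmx1.
  by apply/matrixP => i j; rewrite ![in LHS]mxE ![in RHS]mxE; ring.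
have X2 : `|X| <= 2.
  rewrite -[X](subrK 1%:M) (le_trans (ler_normD _ _))//.
  by have := norm_scalar1_le1 R m; lra.
have B1 : `|Lam E w *m (X - 1%:M)| <= 2 * (K * d) * s.
  rewrite (le_trans (Kmul _ _))//.
  have -> : 2 * (K * d) * s = K * (2 * s) * d by ring.
  by rewrite ler_pM ?mulr_ge0 ?(ltW Xd)// ler_wpM2l.
have B2 : `|Rm *m X| <= 40 * (K ^+ 6 * d) * s.
  rewrite (le_trans (Kmul _ _))//.
  have -> : 40 * (K ^+ 6 * d) * s = K * (K * p * (2 * (K * s))) * 2 by rewrite /p; ring.
  rewrite ler_pM ?mulr_ge0//.
  have p0 : 0 <= p by exact: le_trans (normr_ge0 _) qp.
  by rewrite ler_wpM2l// (le_trans kq)// ler_wpM2l// mulr_ge0.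
have := ler_normD (Y - 1%:M - Lam E w) (Rm *m X - Lam E w *m (X - 1%:M)).
have := ler_normB (Rm *m X) (Lam E w *m (X - 1%:M)).
rewrite EE in H.
have : 2 * (K * d) * s <= 2 * 84^-1 * s.
  rewrite ler_wpM2r ?(ltW s0)// ler_wpM2l//.
  by have := dKi 1%N isT; rewrite expr1.
have : 40 * (K ^+ 6 * d) * s <= 40 * 84^-1 * s.
  by rewrite ler_wpM2r ?(ltW s0)// ler_wpM2l//.
lra.
Qed.

(** Membership becomes a continuous linear equation, which survives limits. *)
Lemma lie_algebraP X : lie_algebra G X <-> Lam E (coords B X) = X.
Proof.
have [_ HX] := HE; rewrite HX; split=> [[x ->]|<-]; first by rewrite EB.
by exists (coords B X).
Qed.

Lemma Laminv_coords X : lie_algebra G X -> Laminv E X = coords B X.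
Proof.
move=> /lie_algebraP LX; rewrite /Laminv; apply: xget_unique => // y <-.
by rewrite EB.
Qed.

(** The bracket is the derivative at 0 of exp(uX) Y exp(-uX). Conjugation by group elements
    preserves the Lie algebra, and the latter is a linear space because [E] spans it, so the
    difference quotients [D k] stay inside, and so does their limit. *)
Lemma lie_algebra_bracket X Y : lie_algebra G X -> lie_algebra G Y ->
  lie_algebra G (X *m Y - Y *m X).
Proof.
move=> GX GY.
pose u k : R := k.+1%:R^-1.
have u0 : u @ \oo --> (0 : R) by exact: cvg_harmonic.
pose D k := (u k)^-1 *: (expm (u k *: X) *m Y *m expm (- (u k *: X)) - Y).
have LD k : lie_algebra G (D k).
  have LC : lie_algebra G (expm (u k *: X) *m Y *m expm (- (u k *: X))).
    move=> t; rewrite -expm_inv.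
    rewrite scalemxAl scalemxAr expm_conj ?expm_unit//; apply: Lie_groupM => //; last first.
      by apply: Lie_groupV => //; exact: GX.
    by apply: Lie_groupM.
  have [_ HX] := HE; move: LC GY => /HX[a aE] /HX[b bE]; apply/HX.
  by exists ((u k)^-1 *: (a - b)); rewrite /D aE bE LamZ LamB.
have expu (Z : 'M[R]_m) : (fun k => (u k)^-1 *: (expm (u k *: Z) - 1%:M)) @ \oo --> Z.
  apply/cvgrPdist_le => e e0.
  set c : R := m%:R * `|Z|.
  have c0 : 0 <= c by rewrite mulr_ge0.
  set b := c * expR c * `|Z|.
  have b0 : 0 <= b by rewrite !mulr_ge0// expR_ge0.
  near=> k.
  have uk0 : 0 < u k by rewrite invr_gt0.
  have uk1 : u k <= 1 by rewrite invf_le1// ler1n.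
  have -> : Z - (u k)^-1 *: (expm (u k *: Z) - 1%:M) =
     - ((u k)^-1 *: (expm (u k *: Z) - expm 0 - (u k *: Z - 0))).
    by rewrite expm0 subr0 [in RHS]scalerBr scalerA mulVf ?gt_eqF// scale1r opprB.
  rewrite normrN normrZ normfV gtr0_norm// ler_pdivrMl//.
  apply: le_trans.
    apply: (@expm_lip _ _ (u k *: Z) 0 (c * u k)); last by rewrite normr0 mulr0 mulr_ge0// ltW.
    by rewrite normrZ gtr0_norm// /c mulrA [leLHS]mulrAC.
  rewrite subr0 normrZ gtr0_norm//.
  apply: (@le_trans _ _ (u k * (b * u k))).
    have -> : u k * (b * u k) = c * u k * expR c * (u k * `|Z|) by rewrite /b; ring.
    rewrite ler_wpM2r ?mulr_ge0 ?(ltW uk0)// ler_wpM2l ?mulr_ge0 ?(ltW uk0)//.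
    by rewrite ler_expR ler_piMr.
  rewrite ler_wpM2l ?(ltW uk0)// (@le_trans _ _ ((b + 1) * u k))//.
    by rewrite ler_wpM2r ?(ltW uk0)// lerDl.
  rewrite mulrC -ler_pdivlMr; last by rewrite ltr_wpDl.
  near: k; have /cvgr0Pnorm_le := u0.
  move=> /(_ (e / (b + 1))) []; first by rewrite divr_gt0// ltr_wpDl.
  by move=> N _ HN; exists N => // k /HN; apply: le_trans; exact: ler_norm.
have exp1 (Z : 'M[R]_m) : (fun k => expm (u k *: Z)) @ \oo --> (1%:M : 'M[R]_m).
  have -> : (fun k => expm (u k *: Z)) =
    (fun k => u k *: ((u k)^-1 *: (expm (u k *: Z) - 1%:M)) + 1%:M).
    by apply/funext => k; rewrite scalerA mulfV ?scale1r ?subrK// gt_eqF// invr_gt0.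
  rewrite -[X in _ --> X]add0r; apply: cvgD; last exact: cvg_cst.
  by rewrite -(scale0r Z); apply: cvgZ.
have DXY : D @ \oo --> X *m Y - Y *m X.
  have -> : D = fun k => ((u k)^-1 *: (expm (u k *: X) - 1%:M)) *m Y *m expm (u k *: (- X))
     + Y *m ((u k)^-1 *: (expm (u k *: (- X)) - 1%:M)).
    apply/funext => k; rewrite /D -scalemxAl -scalemxAl -scalemxAr -scalerDr scalerN.
    by rewrite mulmxBr !mulmxBl mul1mx mulmx1 addrA subrK.
  have -> : X *m Y - Y *m X = X *m Y *m 1%:M + Y *m (- X).
    by rewrite mulmx1 mulmxN.
  apply: cvgD; last by apply: cvg_mulmx; [exact: cvg_cst|exact: expu].
  by apply: cvg_mulmx => //; apply: cvg_mulmx; [exact: expu|exact: cvg_cst].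
apply/lie_algebraP/eqP; rewrite -subr_eq0 -normr_le0; apply/ler_addgt0Pl => e e0.
rewrite addr0; set Z := X *m Y - _.
have [k Hk] : exists k, `|Z - D k| <= e / (K * K + 1).
  have /cvgrPdist_le/(_ (e / (K * K + 1)))[] := DXY.
    by rewrite divr_gt0// ltr_wpDl// mulr_ge0.
  by move=> N _ HN; exists N; apply: HN => /=.
(* [D k] satisfies the equation of [lie_algebraP], so by linearity the defect of [Z] is the defect
   of the small matrix [Z - D k]. *)
have -> : Lam E (coords B Z) - Z = Lam E (coords B (Z - D k)) - (Z - D k).
  have /lie_algebraP LDk := LD k.
  rewrite (coordsB B Z (D k)) LamB LDk; clearbody Z.
  by apply/matrixP => i j; rewrite !mxE; ring.
rewrite (le_trans (ler_normB _ _))//.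
apply: (@le_trans _ _ ((K * K + 1) * `|Z - D k|)).
  by rewrite mulrDl mul1r lerD2r -mulrA (le_trans (KLam _))// ler_wpM2l.
by rewrite mulrC -ler_pdivlMr// ltr_wpDl// mulr_ge0.
Unshelve. all: by end_near. Qed.

End chart.

(** * Strict differentiability *)

Section C1_strict.
Variables (R : realType) (U : normedModType R).

Lemma continuous_norm_inv (V : normedModType R) (f : U -> V) x e :
  continuous f -> 0 < e ->
  exists2 d, 0 < d & forall y, `|x - y| < d -> `|f x - f y| <= e.
Proof.
move=> cf e0; have /cvgrPdist_le/(_ _ e0)/nbhs_ballP[d /= d0 Hd] := cf x.
by exists d => // y xy; apply: Hd; rewrite -ball_normE.
Qed.

Lemma is_derive_line (f : U -> R) (x v : U) (s : R) :
  derivable f (x + s *: v) v ->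
  is_derive s 1 (fun s => f (x + s *: v)) ('D_v f (x + s *: v)).
Proof.
have E : (fun h => h^-1 *: (((fun s => f (x + s *: v)) \o shift s) (h *: (1 : R)) - f (x + s *: v))) =
  (fun h => h^-1 *: ((f \o shift (x + s *: v)) (h *: v) - f (x + s *: v))).
  apply/funext => h /=; congr (_ *: (f _ - _)).
  by rewrite [h *: 1]mulr1 scalerDl addrCA.
by move=> df; split; rewrite /derivable /derive E.
Qed.

(** The mean value theorem along the line gives a derivative at an intermediate point, and
    continuity of ['D_v f] compares it with the one at [x0]. The base point [x] is free, as the
    induction in [C1_strict] moves it. *)
Lemma C1_strict1 (f : U -> R) x0 v e : C1 f -> 0 < e ->
  exists2 d, 0 < d & forall x c, `|x - x0| < d -> `|c| < d ->
    `|f (x + c *: v) - f x - c * 'D_v f x0| <= e * `|c|.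
Proof.
move=> /(_ v)[df cf] e0; have [d d0 Hd] := continuous_norm_inv x0 cf e0.
have v0 : 0 < 1 + `|v| by rewrite ltr_pwDl.
(* Half of [d] is reserved for the base point, the other half for the increment along [v]. *)
exists (d / 2 / (1 + `|v|)); first by rewrite !divr_gt0.
have dd : d / 2 / (1 + `|v|) <= d / 2 by rewrite ler_pdivrMr// ler_peMr ?lerDl// divr_ge0// ltW.
move=> x c xd cd.
have H s : `|s| <= `|c| -> `|'D_v f (x + s *: v) - 'D_v f x0| <= e.
  move=> sc; rewrite distrC; apply: Hd.
  rewrite distrC addrAC (le_lt_trans (ler_normD _ _))// normrZ.
  have : `|s| * `|v| <= d / 2.
    apply: (@le_trans _ _ (`|c| * (1 + `|v|))); first by rewrite ler_pM// lerDr.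
    by rewrite -ler_pdivlMr// ltW.
  by move: xd dd; lra.
pose g := (fun s => f (x + s *: v)).
have dg (s : R) : is_derive s (1 : R) g ('D_v f (x + s *: v)) by exact: is_derive_line.
have cg : continuous g.
  by move=> s; apply/differentiable_continuous/derivable1_diffP; have [] := dg s.
suff [s sc Hs] : exists2 s, `|s| <= `|c| & g c - g 0 = 'D_v f (x + s *: v) * c.
  move: Hs; rewrite /g scale0r addr0 => ->.
  by rewrite [c * _]mulrC -mulrBl normrM ler_wpM2r// H.
have [c0|c0] := leP 0 c.
  have [s] := MVT_segment c0 (fun s _ => dg s) (continuous_subspaceT cg).
  rewrite in_itv/= => /andP[s0 sc]; rewrite subr0 => Hs; exists s => //.
  by rewrite !ger0_norm.
have [s] := MVT_segment (ltW c0) (fun s _ => dg s) (continuous_subspaceT cg).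
rewrite in_itv/= => /andP[s0 sc]; rewrite sub0r => Hs; exists s => //.
  by rewrite !ler0_norm// ?lerN2// ltW.
by rewrite -opprB Hs mulrN opprK.
Qed.

(** The increment is made one direction at a time. All partial derivatives are taken at [x0], not at
    the successive intermediate points, which is where their continuity enters. *)
Lemma C1_strict (f : U -> R) x0 (I : Type) (v : I -> U) (s : seq I) e : C1 f -> 0 < e ->
  exists2 d, 0 < d & forall x (c : I -> R), `|x - x0| < d ->
    (forall i, `|c i| < d) ->
    `|f (x + \sum_(i <- s) c i *: v i) - f x - \sum_(i <- s) c i * 'D_(v i) f x0|
      <= e * \sum_(i <- s) `|c i|.
Proof.
move=> Cf e0; elim: s => [|i s [d d0 IH]].
  exists 1 => // x c _ _; rewrite !big_nil addr0 subrr subr0 normr0 mulr0//.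
have [d' d'0 Hd'] := @C1_strict1 f x0 (v i) e Cf e0.
have v0 : 0 < 1 + `|v i| by rewrite ltr_pwDl.
exists (Num.min d' (d / 2 / (1 + `|v i|))); first by rewrite lt_min d'0 !divr_gt0.
have dd : d / 2 / (1 + `|v i|) <= d / 2 by rewrite ler_pdivrMr// ler_peMr ?lerDl// divr_ge0// ltW.
have d2d : d / 2 <= d by lra.
move=> x c; rewrite lt_min => /andP[xd' xd] cd.
have cd' j : `|c j| < d' /\ `|c j| < d / 2 / (1 + `|v i|).
  by have := cd j; rewrite lt_min => /andP.
rewrite !big_cons addrA mulrDr.
have := Hd' x (c i) xd' (cd' i).1.
have : `|(x + c i *: v i) - x0| < d.
  rewrite addrAC (le_lt_trans (ler_normD _ _))// normrZ.
  have : `|c i| * `|v i| <= d / 2.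
    apply: (@le_trans _ _ (`|c i| * (1 + `|v i|))); first by rewrite ler_pM// lerDr.
    by rewrite -ler_pdivlMr// ltW// (cd' i).2.
  by move: xd dd; lra.
move=> /IH H1 H2.
have {}H1 := H1 c (fun j => lt_le_trans (cd' j).2 (le_trans dd d2d)).
apply: le_trans (lerD H2 H1); apply: le_trans (ler_normD _ _).
rewrite le_eqVlt; apply/orP; left; apply/eqP; congr (`|_|); ring.
Qed.

End C1_strict.

(* Strict differentiability at x0: both endpoints of the increment vary, so that
   the estimate is uniform in the base point and survives a change of chart. *)
Definition sdiff (R : realType) (U : normedModType R) (f : U -> R) (x0 : U)
    (L : U -> R) : Prop :=
  (exists C, forall x, `|L x| <= C * `|x|) /\
  forall e, 0 < e -> exists2 d, 0 < d & forall x y, `|x - x0| < d -> `|y - x0| < d ->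
    `|f y - f x - L (y - x)| <= e * `|y - x|.

Section sdiff_theory.
Variables (R : realType) (U : normedModType R).
Implicit Types (f g : U -> R) (x : U).

Lemma sdiff_lip f x0 L : sdiff f x0 L ->
  exists C d, [/\ 0 <= C, 0 < d & forall x y, `|x - x0| < d -> `|y - x0| < d ->
    `|f y - f x| <= C * `|y - x|].
Proof.
move=> [[C HC] /(_ 1 ltr01)[d d0 Hd]]; exists (1 + `|C|), d; split => // x y xd yd.
rewrite -(subrK (L (y - x)) (f y - f x)) (le_trans (ler_normD _ _))// mulrDl.
by rewrite lerD ?Hd// (le_trans (HC _))// ler_wpM2r// ler_norm.
Qed.

Lemma eq_sdiff f g x0 L M : f =1 g -> L =1 M -> sdiff f x0 L -> sdiff g x0 M.
Proof. by move=> /funext -> /funext ->. Qed.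

Lemma sdiff_cst (c : R) x0 : sdiff (fun _ : U => c) x0 (fun=> 0).
Proof.
split; first by exists 0 => x; rewrite normr0 mul0r.
by move=> e e0; exists 1 => // x y _ _; rewrite !subrr normr0 mulr_ge0// ltW.
Qed.

Lemma sdiffD f g x0 L M : sdiff f x0 L -> sdiff g x0 M ->
  sdiff (fun x => f x + g x) x0 (fun x => L x + M x).
Proof.
move=> [[C HC] Hf] [[D HD] Hg]; split.
  by exists (C + D) => x; rewrite (le_trans (ler_normD _ _))// mulrDl lerD.
move=> e e0; have e20 : 0 < e / 2 by rewrite divr_gt0.
have [d1 d10 H1] := Hf _ e20; have [d2 d20 H2] := Hg _ e20.
exists (Num.min d1 d2) => [|x y]; first by rewrite lt_min d10.
rewrite !lt_min => /andP[x1 x2] /andP[y1 y2].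
have -> : f y + g y - (f x + g x) - (L (y - x) + M (y - x)) =
  (f y - f x - L (y - x)) + (g y - g x - M (y - x)) by ring.
by rewrite (le_trans (ler_normD _ _))// [e]splitr mulrDl lerD ?H1 ?H2.
Qed.

Lemma sdiffM f g x0 L M : sdiff f x0 L -> sdiff g x0 M ->
  sdiff (fun x => f x * g x) x0 (fun x => g x0 * L x + f x0 * M x).
Proof.
move=> sf sg; have [Cf [df [Cf0 df0 lf]]] := sdiff_lip sf.
have [Cg [dg [Cg0 dg0 lg]]] := sdiff_lip sg.
case: sf => [[C HC] Hf]; case: sg => [[D HD] Hg]; split.
  exists (`|g x0| * C + `|f x0| * D) => x; rewrite (le_trans (ler_normD _ _))//.
  by rewrite mulrDl !normrM -!mulrA lerD// ler_wpM2l.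
(* [k] dominates the Lipschitz constants and local bounds of both factors. With e1 = e / (4 k^2),
   each of the two groups of error terms, 2 k e1 and 2 k^2 e1, is at most e / 2. *)
move=> e e0; pose k := Num.max (Num.max 1 (Num.max `|C| `|D|)) (Num.max (Cg + `|g x0|) (Cf + `|f x0|)).
have [k1 Ck Dk gk fk] : [/\ 1 <= k, `|C| <= k, `|D| <= k, Cg + `|g x0| <= k & Cf + `|f x0| <= k].
  by rewrite /k !le_max !lexx ?orbT.
have [e1 e10 e1e] : exists2 e1, 0 < e1 & 2 * k * e1 + 2 * (k * (k * e1)) <= e.
  exists (e / (4 * (k * k))); first by rewrite divr_gt0// mulr_gt0// mulr_gt0//; lra.
  set a := e / _.
  have kk : 1 <= k * k by rewrite -[1]mul1r ler_pM.
  have aE : k * k * a = e / 4 by rewrite /a; field; rewrite gt_eqF//; lra.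
  have a0 : 0 < a by rewrite divr_gt0//; lra.
  have : k * a <= k * k * a by rewrite ler_wpM2r ?(ltW a0)// ler_peMr//; lra.
  by rewrite mulrA aE; lra.
have [d1 d10 H1] := Hf _ e10; have [d2 d20 H2] := Hg _ e10.
pose d := Num.min (Num.min df dg) (Num.min (Num.min d1 d2) (Num.min 1 e1)).
have d0 : 0 < d by rewrite !lt_min df0 dg0 d10 d20 e10 ltr01.
exists d => // x y; rewrite !lt_min.
move=> /andP[/andP[xf xg] /andP[/andP[x1 x2] /andP[x3 x4]]].
move=> /andP[/andP[yf yg] /andP[/andP[y1 y2] /andP[y3 y4]]].
have -> : f y * g y - f x * g x - (g x0 * L (y - x) + f x0 * M (y - x)) =
  (f y - f x - L (y - x)) * g y + L (y - x) * (g y - g x0) +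
  (f x * (g y - g x - M (y - x)) + (f x - f x0) * M (y - x)) by ring.
have gy : `|g y - g x0| <= Cg * e1.
  by rewrite (le_trans (lg _ _ _ _))// ?subrr ?normr0// ler_wpM2l// ltW.
have fx : `|f x - f x0| <= Cf * e1.
  by rewrite (le_trans (lf _ _ _ _))// ?subrr ?normr0// ler_wpM2l// ltW.
have gyk : `|g y| <= k.
  rewrite -(subrK (g x0) (g y)) (le_trans (ler_normD _ _))// (le_trans _ gk)// lerD2r.
  by rewrite (le_trans (lg _ _ _ _))// ?subrr ?normr0// ler_piMr// ltW.
have fxk : `|f x| <= k.
  rewrite -(subrK (f x0) (f x)) (le_trans (ler_normD _ _))// (le_trans _ fk)// lerD2r.
  by rewrite (le_trans (lf _ _ _ _))// ?subrr ?normr0// ler_piMr// ltW.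
have Lk : `|L (y - x)| <= k * `|y - x|.
  by rewrite (le_trans (HC _))// ler_wpM2r// (le_trans (ler_norm _)).
have Mk : `|M (y - x)| <= k * `|y - x|.
  by rewrite (le_trans (HD _))// ler_wpM2r// (le_trans (ler_norm _)).
have Cgk : Cg <= k by rewrite (le_trans _ gk)// lerDl.
have Cfk : Cf <= k by rewrite (le_trans _ fk)// lerDl.
clearbody k d; set z := `|y - x| in Lk Mk *.
have z0 : 0 <= z by exact: normr_ge0.
apply: (@le_trans _ _ ((2 * k * e1 + 2 * (k * (k * e1))) * z)); last by rewrite ler_wpM2r.
have -> : (2 * k * e1 + 2 * (k * (k * e1))) * z =
  (e1 * z * k + (k * z) * (k * e1)) + (k * (e1 * z) + (k * e1) * (k * z)) by ring.
have ke : `|g y - g x0| <= k * e1 by rewrite (le_trans gy)// ler_wpM2r// ltW.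
have ke' : `|f x - f x0| <= k * e1 by rewrite (le_trans fx)// ler_wpM2r// ltW.
rewrite (le_trans (ler_normD _ _))// lerD// (le_trans (ler_normD _ _))// lerD// normrM ler_pM//.
- by rewrite H1.
- by rewrite H2.
Qed.

End sdiff_theory.

(** * Strict differentials in chart coordinate, time and parameter *)

Section sdiff3.
Variables (R : realType) (n : nat).
Local Notation U := ('cV[R]_n * R * R)%type.

(* A point of U is (q, t, c): exponential coordinates q, time t, and the scalar
   parameter c along a fixed direction of parameter space. *)
Definition lin3 (A : 'cV[R]_n) (a b : R) (x : U) : R :=
  dotv A x.1.1 + x.1.2 * a + x.2 * b.

Lemma dotvE (x y : 'cV[R]_n) : dotv x y = \sum_i x i 0 * y i 0.
Proof. by rewrite /dotv mxE; apply: eq_bigr => i _; rewrite mxE. Qed.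

Lemma dotv_norm_le (x y : 'cV[R]_n) : `|dotv x y| <= n%:R * `|x| * `|y|.
Proof.
by rewrite (le_trans (mx_entry_le _ _ _))// (le_trans (mulmx_norm_le _ _))//
  ler_wpM2r// ler_wpM2l// mx_norm_le// => i j; rewrite mxE mx_entry_le.
Qed.

Lemma dotvDr (x y z : 'cV[R]_n) : dotv x (y + z) = dotv x y + dotv x z.
Proof. by rewrite /dotv mulmxDr mxE. Qed.

Lemma dotvDl (x y z : 'cV[R]_n) : dotv (x + y) z = dotv x z + dotv y z.
Proof. by rewrite /dotv linearD/= mulmxDl mxE. Qed.

Lemma dotvZl a (x y : 'cV[R]_n) : dotv (a *: x) y = a * dotv x y.
Proof. by rewrite /dotv linearZ/= -scalemxAl mxE. Qed.

Lemma dotvZr a (x y : 'cV[R]_n) : dotv x (a *: y) = a * dotv x y.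
Proof. by rewrite /dotv -scalemxAr mxE. Qed.

Lemma dotv0l (x : 'cV[R]_n) : dotv 0 x = 0.
Proof. by rewrite -(scale0r 0) dotvZl mul0r. Qed.

Lemma dotv0r (x : 'cV[R]_n) : dotv x 0 = 0.
Proof. by rewrite -(scale0r 0) dotvZr mul0r. Qed.

Lemma dotvBr (x y z : 'cV[R]_n) : dotv x (y - z) = dotv x y - dotv x z.
Proof. by rewrite dotvDr -scaleN1r dotvZr mulN1r. Qed.

Lemma dotvBl (x y z : 'cV[R]_n) : dotv (x - y) z = dotv x z - dotv y z.
Proof. by rewrite dotvDl -scaleN1r dotvZl mulN1r. Qed.

Lemma dotv_ev (x : 'cV[R]_n) i : dotv x (ev i) = x i 0.
Proof.
rewrite dotvE (bigD1 i)//= big1 ?addr0 => [|k ki]; rewrite /ev mxE ?eqxx ?mulr1//.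
by rewrite (negbTE ki) mulr0.
Qed.

Lemma sdiff3_sum (I : finType) (f : I -> U -> R) x0 (c : I -> R) A a b :
  (forall i, sdiff (f i) x0 (lin3 (A i) (a i) (b i))) ->
  sdiff (fun x => \sum_i c i * f i x) x0
    (lin3 (\sum_i c i *: A i) (\sum_i c i * a i) (\sum_i c i * b i)).
Proof.
move=> H; elim: (index_enum I) => [|i s IH].
  have -> : lin3 (\sum_(i <- [::]) c i *: A i) (\sum_(i <- [::]) c i * a i)
      (\sum_(i <- [::]) c i * b i) = fun=> 0.
    by apply/funext => x; rewrite /lin3 !big_nil dotv0l !mulr0 !addr0.
  by under eq_fun do rewrite big_nil; exact: sdiff_cst.
have -> : (fun x => \sum_(j <- i :: s) c j * f j x) =
  (fun x => c i * f i x + \sum_(j <- s) c j * f j x).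
  by apply/funext => x; rewrite big_cons.
have := sdiffD (sdiffM (@sdiff_cst R _ (c i) x0) (H i)) IH.
by apply: eq_sdiff => // x; rewrite /lin3 !big_cons dotvDl dotvZl; ring.
Qed.

Definition has_sdiff3 (f : U -> R) x0 := exists A a b, sdiff f x0 (lin3 A a b).

Lemma eq_has_sdiff3 f g x0 : f =1 g -> has_sdiff3 f x0 -> has_sdiff3 g x0.
Proof. by move=> /funext ->. Qed.

Lemma has_sdiff3M f g x0 : has_sdiff3 f x0 -> has_sdiff3 g x0 ->
  has_sdiff3 (fun x => f x * g x) x0.
Proof.
move=> [A [a [b Hf]]] [A' [a' [b' Hg]]].
exists (g x0 *: A + f x0 *: A'), (g x0 * a + f x0 * a'), (g x0 * b + f x0 * b').
have := sdiffM Hf Hg.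
by apply: eq_sdiff => // x; rewrite /lin3 dotvDl !dotvZl; ring.
Qed.

Lemma has_sdiff3_sum (I : finType) (f : I -> U -> R) x0 (c : I -> R) :
  (forall i, has_sdiff3 (f i) x0) -> has_sdiff3 (fun x => \sum_i c i * f i x) x0.
Proof.
move=> H.
pose A i := projT1 (cid (H i)); have HA i := projT2 (cid (H i)).
pose a i := projT1 (cid (HA i)); have Ha i := projT2 (cid (HA i)).
pose b i := projT1 (cid (Ha i)); have Hb i := projT2 (cid (Ha i)).
by do 3 eexists; exact: (sdiff3_sum c Hb).
Qed.

(** The three data have different parameter spaces: time and parameter for [f], the parameter alone
    for [F], parameter and time for [r]. The affine map given by [w0], [vt] and [ve] brings them to
    the common variables (q, t, c); [vt = 0] is the case of [F]. *)
Lemma C1_sdiff3 (W : normedModType R) (f : 'cV[R]_n * W -> R) (w0 vt ve : W) x0 :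
  C1 f -> has_sdiff3 (fun x => f (x.1.1, w0 + x.1.2 *: vt + x.2 *: ve)) x0.
Proof.
move=> Cf; pose em (x : U) : 'cV[R]_n * W := (x.1.1, w0 + x.1.2 *: vt + x.2 *: ve).
pose v (i : 'I_n + bool) : 'cV[R]_n * W :=
  match i with inl i => (ev i, 0) | inr true => (0, vt) | inr false => (0, ve) end.
pose s := [seq inl i | i <- index_enum 'I_n] ++ [:: inr true; inr false].
pose A := \col_i 'D_(ev i, 0) f (em x0).
exists A, ('D_(0, vt) f (em x0)), ('D_(0, ve) f (em x0)).
have sumE (V : zmodType) (F : 'I_n + bool -> V) :
    \sum_(i <- s) F i = \sum_i F (inl i) + F (inr true) + F (inr false).
  by rewrite big_cat big_map/= !big_cons big_nil addr0 addrA.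
split.
  exists (n%:R * `|A| + `|'D_(0, vt) f (em x0)| + `|'D_(0, ve) f (em x0)|) => x.
  rewrite /lin3 !mulrDl (le_trans (ler_normD _ _))// lerD//; last first.
    by rewrite normrM mulrC ler_wpM2l// prod_normE le_max lexx orbT.
  have x1 : `|x.1| <= `|x| by rewrite [leRHS]prod_normE le_max lexx.
  rewrite (le_trans (ler_normD _ _))// lerD//; last first.
    rewrite normrM mulrC ler_wpM2l// (le_trans _ x1)//.
    by rewrite prod_normE le_max lexx orbT.
  rewrite (le_trans (dotv_norm_le _ _))// ler_wpM2l ?mulr_ge0// (le_trans _ x1)//.
  by rewrite prod_normE le_max lexx.
move=> e e0.
(* There are n + 2 directions, and each coordinate of the increment is at most its norm. *)
have e0' : 0 < e / (n + 2)%:R by rewrite divr_gt0// ltr0n addn2.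
have [d d0 Hd] := C1_strict (em x0) v s Cf e0'.
(* A Lipschitz constant for the affine map [em]. *)
pose k := 1 + `|vt| + `|ve|.
have k1 : 1 <= k by rewrite /k -addrA lerDl addr_ge0.
have kp : 0 < k by exact: lt_le_trans ltr01 k1.
have dk : d / 2 / k <= d / 2 by rewrite ler_pdivrMr// ler_peMr// divr_ge0// ltW.
exists (d / 2 / k) => [|x y xd yd]; first by rewrite !divr_gt0.
have nxy : `|y - x| < d.
  have -> : y - x = (y - x0) - (x - x0) by rewrite opprB addrA subrK.
  rewrite (le_lt_trans (ler_normB _ _))// [d]splitr.
  by apply: ltrD; [exact: lt_le_trans yd dk|exact: lt_le_trans xd dk].
pose c (i : 'I_n + bool) : R := match i with
  inl i => (y - x).1.1 i 0 | inr true => (y - x).1.2 | inr false => (y - x).2 end.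
have xy1 : `|(y - x).1| <= `|y - x| by rewrite [leRHS]prod_normE le_max lexx.
have cN i : `|c i| <= `|y - x|.
  case: i => [i|[|]] /=.
  - rewrite (le_trans _ xy1)// (le_trans (mx_entry_le _ _ _))//.
    by rewrite prod_normE le_max lexx.
  - by rewrite (le_trans _ xy1)// prod_normE le_max lexx orbT.
  - by rewrite prod_normE le_max lexx orbT.
have emx : `|em x - em x0| < d.
  have xx1 : `|(x - x0).1| <= `|x - x0| by rewrite [leRHS]prod_normE le_max lexx.
  have dk' : d / 2 / k * k < d.
    by rewrite divfK ?gt_eqF// ltr_pdivrMr// ltr_pMr// ltr1n.
  have xk : `|x - x0| * k < d.
    exact: le_lt_trans (ler_wpM2r (ltW kp) (ltW xd)) dk'.
  rewrite prod_normE gt_max; apply/andP; split => /=.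
    rewrite (le_lt_trans _ xk)// -[leLHS]mulr1 ler_pM// (le_trans _ xx1)//.
    by rewrite prod_normE le_max lexx.
  rewrite (le_lt_trans _ xk)//.
  have -> : w0 + x.1.2 *: vt + x.2 *: ve - (w0 + x0.1.2 *: vt + x0.2 *: ve) =
     (x - x0).1.2 *: vt + (x - x0).2 *: ve.
    by rewrite /= !scalerBl opprD [- (w0 + _)]opprD addrACA [X in X + _]addrACA subrr add0r.
  rewrite (le_trans (ler_normD _ _))// !normrZ.
  have h1 : `|(x - x0).1.2| * `|vt| <= `|x - x0| * `|vt|.
    by rewrite ler_wpM2r// (le_trans _ xx1)// prod_normE le_max lexx orbT.
  have h2 : `|(x - x0).2| * `|ve| <= `|x - x0| * `|ve|.
    by rewrite ler_wpM2r// prod_normE le_max lexx orbT.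
  apply: le_trans (lerD h1 h2) _.
  by rewrite /k !mulrDr mulr1 -addrA lerDr.
have := Hd (em x) c emx (fun i => le_lt_trans (cN i) nxy).
have -> : em x + \sum_(i <- s) c i *: v i = em y.
  rewrite sumE /=.
  have -> : \sum_i (y.1.1 + - x.1.1) i 0 *: ((ev i, 0) : 'cV[R]_n * W) = (y.1.1 - x.1.1, 0).
    rewrite [in RHS](_ : y.1.1 - x.1.1 = \sum_i (y.1.1 - x.1.1) i 0 *: ev i).
      elim/big_ind2 : _ => // [u1 [u2 u3] v1 [v2 v3] [-> ->] [-> ->]|i _].
        by congr pair; rewrite addr0.
      by congr pair; rewrite /= scaler0.
    apply/colP => i; rewrite summxE (bigD1 i)//= big1 ?addr0 => [|j ji]; rewrite !mxE ?eqxx ?mulr1//.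
    by rewrite eq_sym (negbTE ji) mulr0.
  rewrite /em; congr pair => /=.
    by rewrite !scaler0 !addr0 addrC subrK.
  have e3 (a b : W) : a + (b - a) = b by rewrite addrC subrK.
  rewrite add0r !scalerBl. by rewrite addrACA -[w0 + _ + (_ - _)]addrA !e3.
have -> : \sum_(i <- s) c i * 'D_(v i) f (em x0) =
    lin3 A ('D_(0, vt) f (em x0)) ('D_(0, ve) f (em x0)) (y - x).
  rewrite sumE /lin3 dotvE /=; congr (_ + _ + _).
  by apply: eq_bigr => i _; rewrite [RHS]mulrC; congr (_ * _); rewrite mxE.
move=> /le_trans; apply.
have : \sum_(i <- s) `|c i| <= (n + 2)%:R * `|y - x|.
  rewrite sumE natrD mulrDl [2 * _]mulrDl mul1r addrA.
  rewrite lerD ?cN// lerD ?cN// (@le_trans _ _ (\sum_(i < n) `|y - x|))//.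
    by apply: ler_sum => i _; exact: (cN (inl i)).
  by rewrite sumr_const card_ord [leRHS]mulr_natl.
move=> H; apply: (@le_trans _ _ (e / (n + 2)%:R * ((n + 2)%:R * `|y - x|))).
  by rewrite ler_wpM2l// ltW.
by rewrite mulrA divfK// pnatr_eq0 addn2.
Qed.

End sdiff3.

(** * Functions along curves in the group *)

(** [P d s] is meant as an estimate at [s] valid within radius [d]. Monotonicity turns it into a
    property of all small [d], to which the near-covering form of compactness applies. *)
Lemma segment_uniform (R : realType) (T : R) (P : R -> R -> Prop) :
  (forall t, t \in `[0, T] -> exists2 d, 0 < d &
     forall s, s \in `[0, T] -> `|s - t| < d -> P d s) ->
  (forall d d' s, 0 < d' -> d' <= d -> P d s -> P d' s) ->
  exists2 d, 0 < d & forall s, s \in `[0, T] -> P d s.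
Proof.
move=> H mono.
have /compact_near_coveringP/near_covering_withinP := @segment_compact R 0 T.
move=> /(_ R (0^'+) P _)[].
  move=> t tT; have [d d0 Hd] := H t tT.
  exists (ball t d, [set d' | 0 < d' <= d]) => /=.
    split; first exact: nbhsx_ballx.
    near=> d'; apply/andP; split; near: d'; [exact: nbhs_right_gt|exact: nbhs_right_le].
  move=> [s d'] /= [ts /andP[d'0 d'd]] sT; apply: (mono d) => //.
  by apply: Hd => //; move: ts; rewrite -ball_normE/= distrC.
move=> d /= d0 Hd; exists (d / 2); first by rewrite divr_gt0.
move=> s sT; apply: (Hd (d / 2)) => //=; last by rewrite divr_gt0.
rewrite /ball/= sub0r normrN gtr0_norm ?divr_gt0//.
by rewrite ltr_pdivrMr// ltr_pMr// ltr1n.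
Unshelve. all: by end_near. Qed.

Section group_curves.
Variables (R : realType) (m n : nat) (G : set 'M[R]_m) (E B : 'I_n -> 'M[R]_m) (K : R).
Hypothesis HG : matrix_Lie_group G.
Hypothesis HE : is_basis_of E (lie_algebra G).
Hypothesis EB : forall x, coords B (Lam E x) = x.
Hypothesis HK : chart_const E B K.

Let K1 : 1 <= K. Proof. by case: HK. Qed.
Let K0 : 0 <= K. Proof. exact: le_trans K1. Qed.
Let KLam x : `|Lam E x| <= K * `|x|. Proof. by case: HK. Qed.
Let Kmul (X Y : 'M[R]_m) : `|X *m Y| <= K * `|X| * `|Y|. Proof. by case: HK. Qed.
Let Kexp x y d : `|x| <= d -> `|y| <= d -> d <= 1 ->
  `|expm (Lam E x) - expm (Lam E y) - Lam E (x - y)| <= K * d * `|x - y|.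
Proof. by case: HK => _ _ _ _; exact. Qed.

Lemma norm_expm_Lam1 x : `|x| <= 1 -> `|expm (Lam E x) - 1%:M| <= 2 * (K * `|x|).
Proof.
move=> x1; rewrite -[expm (Lam E x) - 1%:M](subrK (Lam E x)).
rewrite (le_trans (ler_normD _ _))//.
have := expm_Lam1 HK x1; have := KLam x.
have : K * `|x| * `|x| <= K * `|x| by rewrite ler_piMr// mulr_ge0.
lra.
Qed.

(** The Baker-Campbell-Hausdorff formula to first order. The error is relative to |q|, not to |p| +
    |q|: this is what keeps increments small when an expansion is transported to a chart centered at
    a nearby point. *)
Lemma chart_comp e : 0 < e -> exists2 d, 0 < d & forall p q, `|p| < d -> `|q| < d ->
  exists2 p', expm (Lam E p) *m expm (Lam E q) = expm (Lam E p') &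
    `|p'| <= e /\ `|p' - p - q| <= e * `|q|.
Proof.
move=> e0; have [d0 d00 Hchart] := Lie_group_chart HG HE EB HK.
have K0' : 0 < K := lt_le_trans ltr01 K1.
have K6 : 0 < K ^+ 6 by rewrite exprn_gt0.
(* The factor 42 is 2 (16 + 5), with the constants of [zz]: at most half of |z| is absorbed on the
   left, and what remains is at most e |q| / 2. *)
pose d := Num.min (Num.min d0 e) 1 / (42 * K ^+ 6).
have d_gt0 : 0 < d by rewrite divr_gt0 ?mulr_gt0// !lt_min d00 e0 ltr01.
have dE : 42 * (K ^+ 6 * d) <= Num.min (Num.min d0 e) 1.
  by rewrite /d mulrA mulrC divfK// gt_eqF// mulr_gt0.
move: dE; rewrite !le_min => /andP[/andP[dd0 de] dd1].
have dKi i : (i <= 6)%N -> K ^+ i * d <= K ^+ 6 * d.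
  by move=> i6; rewrite ler_wpM2r ?(ltW d_gt0)// ler_weXn2l.
have dKi0 i : 0 < K ^+ i * d by rewrite mulr_gt0// exprn_gt0.
have d1 : d <= 1.
  have := dKi 0%N isT; rewrite expr0 mul1r => dd.
  by move: dd1 (dKi0 6); lra.
exists d => // p q pd qd.
have p1 : `|p| <= 1 by rewrite (le_trans (ltW pd)).
have q1 : `|q| <= 1 by rewrite (le_trans (ltW qd)).
set X := expm (Lam E p) *m expm (Lam E q).
have GX : G X by apply: Lie_groupM => //; exact: G_expm_Lam.
have X1 : `|X - 1%:M| <= 8 * (K ^+ 3 * d).
  have -> : X - 1%:M = (expm (Lam E p) - 1%:M) + expm (Lam E p) *m (expm (Lam E q) - 1%:M).
    by rewrite mulmxBr mulmx1 [RHS]addrC addrA subrK.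
  rewrite (le_trans (ler_normD _ _))//.
  have H1 : `|expm (Lam E p) - 1%:M| <= 2 * (K * d).
    by rewrite (le_trans (norm_expm_Lam1 p1))// ler_wpM2l// ler_wpM2l// ltW.
  have H2 : `|expm (Lam E p) *m (expm (Lam E q) - 1%:M)| <= 6 * (K ^+ 3 * d).
    rewrite (le_trans (Kmul _ _))//.
    have -> : 6 * (K ^+ 3 * d) = K * (3 * K) * (2 * (K * d)) by ring.
    apply: ler_pM; [by rewrite mulr_ge0|exact: normr_ge0| |].
      by rewrite ler_wpM2l// (norm_expm_Lam HK).
    by rewrite (le_trans (norm_expm_Lam1 q1))// ler_wpM2l// ler_wpM2l// ltW.
  have H3 : K * d <= K ^+ 3 * d by rewrite ler_wpM2r ?(ltW d_gt0)// -{1}[K]expr1 ler_weXn2l.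
  by move: H1 H2 H3; lra.
have [|p' XE p'X] := Hchart X GX.
  by move: X1 (dKi 3 isT) (dKi0 6); move: dd0; lra.
exists p' => //.
pose D := 16 * (K ^+ 4 * d).
have p'D : `|p'| <= D.
  rewrite (le_trans p'X)//.
  have -> : D = 2 * K * (8 * (K ^+ 3 * d)) by rewrite /D; ring.
  by rewrite ler_wpM2l// mulr_ge0.
have DK : D <= 16 * (K ^+ 6 * d) by rewrite /D ler_wpM2l// dKi.
have D1 : D <= 1 by move: DK dd1 (dKi0 6); lra.
have pD : `|p| <= D.
  rewrite (le_trans (ltW pd))// /D.
  by have : d <= K ^+ 4 * d; [rewrite ler_peMl ?(ltW d_gt0)// exprn_ege1|have := dKi0 4; lra].
split; first by rewrite (le_trans p'D)// (le_trans DK)//; move: de (dKi0 6); lra.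
set z := p' - p - q.
have zE : Lam E z = - (expm (Lam E p') - expm (Lam E p) - Lam E (p' - p)) +
   ((expm (Lam E p) - 1%:M) *m (expm (Lam E q) - 1%:M) + (expm (Lam E q) - 1%:M - Lam E q)).
  rewrite -XE /X /z (LamB E (p' - p)) mulmxBl mulmxBr mulmx1 mul1mx.
  by apply/matrixP => i j; rewrite ![in LHS]mxE ![in RHS]mxE; ring.
have Z1 := Kexp p'D pD D1.
have Z2 : `|(expm (Lam E p) - 1%:M) *m (expm (Lam E q) - 1%:M)| <= 4 * (K ^+ 3 * d) * `|q|.
  rewrite (le_trans (Kmul _ _))//.
  have -> : 4 * (K ^+ 3 * d) * `|q| = K * (2 * (K * d)) * (2 * (K * `|q|)) by ring.
  rewrite ler_pM ?mulr_ge0//; last exact: norm_expm_Lam1.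
  by rewrite ler_wpM2l// (le_trans (norm_expm_Lam1 p1))// ler_wpM2l// ler_wpM2l// ltW.
have Z3 : `|expm (Lam E q) - 1%:M - Lam E q| <= K ^+ 3 * d * `|q|.
  rewrite (le_trans (expm_Lam1 HK q1))// ler_wpM2r// (@le_trans _ _ (K * d))//.
    by rewrite ler_wpM2l// ltW.
  by rewrite ler_wpM2r ?(ltW d_gt0)// -{1}[K]expr1 ler_weXn2l.
have pp : `|p' - p| <= `|z| + `|q|.
  by rewrite -[p' - p](subrK q) (le_trans (ler_normD _ _)).
have Lz : `|Lam E z| <= K * D * (`|z| + `|q|) + 5 * (K ^+ 3 * d) * `|q|.
  rewrite zE (le_trans (ler_normD _ _))// lerD//.
    by rewrite normrN (le_trans Z1)// ler_wpM2l// mulr_ge0// (le_trans _ pD).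
  rewrite (le_trans (ler_normD _ _))//; move: Z2 Z3; lra.
have zz : `|z| <= 16 * (K ^+ 6 * d) * (`|z| + `|q|) + 5 * (K ^+ 6 * d) * `|q|.
  rewrite (le_trans (norm_le_Lam EB HK z))//.
  apply: (@le_trans _ _ (K * (K * D * (`|z| + `|q|) + 5 * (K ^+ 3 * d) * `|q|))).
    by rewrite ler_wpM2l.
  have -> : K * (K * D * (`|z| + `|q|) + 5 * (K ^+ 3 * d) * `|q|) =
    16 * (K ^+ 6 * d) * (`|z| + `|q|) + 5 * (K ^+ 4 * d) * `|q| by rewrite /D; ring.
  by rewrite lerD2l ler_wpM2r// ler_wpM2l// dKi.
have h1 : 42 * (K ^+ 6 * d) * `|z| <= `|z| by rewrite ler_piMl.
have h2 : 42 * (K ^+ 6 * d) * `|q| <= e * `|q| by rewrite ler_wpM2r.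
have h3 : 0 <= (K ^+ 6 * d) * `|q| by rewrite mulr_ge0// ltW.
move: zz h1 h2 h3; rewrite mulrDr.
set u := K ^+ 6 * d.
rewrite -!mulrA; set a := u * `|z|; set b := u * `|q|; set c := e * `|q|.
lra.
Qed.

(** Asking at q = 0 is enough, since every point of G is the center of its own chart. The parameter
    is taken at 0 only; other values are reached by shifting [phi], as in the hypothesis [sr] of
    [cost_gradient]. *)
Definition group_sdiff (phi : 'M[R]_m -> R -> R -> R) : Prop :=
  forall g0 t0, G g0 ->
  has_sdiff3 (fun x : 'cV[R]_n * R * R => phi (g0 *m expm (Lam E x.1.1)) x.1.2 x.2) (0, t0, 0).

Lemma invmx_mul_expm g0 x : G g0 ->
  invmx (g0 *m expm (Lam E x)) = expm (Lam E (- x)) *m invmx g0.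
Proof.
move=> Gg0; have g0u := Lie_group_unit HG Gg0.
have H : (g0 *m expm (Lam E x)) *m (expm (Lam E (- x)) *m invmx g0) = 1%:M.
  by rewrite LamN -mulmxA [expm (Lam E x) *m _]mulmxA expmN mul1mx mulmxV.
have [u _] := mulmx1_unit H.
by rewrite -[LHS]mulmx1 -H mulKmx.
Qed.

(** In the chart at g0 the inverse is exp(-Lam q) g0^-1, whose differential at q = 0 is -Lam q
    g0^-1; [Kexp], with both endpoints free, is already a strict estimate. *)
Lemma group_sdiff_inv j l : group_sdiff (fun g _ _ => invmx g j l).
Proof.
move=> g0 t0 Gg0; pose A : 'cV[R]_n := \col_i (- (E i *m invmx g0) j l).
have AE p : dotv A p = (Lam E (- p) *m invmx g0) j l.
  rewrite dotvE LamN mulNmx /Lam mulmx_suml mxE summxE -sumrN; apply: eq_bigr => i _.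
  by rewrite mxE -scalemxAl !mxE mulNr mulrC.
exists A, 0, 0; split.
  exists (n%:R * `|A|) => x; rewrite /lin3 !mulr0 !addr0.
  rewrite (le_trans (dotv_norm_le _ _))// ler_wpM2l ?mulr_ge0//.
  by rewrite 2!prod_normE !le_max lexx.
move=> e e0; set c := K * K * `|invmx g0|.
have c0 : 0 <= c by rewrite !mulr_ge0.
exists (Num.min 1 (e / (c + 1))); first by rewrite lt_min ltr01 divr_gt0// ltr_wpDl.
move=> x y; rewrite lt_min => /andP[x1 xe]; rewrite lt_min => /andP[y1 ye].
have N1 (z : 'cV[R]_n * R * R) : `|z.1.1| <= `|z| by rewrite 2!prod_normE !le_max lexx.
have H0 (z : 'cV[R]_n * R * R) : `|z.1.1| <= `|z - (0, t0, 0)|.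
  by have := N1 (z - (0, t0, 0)); rewrite /= subr0.
rewrite !invmx_mul_expm// /lin3 !mulr0 !addr0 AE.
have -> : forall X Y Z : 'M[R]_m, X j l - Y j l - Z j l = (X - Y - Z) j l.
  by move=> X Y Z; rewrite !mxE.
have -> : - (y - x).1.1 = - y.1.1 - - x.1.1 by rewrite /= opprD.
rewrite -!mulmxBl (le_trans (mx_entry_le _ _ _))// (le_trans (Kmul _ _))//.
have := @Kexp (- y.1.1) (- x.1.1) (Num.min 1 (e / (c + 1))).
rewrite !normrN !le_min ge_min lexx.
rewrite (le_trans (H0 _) (ltW y1)) (le_trans (H0 _) (ltW ye)).
rewrite (le_trans (H0 _) (ltW x1)) (le_trans (H0 _) (ltW xe)) => /(_ isT isT isT) H.
have xyN : `|- y.1.1 - - x.1.1| <= `|y - x|.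
  by have := N1 (y - x); rewrite /= -opprD normrN.
apply: (@le_trans _ _ (c * (e / (c + 1)) * `|y - x|)).
  have -> : c * (e / (c + 1)) * `|y - x| = K * (K * (e / (c + 1)) * `|y - x|) * `|invmx g0|.
    by rewrite /c; ring.
  rewrite ler_wpM2r// ler_wpM2l// (le_trans H)// ler_pM ?mulr_ge0//.
    by rewrite le_min ler01 divr_ge0// ?addr_ge0// ltW.
  by rewrite ler_wpM2l// ge_min lexx orbT.
rewrite ler_wpM2r// mulrCA ler_piMr ?(ltW e0)//.
by rewrite ler_pdivrMr ?ltr_wpDl// mul1r lerDl.
Qed.

End group_curves.

(** * Expansions that are uniform along a curve *)

Definition seg_cont (R : realType) (V : normedModType R) (T : R) (g : R -> V) : Prop :=
  forall t e, t \in `[0, T] -> 0 < e -> exists2 d, 0 < d &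
    forall s, s \in `[0, T] -> `|s - t| < d -> `|g s - g t| <= e.

Lemma within_seg_cont (R : realType) (V : normedModType R) (T : R) (g : R -> V) :
  {within `[0, T], continuous g} <-> seg_cont T g.
Proof.
split=> [/subspace_continuousP cg t e tT e0|cg].
  have /cvgrPdist_le/(_ _ e0) := cg t tT.
  rewrite /prop_near1 /within/= => /nbhs_ballP[d /= d0 Hd]; exists d => // s sT st.
  by rewrite distrC; apply: Hd => //; rewrite -ball_normE/= distrC.
apply/subspace_continuousP => t tT; apply/cvgrPdist_le => e e0.
have [d d0 Hd] := cg t e tT e0.
rewrite /prop_near1 /within/=; apply/nbhs_ballP; exists d => // s.
by rewrite -ball_normE/= => ts sT; rewrite distrC; apply: Hd => //; rewrite distrC.
Qed.

(** Writing the bound as d^-1 makes it monotone in [d], as [segment_uniform] requires. *)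
Lemma seg_cont_bounded (R : realType) (V : normedModType R) (T : R) (g : R -> V) :
  seg_cont T g -> exists2 M, 0 < M & forall t, t \in `[0, T] -> `|g t| <= M.
Proof.
move=> cg; have [|d d' s d'0 dd' gs|d d0 Hd] := @segment_uniform R T (fun d t => `|g t| <= d^-1).
- move=> t tT; have [d d0 Hd] := cg t 1 tT ltr01.
  have g0 : 0 < 1 + `|g t| by rewrite ltr_pwDl.
  exists (Num.min d (1 + `|g t|)^-1); first by rewrite lt_min d0 invr_gt0.
  move=> s sT; rewrite lt_min => /andP[sd _].
  apply: (@le_trans _ _ (1 + `|g t|)).
    by rewrite -[g s](subrK (g t)) (le_trans (ler_normD _ _))// lerD2r Hd.
  by rewrite -[leLHS]invrK lef_pV2 ?posrE ?invr_gt0// ?lt_min ?d0 ?invr_gt0// ge_min lexx orbT.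
- by rewrite (le_trans gs)// lef_pV2 ?posrE// (lt_le_trans d'0).
by exists d^-1; [rewrite invr_gt0|].
Qed.

Section curves.
Variables (R : realType) (m n : nat) (G : set 'M[R]_m) (E B : 'I_n -> 'M[R]_m) (K : R).
Hypothesis HG : matrix_Lie_group G.
Hypothesis HE : is_basis_of E (lie_algebra G).
Hypothesis EB : forall x, coords B (Lam E x) = x.
Hypothesis HK : chart_const E B K.
Variables (T : R) (g : R -> 'M[R]_m).
Hypothesis Gg : forall t, t \in `[0, T] -> G (g t).
Hypothesis cg : seg_cont T g.

Let K1 : 1 <= K. Proof. by case: HK. Qed.
Let K0 : 0 <= K. Proof. exact: le_trans K1. Qed.
Let Kmul (X Y : 'M[R]_m) : `|X *m Y| <= K * `|X| * `|Y|. Proof. by case: HK. Qed.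

Lemma curve_chart t e : t \in `[0, T] -> 0 < e -> exists2 d, 0 < d &
  forall s, s \in `[0, T] -> `|s - t| < d ->
    exists2 p, g s = g t *m expm (Lam E p) & `|p| < e.
Proof.
move=> tT e0; have [d0 d00 Hchart] := Lie_group_chart HG HE EB HK.
have K0' : 0 < K := lt_le_trans ltr01 K1.
have gu := Lie_group_unit HG (Gg tT).
pose c := Num.min (d0 / 2) (e / (4 * K)).
have c0 : 0 < c by rewrite lt_min !divr_gt0// mulr_gt0.
pose k := K * `|invmx (g t)| + 1.
have k0 : 0 < k by rewrite ltr_wpDl// mulr_ge0.
have [d d_gt0 Hd] := cg tT (divr_gt0 c0 k0).
exists d => // s sT /(Hd _ sT) gst.
set X := invmx (g t) *m g s.
have GX : G X by apply: (Lie_groupM HG); [apply: (Lie_groupV HG)|]; exact: Gg.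
have X1 : `|X - 1%:M| <= c.
  rewrite -(mulVmx gu) -mulmxBr (le_trans (Kmul _ _))//.
  apply: (@le_trans _ _ (k * (c / k))); last by rewrite mulrC divfK// gt_eqF.
  by rewrite ler_pM ?mulr_ge0// lerDl.
move: (X1); rewrite le_min => /andP[Xd Xe].
have [|p XE pX] := Hchart X GX.
  by rewrite (le_lt_trans Xd)// ltr_pdivrMr// ltr_pMr// ltr1n.
exists p; first by rewrite -XE mulKVmx.
rewrite (le_lt_trans pX)// (@le_lt_trans _ _ (2 * K * (e / (4 * K))))//.
  by rewrite ler_wpM2l// mulr_ge0.
have -> : 2 * K * (e / (4 * K)) = e / 2 by field; rewrite gt_eqF.
by rewrite ltr_pdivrMr// ltr_pMr// ltr1n.
Qed.

Variable phi : 'M[R]_m -> R -> R -> R.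

Lemma norm3 (p : 'cV[R]_n) (t e : R) : `|(p, t, e)| <= `|p| + `|t| + `|e|.
Proof.
rewrite prod_normE ge_max/= prod_normE ge_max/=.
by have := normr_ge0 p; have := normr_ge0 t; have := normr_ge0 e; lra.
Qed.

Lemma norm3_lt (p : 'cV[R]_n) (t e d : R) : `|p| < d -> `|t| < d -> `|e| < d -> `|(p, t, e)| < d.
Proof. by move=> H1 H2 H3; rewrite prod_normE gt_max/= prod_normE gt_max/= H1 H2 H3. Qed.

Lemma curve_phi_cont : group_sdiff G E phi -> seg_cont T (fun t => phi (g t) t 0).
Proof.
move=> sphi t e tT e0; have [A [a [b sd]]] := sphi _ t (Gg tT).
have [C [d [C0 d0 Hd]]] := sdiff_lip sd.
have c0 : 0 < Num.min d (e / (2 * (C + 1))).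
  by rewrite lt_min d0 divr_gt0// mulr_gt0// ltr_wpDl.
have [d1 d10 Hd1] := curve_chart tT c0.
exists (Num.min d1 (Num.min d (e / (2 * (C + 1))))); first by rewrite lt_min d10.
move=> s sT; rewrite lt_min => /andP[/(Hd1 _ sT)[p gE pd]].
move: pd; rewrite !lt_min => /andP[pd pe] /andP[sd' se].
have -> : phi (g t) t 0 = phi (g t *m expm (Lam E 0)) t 0.
  by rewrite Lam0 expm0 mulmx1.
rewrite gE; have := Hd (0, t, 0) (p, s, 0).
have dE (z : 'cV[R]_n) (u v : R) : (z, u, v) - (0, t, 0) = (z, u - t, v).
  by congr (_, _, _); rewrite /= subr0.
rewrite !dE /= => /(_ _ _)/le_trans; apply.
- by rewrite subrr; apply: norm3_lt; rewrite ?normr0.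
- by apply: norm3_lt; rewrite ?normr0.
rewrite (le_trans (ler_wpM2l C0 (norm3 _ _ _)))// normr0 addr0.
rewrite (@le_trans _ _ ((C + 1) * (e / (2 * (C + 1)) + e / (2 * (C + 1)))))//.
  by rewrite ler_pM ?addr_ge0// ?lerDl// lerD// ltW.
by rewrite le_eqVlt; apply/orP; left; apply/eqP; field; rewrite gt_eqF// ltr_wpDl.
Qed.

(** With g s = g t exp(p) and exp(p) exp(q) = exp(p'), the increment at [s] becomes the increment
    between (p, s, 0) and (p', s, c) in the fixed chart at [g t]. Both endpoints vary, so strict
    differentiability is essential; [chart_comp] replaces p' - p by q, and the time difference is 0,
    which eliminates [a]. *)
Lemma curve_local t A a b e : t \in `[0, T] ->
  sdiff (fun x : 'cV[R]_n * R * R => phi (g t *m expm (Lam E x.1.1)) x.1.2 x.2)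
    (0, t, 0) (lin3 A a b) -> 0 < e ->
  exists2 d, 0 < d & forall s, s \in `[0, T] -> `|s - t| < d ->
  forall q c, `|q| < d -> `|c| < d ->
    `|phi (g s *m expm (Lam E q)) s c - phi (g s) s 0 - (dotv A q + c * b)|
      <= e * (`|q| + `|c|).
Proof.
move=> tT [_ sd] e0.
have [|dS dS0 HS] := sd (e / 4); first by rewrite divr_gt0.
have nA0 : 0 <= n%:R * `|A| by rewrite mulr_ge0.
pose k := Num.min 1 (Num.min (dS / 2) (e / (2 * (n%:R * `|A| + 1)))).
have k0 : 0 < k by rewrite !lt_min ltr01 !divr_gt0// mulr_gt0// ltr_wpDl.
have [d1 d10 H1] := chart_comp HG HE EB HK k0.
have d1S : 0 < Num.min d1 dS by rewrite lt_min d10.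
have [d2 d20 H2] := curve_chart tT d1S.
exists (Num.min d2 (Num.min d1 dS)) => [|s sT]; first by rewrite lt_min d20.
rewrite lt_min => /andP[/(H2 _ sT)[p gE pd] sd1] q c.
move: pd sd1; rewrite !lt_min => /andP[pd1 pdS] /andP[_ sdS].
move=> /andP[_ /andP[qd1 qdS]] /andP[_ /andP[_ cdS]].
have [p' pp' [p'k p'z]] := H1 p q pd1 qd1.
have kE : k <= dS / 2 /\ (k <= 1 /\ k <= e / (2 * (n%:R * `|A| + 1))).
  by rewrite /k !ge_min !lexx /= !orbT.
case: kE => kS [k1 ke].
have p'S : `|p'| < dS.
  by rewrite (le_lt_trans p'k)// (le_lt_trans kS)// ltr_pdivrMr// ltr_pMr// ltr1n.
have -> : phi (g s *m expm (Lam E q)) s c = phi (g t *m expm (Lam E p')) s c.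
  by rewrite gE -mulmxA pp'.
rewrite [in phi (g s) s 0]gE.
have dE (z : 'cV[R]_n) (u v : R) : (z, u, v) - (0, t, 0) = (z, u - t, v).
  by congr (_, _, _); rewrite /= subr0.
have := HS (p, s, 0) (p', s, c); rewrite !dE /=.
have -> : (p', s, c) - (p, s, 0) = (p' - p, 0, c) :> 'cV[R]_n * R * R.
  by congr (_, _, _); rewrite /= ?subrr ?subr0.
have z0 : `|0 : R| < dS by rewrite normr0.
move=> /(_ (norm3_lt pdS sdS z0) (norm3_lt p'S sdS cdS)).
rewrite /lin3/= mul0r addr0 => H.
have pq : `|p' - p| <= 2 * `|q|.
  rewrite -[p' - p](subrK q) (le_trans (ler_normD _ _))//.
  have : `|p' - p - q| <= `|q| by rewrite (le_trans p'z)// ler_piMl.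
  lra.
have Hz : `|dotv A (p' - p - q)| <= e / 2 * `|q|.
  rewrite (le_trans (dotv_norm_le _ _))//.
  apply: (@le_trans _ _ (n%:R * `|A| * (e / (2 * (n%:R * `|A| + 1)) * `|q|))).
    by rewrite ler_wpM2l// (le_trans p'z)// ler_wpM2r.
  rewrite mulrA ler_wpM2r// mulrC -mulrA ler_wpM2l ?(ltW e0)//.
  by rewrite ler_pdivrMl ?mulr_gt0 ?ltr_wpDl// mulrAC mulfV// mul1r lerDl.
have -> : forall x y : R, x - y - (dotv A q + c * b) =
   (x - y - (dotv A (p' - p) + c * b)) + dotv A (p' - p - q).
  by move=> x y; rewrite [dotv A (p' - p - q)]dotvBr; ring.
rewrite (le_trans (ler_normD _ _))//.
have H3 : `|(p' - p, 0, c) : 'cV[R]_n * R * R| <= 2 * `|q| + `|c|.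
  by rewrite (le_trans (norm3 _ _ _))// normr0 addr0 lerD2r.
have H4 : e / 4 * `|(p' - p, 0, c) : 'cV[R]_n * R * R| <= e / 4 * (2 * `|q| + `|c|).
  by rewrite ler_wpM2l// divr_ge0// ltW.
have : 0 <= e * `|c| by rewrite mulr_ge0// ltW.
move: (le_trans H H4) Hz; set x := `|_ - _|; set y := `|dotv _ _|.
by lra.
Qed.

(** The differentials [A t] and [b t] are picked by choice for each [t]; their continuity is a
    consequence of the local estimates, and it in turn allows them to be replaced by [A s] and [b s]
    before compactness is applied. *)
Lemma curve_uniform : group_sdiff G E phi -> exists (A : R -> 'cV[R]_n) (b : R -> R),
  [/\ seg_cont T A, seg_cont T b &
   forall e, 0 < e -> exists2 d, 0 < d & forall t, t \in `[0, T] ->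
     forall q c, `|q| < d -> `|c| < d ->
     `|phi (g t *m expm (Lam E q)) t c - phi (g t) t 0 - (dotv (A t) q + c * b t)|
       <= e * (`|q| + `|c|)].
Proof.
move=> sphi.
have HA t : exists A : 'cV[R]_n, exists b, t \in `[0, T] -> exists a,
  sdiff (fun x : 'cV[R]_n * R * R => phi (g t *m expm (Lam E x.1.1)) x.1.2 x.2)
    (0, t, 0) (lin3 A a b).
  case: (boolP (t \in `[0, T])) => tT; last by exists 0, 0.
  by have [A [a [b H]]] := sphi _ t (Gg tT); exists A, b => _; exists a.
pose A t := projT1 (cid (HA t)); have HAt t := projT2 (cid (HA t)).
pose b t := projT1 (cid (HAt t)); have Hbt t := projT2 (cid (HAt t)).
have loc t e (tT : t \in `[0, T]) (e0 : 0 < e) : exists2 d, 0 < d &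
    forall s, s \in `[0, T] -> `|s - t| < d ->
    forall q c, `|q| < d -> `|c| < d ->
    `|phi (g s *m expm (Lam E q)) s c - phi (g s) s 0 - (dotv (A t) q + c * b t)|
      <= e * (`|q| + `|c|).
  by have [a sd] := Hbt t tT; exact: curve_local sd e0.
(* At [s], the forms of [t] and of [s] approximate the same increments of [phi]. They therefore
   nearly agree on vectors of some small size [u], and by homogeneity their coefficients are
   close. *)
have close t e (tT : t \in `[0, T]) (e0 : 0 < e) : exists2 d, 0 < d &
    forall s, s \in `[0, T] -> `|s - t| < d ->
    `|A s - A t| <= e /\ `|b s - b t| <= e.
  have e20 : 0 < e / 2 by rewrite divr_gt0.
  have [d d0 Hd] := loc t _ tT e20; exists d => // s sT st.
  have [d' d'0 Hd'] := loc s _ sT e20.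
  pose u := Num.min d d' / 2.
  have dd' : 0 < Num.min d d' by rewrite lt_min d0.
  have u0 : 0 < u by rewrite divr_gt0.
  have ud : u < Num.min d d' by rewrite ltr_pdivrMr// ltr_pMr// ltr1n.
  move: ud; rewrite lt_min => /andP[ud ud'].
  have key q c : `|q| <= u -> `|c| <= u -> `|q| + `|c| <= u ->
      `|dotv (A s - A t) q + c * (b s - b t)| <= e * u.
    move=> qu cu qcu.
    have h1 := Hd s sT st q c (le_lt_trans qu ud) (le_lt_trans cu ud).
    have := Hd' s sT _ q c (le_lt_trans qu ud') (le_lt_trans cu ud').
    rewrite subrr normr0 => /(_ d'0) h2.
    have -> : dotv (A s - A t) q + c * (b s - b t) =
      (phi (g s *m expm (Lam E q)) s c - phi (g s) s 0 - (dotv (A t) q + c * b t)) -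
      (phi (g s *m expm (Lam E q)) s c - phi (g s) s 0 - (dotv (A s) q + c * b s)).
      by rewrite dotvBl; ring.
    rewrite (le_trans (ler_normB _ _))// (le_trans (lerD h1 h2))//.
    by rewrite -mulrDl -splitr ler_wpM2l// ltW.
  split.
    apply: mx_norm_le => [|i j]; first exact: ltW.
    rewrite ord1; have evu : `|u *: (ev i : 'cV[R]_n)| <= u.
      rewrite normrZ gtr0_norm// ler_piMr ?(ltW u0)//.
      by apply: mx_norm_le => // k l; rewrite mxE; case: (_ && _); rewrite ?normr1 ?normr0.
    have := key (u *: ev i) 0; rewrite normr0 addr0 mul0r addr0 => /(_ evu (ltW u0) evu).
    by rewrite dotvZr dotv_ev normrM gtr0_norm// mulrC ler_pM2r.
  have := key 0 u; rewrite normr0 add0r dotv0r add0r gtr0_norm// => /(_ (ltW u0) (lexx _) (lexx _)).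
  by rewrite normrM gtr0_norm// mulrC ler_pM2r.
exists A, b; split.
- by move=> t e tT e0; have [d d0 Hd] := close t e tT e0; exists d => // s sT /(Hd _ sT)[].
- by move=> t e tT e0; have [d d0 Hd] := close t e tT e0; exists d => // s sT /(Hd _ sT)[].
move=> e e0.
apply: (@segment_uniform R T (fun d t => forall q c, `|q| < d -> `|c| < d ->
     `|phi (g t *m expm (Lam E q)) t c - phi (g t) t 0 - (dotv (A t) q + c * b t)|
       <= e * (`|q| + `|c|))); last first.
  by move=> d d' s d'0 dd' H q c qd cd; apply: H; exact: lt_le_trans dd'.
move=> t tT; have e20 : 0 < e / 2 by rewrite divr_gt0.
have n10 : 0 < n%:R + 1 :> R by rewrite ltr_wpDl.
have e20' : 0 < e / 2 / (n%:R + 1) by rewrite divr_gt0.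
have [d d0 Hd] := loc t _ tT e20.
have [d' d'0 Hd'] := close t _ tT e20'.
exists (Num.min d d') => [|s sT]; first by rewrite lt_min d0.
rewrite lt_min => /andP[sd /(Hd' _ sT)[As bs]] q c; rewrite !lt_min => /andP[qd _] /andP[cd _].
have H := Hd s sT sd q c qd cd.
have -> : forall x y : R, x - y - (dotv (A s) q + c * b s) =
   (x - y - (dotv (A t) q + c * b t)) - (dotv (A s - A t) q + c * (b s - b t)).
  by move=> x y; rewrite dotvBl; ring.
rewrite (le_trans (ler_normB _ _))//.
have -> : e * (`|q| + `|c|) = e / 2 * (`|q| + `|c|) + e / 2 * (`|q| + `|c|).
  by rewrite -mulrDl -splitr.
rewrite lerD//.
rewrite (le_trans (ler_normD _ _))// [leRHS]mulrDr lerD//.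
  rewrite (le_trans (dotv_norm_le _ _))// ler_wpM2r//.
  apply: (@le_trans _ _ ((n%:R + 1) * (e / 2 / (n%:R + 1)))).
    by rewrite ler_pM// lerDl.
  by rewrite mulrC divfK// gt_eqF.
rewrite normrM mulrC ler_wpM2r// (le_trans bs)// ler_pdivrMr//.
by rewrite ler_peMr ?(ltW e20)// lerDr.
Qed.

End curves.

(** * Derivatives and Gronwall estimates *)

Section derivatives.
Variable R : realType.

Lemma is_deriveP (V W : normedModType R) (f : V -> W) x v df :
  is_derive x v f df <-> h^-1 *: (f (h *: v + x) - f x) @[h --> 0^'] --> df.
Proof.
split=> [[df' <-]|H]; first by move: df'.
by split; [apply/cvg_ex; exists df|exact: cvg_lim H].
Qed.

Lemma is_derive_mxP m n (V : normedModType R) (M : V -> 'M[R]_(m, n)) x v (dM : 'M[R]_(m, n)) :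
  is_derive x v M dM <-> forall i j, is_derive x v (fun y => M y i j) (dM i j).
Proof.
split=> [/is_deriveP/cvg_mxP H i j|H].
  apply/is_deriveP; have := H i j.
  by under eq_fun do rewrite !mxE.
apply/is_deriveP/cvg_mxP => i j; have /is_deriveP := H i j.
by under [in X in _ -> X]eq_fun do rewrite !mxE.
Qed.

Lemma is_derive_bigsum (V : normedModType R) (I : Type) (s : seq I) (f : I -> V -> R) x v df :
  (forall i, is_derive x v (f i) (df i)) ->
  is_derive x v (fun y => \sum_(i <- s) f i y) (\sum_(i <- s) df i).
Proof.
move=> H; elim: s => [|i s IH].
  rewrite big_nil; under eq_fun do rewrite big_nil; exact: is_derive_cst.
rewrite big_cons; under eq_fun do rewrite big_cons.
exact: (is_deriveD (H i) IH).
Qed.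

Lemma is_derive_mulmx m n p (V : normedModType R) (A : V -> 'M[R]_(m, n)) (B : V -> 'M[R]_(n, p))
    x v (dA : 'M[R]_(m, n)) (dB : 'M[R]_(n, p)) :
  is_derive x v A dA -> is_derive x v B dB ->
  is_derive x v (fun y => A y *m B y) (dA *m B x + A x *m dB).
Proof.
move=> /is_derive_mxP HA /is_derive_mxP HB; apply/is_derive_mxP => i j.
rewrite !mxE -big_split/=; under eq_fun do rewrite mxE.
apply: is_derive_bigsum => k.
have := is_deriveM (HA i k) (HB k j).
by rewrite /GRing.scale/= addrC [_ * dA i k]mulrC.
Qed.

Lemma is_derive_dotv n (V : normedModType R) (a b : V -> 'cV[R]_n) x v (da db : 'cV[R]_n) :
  is_derive x v a da -> is_derive x v b db ->
  is_derive x v (fun y => dotv (a y) (b y)) (dotv da (b x) + dotv (a x) db).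
Proof.
move=> Ha Hb.
have Ht : is_derive x v (fun y => (a y)^T) da^T.
  apply/is_derive_mxP => i j; move/is_derive_mxP : Ha => /(_ j i).
  by rewrite mxE; under [in X in _ -> X]eq_fun do rewrite mxE.
have /is_derive_mxP/(_ 0 0) := is_derive_mulmx Ht Hb.
by rewrite mxE.
Qed.

Lemma is_derive_coords m n (B : 'I_n -> 'M[R]_m) (V : normedModType R) (X : V -> 'M[R]_m) x v dX :
  is_derive x v X dX -> is_derive x v (fun y => coords B (X y)) (coords B dX).
Proof.
move=> /is_derive_mxP H; apply/is_derive_mxP => i j.
rewrite mxE; under eq_fun do rewrite mxE.
by apply: is_derive_bigsum => k; apply: is_derive_bigsum => l.
Qed.

Lemma MVT_le (f df : R -> R) (T e : R) : 0 < T -> 0 <= e -> seg_cont T f ->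
  (forall t, t \in `]0, T[ -> is_derive t (1 : R) f (df t) /\ `|df t| <= e) ->
  `|f T - f 0| <= e * T.
Proof.
move=> T0 e0 /within_seg_cont cf H.
have [c cT] := MVT T0 (fun t tT => (H t tT).1) cf.
rewrite subr0 => ->; rewrite normrM (gtr0_norm T0) ler_wpM2r ?(ltW T0)//.
exact: (H c cT).2.
Qed.

Lemma seg_cont_sub (V : normedModType R) (T T' : R) (f : R -> V) : T' <= T ->
  seg_cont T f -> seg_cont T' f.
Proof.
move=> T'T cf; have sub t : t \in `[0, T'] -> t \in `[0, T].
  by rewrite !in_itv/= => /andP[-> /le_trans]; exact.
move=> t e tT e0; have [d d0 Hd] := cf t e (sub _ tT) e0; exists d => // s sT.
exact/Hd/sub.
Qed.

Lemma seg_contD (V : normedModType R) T (f g : R -> V) :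
  seg_cont T f -> seg_cont T g -> seg_cont T (fun t => f t + g t).
Proof.
move=> /within_seg_cont cf /within_seg_cont cg; apply/within_seg_cont => t.
by apply: (@cvgD _ _ _ (nbhs t) _ f g); [exact: cf|exact: cg].
Qed.

Lemma seg_contM T (f g : R -> R) :
  seg_cont T f -> seg_cont T g -> seg_cont T (fun t => f t * g t).
Proof.
move=> /within_seg_cont cf /within_seg_cont cg; apply/within_seg_cont => t.
by apply: (@cvgM _ _ (nbhs t) _ f g); [exact: cf|exact: cg].
Qed.

Lemma seg_cont_cst (V : normedModType R) T (x : V) : seg_cont T (fun=> x).
Proof. by move=> t e tT e0; exists 1 => // s _ _; rewrite subrr normr0 ltW. Qed.

Lemma seg_cont_sum (I : Type) (s : seq I) T (f : I -> R -> R) :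
  (forall i, seg_cont T (f i)) -> seg_cont T (fun t => \sum_(i <- s) f i t).
Proof.
move=> H; elim: s => [|i s IH].
  by under eq_fun do rewrite big_nil; exact: seg_cont_cst.
by under eq_fun do rewrite big_cons; exact: seg_contD.
Qed.

Lemma seg_cont_mxP m n T (f : R -> 'M[R]_(m, n)) :
  seg_cont T f <-> forall i j, seg_cont T (fun t => f t i j).
Proof.
split=> [cf i j t e tT e0|cf].
  have [d d0 Hd] := cf t e tT e0; exists d => // s sT /(Hd s sT); apply: le_trans.
  by have := mx_entry_le (f s - f t) i j; rewrite !mxE.
apply/within_seg_cont => t; apply: (@cvg_mxP _ _ _ _ (nbhs t) _ f (f t)).2 => i j.
by have /within_seg_cont := cf i j; apply.
Qed.

Lemma seg_cont_continuous (T : R) (f : R -> R) : continuous f -> seg_cont T f.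
Proof. by move=> cf; apply/within_seg_cont/continuous_subspaceT. Qed.

Lemma first_exit (T d : R) (f : R -> R) : seg_cont T f -> f 0 < d ->
  (exists2 t, t \in `[0, T] & d <= f t) ->
  exists t, [/\ 0 < t, t <= T, d <= f t & forall s, 0 <= s -> s < t -> f s < d].
Proof.
move=> cf f0 [t1 t1T ft1].
pose S := [set t | t \in `[0, T] /\ d <= f t].
have Slb : lbound S 0 by move=> t [+ _]; rewrite in_itv/= => /andP[].
have Sinf : has_inf S by split; [exists t1|exists 0].
pose t := inf S.
have t0 : 0 <= t by apply: lb_le_inf => //; exists t1.
have tT : t <= T.
  rewrite (@le_trans _ _ t1)//; last by move: t1T; rewrite in_itv/= => /andP[].
  by apply: ge_inf => //; exists 0.
have tI : t \in `[0, T] by rewrite in_itv/= t0.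
have ft : d <= f t.
  rewrite leNgt; apply/negP => ftd.
  have e0 : 0 < (d - f t) / 2 by rewrite divr_gt0// subr_gt0.
  have [u u0 Hu] := cf t _ tI e0.
  have [s [sT fs]] := inf_adherent u0 Sinf.
  rewrite -/t => stu.
  have ts : t <= s by apply: ge_inf => //; exists 0.
  have := Hu s sT; rewrite ger0_norm ?subr_ge0// => /(_ _) H.
  have := H (ltac:(by rewrite ltrBlDl)); rewrite ler_norml => /andP[_]; lra.
exists t; split => //.
  rewrite lt_neqAle t0 andbT; apply/eqP => t00.
  by move: ft; rewrite -t00 leNgt f0.
move=> s s0 st; rewrite ltNge; apply/negP => fs.
have : t <= s.
  apply: ge_inf; first by exists 0.
  by split => //; rewrite in_itv/= s0 (le_trans (ltW st)).
by rewrite leNgt st.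
Qed.

(** The function (N + b) exp(-a t) has nonpositive derivative. *)
Lemma gronwall_scalar (N dN : R -> R) (T a b : R) : 0 <= T -> 0 <= a -> 0 <= b ->
  seg_cont T N -> N 0 = 0 ->
  (forall t, t \in `]0, T[ -> is_derive t (1 : R) N (dN t) /\ dN t <= a * (N t + b)) ->
  N T <= b * expR (a * T).
Proof.
move=> T0 a0 b0 cN N0 H.
have [->|T_neq0] := eqVneq T 0; first by rewrite N0 mulr_ge0// expR_ge0.
have {}T0 : 0 < T by rewrite lt_neqAle eq_sym T_neq0.
pose M t := (N t + b) * expR (- a * t).
pose dM t := (N t + b) * (expR (- a * t) * - a) + expR (- a * t) * dN t.
have dMP t : t \in `]0, T[ -> is_derive t (1 : R) M (dM t).
  move=> /H[dNt _].
  have dE : is_derive t (1 : R) (fun t => expR (- a * t)) (expR (- a * t) * - a).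
    apply: (@is_derive1_comp R expR (fun t => - a * t)).
    have := is_deriveZ (- a) (is_derive_id t (1 : R)).
    by rewrite /GRing.scale/= mulr1.
  have := is_deriveM (is_deriveD dNt (is_derive_cst b t (1 : R))) dE.
  by rewrite addr0.
have cM : {within `[0, T], continuous M}.
  apply/within_seg_cont; apply: seg_contM.
    by apply: seg_contD => //; exact: seg_cont_cst.
  apply: seg_cont_continuous => t; apply: continuous_comp; last exact: continuous_expR.
  exact: mulrl_continuous.
have [c cT] := MVT T0 dMP cM.
have dMc : dM c <= 0.
  rewrite /dM mulrCA -mulrDr pmulr_rle0 ?expR_gt0//.
  by have := (H c cT).2; lra.
have : dM c * (T - 0) <= 0 by rewrite subr0 pmulr_lle0.
move=> + ME; rewrite -ME subr_le0 /M mulr0 expR0 mulr1 N0 add0r mulNr expRN.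
rewrite ler_pdivrMr ?expR_gt0// => HH.
by rewrite (le_trans _ HH)// lerDl.
Qed.

End derivatives.

(* The differential inequality is only assumed while |Z| < rho; the conclusion
   shows that Z never leaves that region. *)
Lemma gronwall_mx (R : realType) p q (Z dZ : R -> 'M[R]_(p, q)) (T rho C c : R) :
  let k := expR (3 * (p%:R * q%:R) * C * T) in
  0 <= T -> 0 < rho -> 0 <= C -> 0 <= c -> seg_cont T Z -> Z 0 = 0 ->
  (forall t, t \in `]0, T[ -> is_derive t (1 : R) Z (dZ t) /\
     (`|Z t| < rho -> `|dZ t| <= C * (`|Z t| + c))) ->
  c * Num.sqrt k < rho ->
  forall t, t \in `[0, T] -> `|Z t| <= c * Num.sqrt k.
Proof.
move=> k T0 rho0 C0 c0 cZ Z0 H ck.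
have k0 : 0 < k by rewrite expR_gt0.
(* The maximum norm is not differentiable in t; the sum of squares is, it dominates the squared
   norm, and it also vanishes at 0. *)
pose N t := \sum_i \sum_j (Z t i j) ^+ 2.
pose dN t := \sum_i \sum_j (2 * Z t i j * dZ t i j).
have ZN t i j : (Z t i j) ^+ 2 <= N t.
  rewrite /N (bigD1 i)//= (bigD1 j)//= -addrA lerDl addr_ge0//.
    by apply: sumr_ge0 => *; exact: sqr_ge0.
  by apply: sumr_ge0 => *; apply: sumr_ge0 => *; exact: sqr_ge0.
have ZsN t : `|Z t| <= Num.sqrt (N t).
  apply: mx_norm_le => [|i j]; first exact: sqrtr_ge0.
  by rewrite -sqrtr_sqr ler_wsqrtr.
have N0 t : 0 <= N t by apply: sumr_ge0 => *; apply: sumr_ge0 => *; exact: sqr_ge0.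
have Zsq t : `|Z t| ^+ 2 <= N t.
  by rewrite -[leRHS]sqr_sqrtr// lerXn2r ?nnegrE ?sqrtr_ge0.
have cN : seg_cont T N.
  have /seg_cont_mxP cZ' := cZ.
  by apply: seg_cont_sum => i; apply: seg_cont_sum => j; exact: seg_contM.
have N00 : N 0 = 0.
  by rewrite /N big1// => i _; rewrite big1// => j _; rewrite Z0 mxE expr0n.
(* With z the norm of [Z t], the 3 comes from 2 z (z + c) <= 3 (z^2 + c^2); p q is the number of
   entries summed in [dN]. *)
set a := 3 * (p%:R * q%:R) * C.
have a0 : 0 <= a by rewrite !mulr_ge0.
have ndN t : `|dN t| <= 2 * (p%:R * q%:R) * (`|Z t| * `|dZ t|).
  rewrite /dN (le_trans (ler_norm_sum _ _ _))//.
  apply: (@le_trans _ _ (\sum_(i < p) \sum_(j < q) (2 * (`|Z t| * `|dZ t|)))).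
    apply: ler_sum => i _; rewrite (le_trans (ler_norm_sum _ _ _))//.
    apply: ler_sum => j _; rewrite !normrM -mulrA ger0_norm// ler_wpM2l//.
    by rewrite ler_pM// mx_entry_le.
  rewrite !sumr_const !card_ord -[_ *+ q]mulr_natl -[_ *+ p]mulr_natl.
  by rewrite le_eqVlt; apply/orP; left; apply/eqP; ring.
have dNP t : t \in `]0, T[ -> is_derive t (1 : R) N (dN t).
  move=> /H[/is_derive_mxP dZt _].
  apply: is_derive_bigsum => i; apply: is_derive_bigsum => j.
  have := is_deriveM (dZt i j) (dZt i j).
  by rewrite /GRing.scale/= -mulrDl -mulr2n -[_ *+ 2]mulr_natl.
have small t : t \in `]0, T[ -> N t < rho ^+ 2 -> dN t <= a * (N t + c ^+ 2).
  move=> tT Nt; have Zr : `|Z t| < rho.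
    rewrite (le_lt_trans (ZsN t))// -[rho]ger0_norm ?(ltW rho0)// -sqrtr_sqr.
    by rewrite ltr_sqrt// exprn_gt0.
  have dZC := (H t tT).2 Zr.
  rewrite (le_trans (ler_norm _))// (le_trans (ndN t))//.
  have pq0 : 0 <= p%:R * q%:R :> R by rewrite mulr_ge0.
  apply: (@le_trans _ _ (2 * (p%:R * q%:R) * (`|Z t| * (C * (`|Z t| + c))))).
    by rewrite ler_wpM2l ?mulr_ge0// ler_wpM2l.
  have -> : 2 * (p%:R * q%:R) * (`|Z t| * (C * (`|Z t| + c))) =
     (p%:R * q%:R) * C * (2 * (`|Z t| * (`|Z t| + c))) by ring.
  have -> : a * (N t + c ^+ 2) = (p%:R * q%:R) * C * (3 * (N t + c ^+ 2)) by rewrite /a; ring.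
  rewrite ler_wpM2l ?mulr_ge0//.
  have := Zsq t; have := sqr_ge0 (`|Z t| - c); rewrite sqrrB expr2; nra.
have bound t : 0 <= t -> t <= T -> (forall s, 0 <= s -> s < t -> N s < rho ^+ 2) ->
    N t <= c ^+ 2 * k.
  move=> t0 tT Hs.
  have sub s : s \in `]0, t[ -> s \in `]0, T[.
    by rewrite !in_itv/= => /andP[-> /lt_le_trans]; exact.
  apply: (@le_trans _ _ (c ^+ 2 * expR (a * t))); last first.
    by rewrite ler_wpM2l ?sqr_ge0// ler_expR ler_wpM2l.
  apply: (@gronwall_scalar _ N dN) => //; first exact: sqr_ge0.
    exact: seg_cont_sub cN.
  move=> s st; split; first exact/dNP/sub.
  apply: small; first exact: sub.
  by apply: Hs; move: st; rewrite in_itv/= => /andP[/ltW].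
have ck2 : c ^+ 2 * k < rho ^+ 2.
  rewrite -[k]sqr_sqrtr ?(ltW k0)// -exprMn.
  by rewrite ltrXn2r// ?nnegrE ?mulr_ge0 ?sqrtr_ge0// ltW.
(* At a first exit time, [bound] would already give a value below rho^2. *)
have all_small : forall t, t \in `[0, T] -> N t < rho ^+ 2.
  apply: contrapT => /existsNP[t1 /not_implyP[t1T /negP]]; rewrite -leNgt => Nt1.
  have [||t [t0 tT Nt Hs]] := @first_exit _ T (rho ^+ 2) N cN.
  - by rewrite N00 exprn_gt0.
  - by exists t1.
  have := bound t (ltW t0) tT Hs.
  by rewrite leNgt (lt_le_trans ck2 Nt).
move=> t tT; rewrite (le_trans (ZsN t))//.
have -> : c * Num.sqrt k = Num.sqrt (c ^+ 2 * k).
  by rewrite sqrtrM ?sqr_ge0// sqrtr_sqr ger0_norm.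
rewrite ler_wsqrtr//; move: (tT); rewrite in_itv/= => /andP[t0 tT'].
apply: bound => // s s0 st; apply: all_small.
by rewrite in_itv/= s0 (le_trans (ltW st)).
Qed.

Section curve_inverse.
Variables (R : realType) (m n : nat) (G : set 'M[R]_m) (E B : 'I_n -> 'M[R]_m) (K : R).
Hypothesis HG : matrix_Lie_group G.
Hypothesis HE : is_basis_of E (lie_algebra G).
Hypothesis EB : forall x, coords B (Lam E x) = x.
Hypothesis HK : chart_const E B K.
Variables (T : R) (g : R -> 'M[R]_m).
Hypothesis Gg : forall t, t \in `[0, T] -> G (g t).
Hypothesis cg : seg_cont T g.

Lemma curve_inv_cont : seg_cont T (fun t => invmx (g t)).
Proof.
apply/seg_cont_mxP => i j.
apply: (curve_phi_cont HG HE EB HK Gg cg (phi := fun g _ _ => invmx g i j)).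
exact: (group_sdiff_inv HG HK).
Qed.

(** From A^-1 - B^-1 = -A^-1 (A - B) B^-1 and the continuity of the inverse along the curve. As [t]
    is interior, nearby points of the curve are still in G, hence invertible. *)
Lemma is_derive_inv t dg : t \in `]0, T[ -> is_derive t (1 : R) g dg ->
  is_derive t (1 : R) (fun s => invmx (g s)) (- (invmx (g t) *m dg *m invmx (g t))).
Proof.
move=> tT /is_deriveP dgP; apply/is_deriveP.
have tI : t \in `[0, T] by move: tT; rewrite !in_itv/= => /andP[/ltW-> /ltW->].
have nearT : \forall h \near (0 : R)^', h *: 1 + t \in `[0, T].
  apply: nbhs_dnbhs; move: tT; rewrite in_itv/= => /andP[t0 tT].
  apply/nbhs_ballP; exists (Num.min t (T - t)); first by rewrite /= lt_min t0 subr_gt0.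
  move=> h; rewrite -ball_normE/= sub0r normrN lt_min [h *: 1]mulr1.
  by rewrite !ltr_norml in_itv/= => /andP[/andP[h1 _] /andP[_ h2]]; apply/andP; split; lra.
have inv_cvg : invmx (g (h *: 1 + t)) @[h --> (0 : R)^'] --> invmx (g t).
  apply/cvgrPdist_le => e e0.
  have [d d0 Hd] := curve_inv_cont tI e0.
  have near_d : \forall h \near (0 : R)^', `|h| < d by exact: dnbhs0_lt.
  near=> h; rewrite distrC; apply: Hd; first by near: h.
  by rewrite addrK [h *: 1]mulr1; near: h.
have H : - (invmx (g (h *: 1 + t)) *m (h^-1 *: (g (h *: 1 + t) - g t)) *m invmx (g t))
    @[h --> (0 : R)^'] --> - (invmx (g t) *m dg *m invmx (g t)).
  by apply: cvgN; apply: cvg_mulmx; [exact: cvg_mulmx|exact: cvg_cst].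
apply: (cvg_trans _ H); apply: near_eq_cvg; near=> h.
have hT : h *: 1 + t \in `[0, T] by near: h.
have u := Lie_group_unit HG (Gg tI); have u' := Lie_group_unit HG (Gg hT).
rewrite /= -scalemxAr -scalemxAl -scalerN; congr (_ *: _).
by rewrite mulmxBr mulVmx// mulmxBl mul1mx -mulmxA mulmxV// mulmx1 opprB.
Unshelve. all: by end_near. Qed.

End curve_inverse.

Lemma is_derive_eps (R : realType) (V : normedModType R) (f : V -> R) x v a :
  (forall e, 0 < e -> exists2 d, 0 < d & forall h, `|h| < d ->
     `|f (h *: v + x) - f x - h * a| <= e * `|h|) ->
  is_derive x v f a.
Proof.
move=> H; apply/is_deriveP/cvgrPdist_le => e e0; have [d d0 Hd] := H e e0.
have near_d : \forall h \near (0 : R)^', `|h| < d by exact: dnbhs0_lt.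
near=> h; have h0 : h != 0 by near: h; exact: nbhs_dnbhs_neq.
have -> : a - h^-1 *: (f (h *: v + x) - f x) = - (h^-1 * (f (h *: v + x) - f x - h * a)).
  by rewrite /GRing.scale/= [in RHS]mulrBr mulKf// opprB.
rewrite normrN normrM normfV ler_pdivrMl ?normr_gt0// [leRHS]mulrC.
by apply: Hd; near: h.
Unshelve. all: by end_near. Qed.

Lemma fin_uniform (R : realType) (I : finType) (P : I -> R -> Prop) :
  (forall i, exists2 d, 0 < d & P i d) ->
  (forall i d d', 0 < d' -> d' <= d -> P i d -> P i d') ->
  exists2 d, 0 < d & forall i, P i d.
Proof.
move=> H mono; suff [d d0 Hd] : exists2 d, 0 < d & forall i, i \in enum I -> P i d.
  by exists d => // i; apply: Hd; rewrite mem_enum.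
elim: (enum I) => [|i s [d d0 IH]]; first by exists 1.
have [d' d'0 Hd'] := H i.
exists (Num.min d d') => [|k]; first by rewrite lt_min d0.
have dd0 : 0 < Num.min d d' by rewrite lt_min d0.
rewrite inE => /predU1P[->|ks].
  by apply: (mono _ d') => //; rewrite ge_min lexx orbT.
by apply: (mono _ d); rewrite ?ge_min ?lexx//; exact: IH.
Qed.

(** * The adjoint equation and the gradient of the cost *)

Section adjoint_action.
Variables (R : realType) (m n : nat) (G : set 'M[R]_m) (E B : 'I_n -> 'M[R]_m) (K : R).
Hypothesis HG : matrix_Lie_group G.
Hypothesis HE : is_basis_of E (lie_algebra G).
Hypothesis EB : forall x, coords B (Lam E x) = x.
Hypothesis HK : chart_const E B K.

Let K1 : 1 <= K. Proof. by case: HK. Qed.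
Let K0 : 0 <= K. Proof. exact: le_trans K1. Qed.
Let Kcoords X : `|coords B X| <= K * `|X|. Proof. by case: HK. Qed.
Let Kmul (X Y : 'M[R]_m) : `|X *m Y| <= K * `|X| * `|Y|. Proof. by case: HK. Qed.

(** [adm] applies [Laminv] to brackets of basis elements; these lie in the Lie algebra, so the
    linear [coords] may take its place, and linearity extends the formula to every [x]. *)
Lemma adm_mul a x : adm E a *m x = coords B (Lam E a *m Lam E x - Lam E x *m Lam E a).
Proof.
apply/colP => i; rewrite mxE.
have -> : Lam E a *m Lam E x - Lam E x *m Lam E a =
  \sum_j x j 0 *: (Lam E a *m Lam E (ev j) - Lam E (ev j) *m Lam E a).
  rewrite {2 4}/Lam mulmx_sumr mulmx_suml -sumrB; apply: eq_bigr => j _.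
  by rewrite Lam_ev -scalemxAl -scalemxAr scalerBr.
have -> : forall F : 'I_n -> 'M[R]_m, coords B (\sum_j F j) = \sum_j coords B (F j).
  move=> F; elim/big_ind2 : _ => // [|X x' Y y' <- <-]; last by rewrite coordsD.
  exact: coords0.
rewrite summxE; apply: eq_bigr => j _; rewrite coordsZ !mxE mulrC; congr (_ * _).
rewrite (Laminv_coords HE EB) ?mxE//.
by apply: (lie_algebra_bracket HG HE EB HK); exact: lie_algebra_Lam.
Qed.

Lemma bracket_norm_le (X Y : 'M[R]_m) :
  `|coords B (X *m Y - Y *m X)| <= 2 * K ^+ 2 * `|X| * `|Y|.
Proof.
rewrite (le_trans (Kcoords _))//.
have -> : 2 * K ^+ 2 * `|X| * `|Y| = K * (K * `|X| * `|Y| + K * `|Y| * `|X|) by ring.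
by rewrite ler_wpM2l// (le_trans (ler_normB _ _))// lerD.
Qed.

(* The costate equation is designed so that, in the derivative of
   lam . (X - 1) with X = exp(Lam q), all the terms linear in q cancel
   except - Ar . q. *)
Lemma costate_identity (q u0 u1 lam bU Ar : 'cV[R]_n) (AU : 'M[R]_n) (c br r0 r1 : R) :
  let X := expm (Lam E q) in
  let rho := X - 1%:M - Lam E q in
  dotv (- (AU^T *m lam + Ar) + (adm E u0)^T *m lam) (coords B (X - 1%:M))
  + dotv lam (coords B (- (Lam E u0 *m X) + X *m Lam E u1))
  - (c * (dotv lam bU + br) - (r1 - r0)) =
  (dotv lam (coords B (Lam E u0 *m Lam E (coords B rho) - Lam E (coords B rho) *m Lam E u0))
   - dotv lam (AU *m coords B rho) - dotv Ar (coords B rho))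
  + dotv lam (u1 - u0 - (AU *m q + c *: bU))
  + (r1 - r0 - (dotv Ar q + c * br))
  + dotv lam (coords B ((X - 1%:M) *m Lam E (u1 - u0)))
  - dotv lam (coords B (Lam E u0 *m rho - rho *m Lam E u0)).
Proof.
move=> X rho.
have tr (M : 'M[R]_n) x y : dotv (M^T *m x) y = dotv x (M *m y).
  by rewrite /dotv trmx_mul trmxK mulmxA.
have yE : coords B (X - 1%:M) = q + coords B rho.
  by rewrite -{1}[q]EB -coordsD /rho [Lam E q + _]addrC subrK.
have XE : X - 1%:M = Lam E q + rho by rewrite /rho [Lam E q + _]addrC subrK.
have X1 : X = 1%:M + (X - 1%:M) by rewrite [RHS]addrC subrK.
clearbody rho; clearbody X.
rewrite [dotv (_ + _) _]dotvDl -scaleN1r dotvZl dotvDl !tr yE.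
(* The identity part of X commutes with everything, which leaves the difference of the velocities,
   the bracket of [Lam E u0] with X - 1, and a product of two small factors. *)
have dXE : - (Lam E u0 *m X) + X *m Lam E u1 =
   Lam E (u1 - u0) - (Lam E u0 *m Lam E q - Lam E q *m Lam E u0)
   - (Lam E u0 *m rho - rho *m Lam E u0) + (X - 1%:M) *m Lam E (u1 - u0).
  rewrite XE {1 2}X1 XE LamB !mulmxDr !mulmxDl !mulmxN mulmx1 mul1mx.
  move: (Lam E u0 *m rho) (rho *m Lam E u0) (Lam E u0 *m Lam E q) (Lam E q *m Lam E u0)
    (Lam E q *m Lam E u1) (rho *m Lam E u1) (Lam E u0) (Lam E u1) => a b c' d e f g h.
  by apply/matrixP => i j; rewrite !mxE; ring.
rewrite dXE coordsD !coordsB EB -(coordsB _ (Lam E u0 *m Lam E q)) -adm_mul.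
rewrite -(coordsB _ (Lam E u0 *m Lam E (coords B rho))) -adm_mul.
have dN (x y : 'cV[R]_n) : dotv x (- y) = - dotv x y.
  by rewrite -scaleN1r dotvZr mulN1r.
rewrite !mulmxDr !(dN, dotvDr) !dotvZr.
ring.
Qed.

End adjoint_action.

Section core.
Variables (R : realType) (m n : nat) (G : set 'M[R]_m) (E B : 'I_n -> 'M[R]_m) (K : R).
Hypothesis HG : matrix_Lie_group G.
Hypothesis HE : is_basis_of E (lie_algebra G).
Hypothesis EB : forall x, coords B (Lam E x) = x.
Hypothesis HK : chart_const E B K.

Let K1 : 1 <= K. Proof. by case: HK. Qed.
Let K0 : 0 <= K. Proof. exact: le_trans K1. Qed.
Let Kcoords X : `|coords B X| <= K * `|X|. Proof. by case: HK. Qed.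
Let KLam x : `|Lam E x| <= K * `|x|. Proof. by case: HK. Qed.
Let Kmul (X Y : 'M[R]_m) : `|X *m Y| <= K * `|X| * `|Y|. Proof. by case: HK. Qed.

(** [W] depends only on the bounds [M], [L], [N], hence serves for all times at once. *)
Lemma costate_estimate (M L N : R) : 0 <= M -> 0 <= L -> 0 <= N ->
  exists2 W, 0 < W &
  forall (q u0 u1 lam bU Ar : 'cV[R]_n) (AU : 'M[R]_n) (c br r0 r1 e : R), 0 <= e ->
  `|lam| <= M -> `|AU| <= M -> `|Ar| <= M -> `|u0| <= M ->
  `|q| <= N * `|c| -> N * `|c| <= 1 -> `|u1 - u0| <= L * (`|q| + `|c|) ->
  `|u1 - u0 - (AU *m q + c *: bU)| <= e * (`|q| + `|c|) ->
  `|r1 - r0 - (dotv Ar q + c * br)| <= e * (`|q| + `|c|) ->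
  forall X, X = expm (Lam E q) ->
  `|dotv (- (AU^T *m lam + Ar) + (adm E u0)^T *m lam) (coords B (X - 1%:M))
    + dotv lam (coords B (- (Lam E u0 *m X) + X *m Lam E u1))
    - (c * (dotv lam bU + br) - (r1 - r0))| <= W * (e + `|c|) * `|c|.
Proof.
move=> M0 L0 N0; pose k : R := n%:R.
have k0 : 0 <= k by rewrite ler0n.
pose P := K ^+ 2 * N ^+ 2.
have P0 : 0 <= P by rewrite mulr_ge0// exprn_ge0.
(* [W1] to [W6] bound the terms on the right of [costate_identity] in their order. [W4] gathers the
   two linearisation errors, which are of size e |c|; all the others are quadratic in c. *)
pose W1 := k * M * (2 * K ^+ 2 * (K * M) * (K * P)).
pose W2 := k * M * (k * M * P).
pose W3 := k * M * P.
pose W4 := k * M * (N + 1) + (N + 1).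
pose W5 := k * M * (K * (K * (2 * (K * N)) * (K * (L * (N + 1))))).
pose W6 := k * M * (2 * K ^+ 2 * (K * M) * (K * N ^+ 2)).
have W10 : 0 <= W1 by rewrite !(mulr_ge0, exprn_ge0).
have W20 : 0 <= W2 by rewrite !(mulr_ge0, exprn_ge0).
have W30 : 0 <= W3 by rewrite !(mulr_ge0, exprn_ge0).
have W40 : 0 <= W4 by rewrite !(addr_ge0, mulr_ge0).
have W50 : 0 <= W5 by rewrite !(mulr_ge0, exprn_ge0, addr_ge0).
have W60 : 0 <= W6 by rewrite !(mulr_ge0, exprn_ge0).
exists (1 + W1 + W2 + W3 + W4 + W5 + W6); first by lra.
move=> q u0 u1 lam bU Ar AU c br r0 r1 e e0 lamM AUM ArM u0M qN Nc1 u10 hu hr X XE.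
rewrite {1 2 3}XE (costate_identity HG HE EB HK) -XE.
set rho := X - 1%:M - Lam E q; set s := `|c| in qN Nc1 u10 hu hr *.
have s0 : 0 <= s by exact: normr_ge0.
have q1 : `|q| <= 1 by exact: le_trans qN Nc1.
have rhos : `|rho| <= K * N ^+ 2 * s ^+ 2.
  rewrite /rho XE (le_trans (expm_Lam1 HK q1))//.
  have -> : K * N ^+ 2 * s ^+ 2 = K * (N * s) * (N * s) by ring.
  by rewrite ler_pM// ?mulr_ge0// ler_wpM2l.
have crho : `|coords B rho| <= P * s ^+ 2.
  rewrite (le_trans (Kcoords _))//.
  have -> : P * s ^+ 2 = K * (K * N ^+ 2 * s ^+ 2) by rewrite /P; ring.
  by rewrite ler_wpM2l.
have dotM (x y : 'cV[R]_n) a b : `|x| <= a -> `|y| <= b -> `|dotv x y| <= k * a * b.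
  move=> xa yb; rewrite (le_trans (dotv_norm_le _ _))// ler_pM ?mulr_ge0//.
  by rewrite ler_wpM2l.
have Lu0 : `|Lam E u0| <= K * M by rewrite (le_trans (KLam _))// ler_wpM2l.
have qs : `|q| + s <= (N + 1) * s by rewrite mulrDl mul1r lerD2r.
have B1 : `|dotv lam (coords B (Lam E u0 *m Lam E (coords B rho) - Lam E (coords B rho) *m Lam E u0))|
    <= W1 * s ^+ 2.
  have -> : W1 * s ^+ 2 = k * M * (2 * K ^+ 2 * (K * M) * (K * (P * s ^+ 2))) by rewrite /W1; ring.
  apply: dotM => //; rewrite (le_trans (bracket_norm_le HK _ _))//.
  rewrite ler_pM ?mulr_ge0 ?exprn_ge0//; first by rewrite ler_wpM2l// mulr_ge0// exprn_ge0.
  by rewrite (le_trans (KLam _))// ler_wpM2l.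
have B2 : `|dotv lam (AU *m coords B rho)| <= W2 * s ^+ 2.
  have -> : W2 * s ^+ 2 = k * M * (k * M * (P * s ^+ 2)) by rewrite /W2; ring.
  apply: dotM => //; rewrite (le_trans (mulmx_norm_le _ _))// ler_pM ?mulr_ge0//.
  by rewrite ler_wpM2l.
have B3 : `|dotv Ar (coords B rho)| <= W3 * s ^+ 2.
  by have := dotM _ _ _ _ ArM crho; rewrite /W3 mulrA.
have B4 : `|dotv lam (u1 - u0 - (AU *m q + c *: bU))| <= k * M * (N + 1) * e * s.
  have -> : k * M * (N + 1) * e * s = k * M * (e * ((N + 1) * s)) by ring.
  by apply: dotM => //; rewrite (le_trans hu)// ler_wpM2l.
have B4' : `|r1 - r0 - (dotv Ar q + c * br)| <= (N + 1) * e * s.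
  by rewrite (le_trans hr)// [leRHS]mulrAC [leRHS]mulrC ler_wpM2l.
have B5 : `|dotv lam (coords B ((X - 1%:M) *m Lam E (u1 - u0)))| <= W5 * s ^+ 2.
  have -> : W5 * s ^+ 2 = k * M * (K * (K * (2 * (K * (N * s))) * (K * (L * ((N + 1) * s))))).
    by rewrite /W5; ring.
  apply: dotM => //; rewrite (le_trans (Kcoords _))// ler_wpM2l// (le_trans (Kmul _ _))//.
  rewrite ler_pM ?mulr_ge0//.
    by rewrite ler_wpM2l// XE (le_trans (norm_expm_Lam1 HK q1))// ler_wpM2l// ler_wpM2l.
  by rewrite (le_trans (KLam _))// ler_wpM2l// (le_trans u10)// ler_wpM2l.
have B6 : `|dotv lam (coords B (Lam E u0 *m rho - rho *m Lam E u0))| <= W6 * s ^+ 2.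
  have -> : W6 * s ^+ 2 = k * M * (2 * K ^+ 2 * (K * M) * (K * N ^+ 2 * s ^+ 2)).
    by rewrite /W6; ring.
  apply: dotM => //; rewrite (le_trans (bracket_norm_le HK _ _))//.
  rewrite ler_pM ?mulr_ge0 ?exprn_ge0//; first by rewrite ler_wpM2l// mulr_ge0// exprn_ge0.
have es : 0 <= e * s by rewrite mulr_ge0.
have ss : 0 <= s ^+ 2 by rewrite exprn_ge0.
have -> : (1 + W1 + W2 + W3 + W4 + W5 + W6) * (e + s) * s =
  (1 + W1 + W2 + W3 + W5 + W6) * (e * s) + W4 * (e * s)
  + (1 + W4) * s ^+ 2 + (W1 + W2 + W3 + W5 + W6) * s ^+ 2 by ring.
have p1 : 0 <= (1 + W1 + W2 + W3 + W5 + W6) * (e * s) by rewrite mulr_ge0// !addr_ge0.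
have p2 : 0 <= (1 + W4) * s ^+ 2 by rewrite mulr_ge0// addr_ge0.
have e4 : W4 * (e * s) = k * M * (N + 1) * e * s + (N + 1) * e * s by rewrite /W4; ring.
rewrite e4 [(W1 + _ + _ + _ + _) * _]mulrDl ![(_ + W5) * _]mulrDl [(_ + W3) * _]mulrDl [(W1 + _) * _]mulrDl.
set t1 := dotv _ _ in B1 *; set t2 := dotv _ _ in B2 *; set t3 := dotv _ _ in B3 *.
set t4 := dotv _ _ in B4 *; set t5 := _ - _ in B4' *; set t6 := dotv _ _ in B5 *.
set t7 := dotv _ _ in B6 *.
move: B1 B2 B3 B4 B4' B5 B6; rewrite !ler_norml.
move: t1 t2 t3 t4 t5 t6 t7 p1 p2 => t1 t2 t3 t4 t5 t6 t7.
clear.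
set x1 := W1 * _; set x2 := W2 * _; set x3 := W3 * _; set x5 := W5 * _; set x6 := W6 * _.
set x4 := k * M * _ * e * s; set x4' := (N + 1) * e * s.
set y1 := _ * (e * s); set y2 := _ * s ^+ 2.
move: x1 x2 x3 x5 x6 x4 x4' y1 y2 => x1 x2 x3 x5 x6 x4 x4' y1 y2.
move=> y10 y20 /andP[a1 b1] /andP[a2 b2] /andP[a3 b3] /andP[a4 b4] /andP[a5 b5] /andP[a6 b6] /andP[a7 b7].
by apply/andP; split; lra.
Qed.

End core.

Lemma affine_approx_norm_le (R : realType) n (A : 'M[R]_n) (b q x : 'cV[R]_n) (c M N : R) :
  `|A| <= M -> `|b| <= N -> `|x - (A *m q + c *: b)| <= `|q| + `|c| ->
  `|x| <= (1 + n%:R * M + N) * (`|q| + `|c|).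
Proof.
move=> AM bN H; rewrite -[x](subrK (A *m q + c *: b)) (le_trans (ler_normD _ _))//.
have := ler_normD (A *m q) (c *: b).
have : `|A *m q| <= n%:R * M * `|q|.
  by rewrite (le_trans (mulmx_norm_le _ _))// ler_wpM2r// ler_wpM2l.
have : `|c *: b| <= `|c| * N by rewrite normrZ ler_wpM2l.
have : 0 <= n%:R * M * `|c| by rewrite !mulr_ge0// (le_trans _ AM).
have : 0 <= N * `|q| by rewrite !mulr_ge0// (le_trans _ bN).
move: H; lra.
Qed.

(** * Distance between trajectories for nearby parameters *)

Section perturbation.
Variables (R : realType) (m n : nat) (G : set 'M[R]_m) (E B : 'I_n -> 'M[R]_m) (K : R).
Hypothesis HG : matrix_Lie_group G.
Hypothesis HE : is_basis_of E (lie_algebra G).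
Hypothesis EB : forall x, coords B (Lam E x) = x.
Hypothesis HK : chart_const E B K.
Variables (T : R) (h : R -> R -> 'M[R]_m) (u : 'M[R]_m -> R -> R -> 'cV[R]_n).
(* h c is the trajectory for the parameter theta + c e_j, and
   u g t c = Lam^-1 (g^-1 f) at that parameter. *)
Hypothesis T0 : 0 < T.
Hypothesis Gh : forall c t, t \in `[0, T] -> G (h c t).
Hypothesis ch : forall c, seg_cont T (h c).
Hypothesis h0 : forall c, h c 0 = h 0 0.
Hypothesis dh : forall c t, t \in `]0, T[ ->
  is_derive t (1 : R) (h c) (h c t *m Lam E (u (h c t) t c)).
Hypothesis su : forall i, group_sdiff G E (fun g t c => u g t c i 0).

Let K1 : 1 <= K. Proof. by case: HK. Qed.
Let K0 : 0 <= K. Proof. exact: le_trans K1. Qed.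
Let KLam x : `|Lam E x| <= K * `|x|. Proof. by case: HK. Qed.
Let Kmul (X Y : 'M[R]_m) : `|X *m Y| <= K * `|X| * `|Y|. Proof. by case: HK. Qed.

Let oo_cc t : t \in `]0, T[ -> t \in `[0, T].
Proof. by rewrite !in_itv/= => /andP[/ltW-> /ltW->]. Qed.

Lemma curve_uniform_vec : exists (AU : R -> 'M[R]_n) (bU : R -> 'cV[R]_n),
  [/\ seg_cont T AU, seg_cont T bU &
   forall e, 0 < e -> exists2 d, 0 < d & forall t, t \in `[0, T] ->
     forall q c, `|q| < d -> `|c| < d ->
     `|u (h 0 t *m expm (Lam E q)) t c - u (h 0 t) t 0 - (AU t *m q + c *: bU t)|
       <= e * (`|q| + `|c|)].
Proof.
have H i := curve_uniform HG HE EB HK (@Gh 0) (ch 0) (su i).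
pose A i := projT1 (cid (H i)); have HA i := projT2 (cid (H i)).
pose b i := projT1 (cid (HA i)); have Hb i := projT2 (cid (HA i)).
exists (fun t => \matrix_(i, j) A i t j 0), (fun t => \col_i b i t); split.
- apply/seg_cont_mxP => i j; have [+ _ _] := Hb i => /seg_cont_mxP/(_ j 0).
  by under [in X in _ -> X]eq_fun do rewrite mxE.
- apply/seg_cont_mxP => i j; have [_ + _] := Hb i.
  by under [in X in _ -> X]eq_fun do rewrite mxE.
move=> e e0.
have [||d d0 Hd] := @fin_uniform R 'I_n (fun i d => forall t, t \in `[0, T] ->
     forall q c, `|q| < d -> `|c| < d ->
     `|u (h 0 t *m expm (Lam E q)) t c i 0 - u (h 0 t) t 0 i 0 - (dotv (A i t) q + c * b i t)|
       <= e * (`|q| + `|c|)).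
- by move=> i; have [_ _] := Hb i; exact.
- by move=> i d d' d'0 dd' Hi t tT q c qd cd; apply: Hi => //; exact: lt_le_trans dd'.
exists d => // t tT q c qd cd.
apply: mx_norm_le => [|i j]; first by rewrite mulr_ge0 ?addr_ge0// ltW.
rewrite ord1; have := Hd i t tT q c qd cd; rewrite !mxE dotvE.
by under [X in _ -> `|_ - (X + _)| <= _]eq_bigr do rewrite mxE.
Qed.

(** Both velocities are written as group element times Lie algebra element, so X = g^-1 g_c
    satisfies an equation in which g appears only through the velocities. *)
Lemma is_derive_deviation c t : t \in `]0, T[ ->
  is_derive t (1 : R) (fun s => invmx (h 0 s) *m h c s - 1%:M)
    (- (Lam E (u (h 0 t) t 0) *m (invmx (h 0 t) *m h c t))
     + (invmx (h 0 t) *m h c t) *m Lam E (u (h c t) t c)).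
Proof.
move=> tT; have g0u := Lie_group_unit HG (Gh 0 (oo_cc tT)).
have := is_derive_mulmx (is_derive_inv HG HE EB HK (@Gh 0) (ch 0) tT (dh 0 tT)) (dh c tT).
rewrite mulKmx// !mulNmx -!mulmxA => H.
have := is_deriveB H (is_derive_cst (1%:M : 'M[R]_m) t (1 : R)).
by rewrite subr0.
Qed.

Lemma deviation_cont c : seg_cont T (fun s => invmx (h 0 s) *m h c s - 1%:M).
Proof.
apply: seg_contD; last exact: seg_cont_cst.
have /seg_cont_mxP ci := curve_inv_cont HG HE EB HK (@Gh 0) (ch 0).
have /seg_cont_mxP cc := ch c.
apply/seg_cont_mxP => i j; under eq_fun do rewrite mxE.
by apply: seg_cont_sum => k; exact: seg_contM.
Qed.

(** The velocities can be compared only while g_c is in the chart around g, that is for |Z| < rho;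
    [gronwall_mx] accepts such a conditional inequality. All trajectories start at the same point,
    so Z vanishes at time 0. *)
Lemma state_bound : exists N d, [/\ 0 <= N, 0 < d &
  forall c t, `|c| < d -> t \in `[0, T] ->
    exists2 q, h c t = h 0 t *m expm (Lam E q) & `|q| <= N * `|c|].
Proof.
have K0' : 0 < K := lt_le_trans ltr01 K1.
have [d0 d00 Hchart] := Lie_group_chart HG HE EB HK.
have [AU [bU [cA cb HU]]] := curve_uniform_vec.
have [M1 M10 HM1] := seg_cont_bounded cA; have [M2 M20 HM2] := seg_cont_bounded cb.
have cu : seg_cont T (fun t => u (h 0 t) t 0).
  apply/seg_cont_mxP => i j; rewrite ord1.
  exact: (curve_phi_cont HG HE EB HK (@Gh 0) (ch 0) (su i)).
have [M3 M30 HM3] := seg_cont_bounded cu.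
have [d1 d10 Hd1] := HU 1 ltr01.
pose L := 1 + n%:R * M1 + M2.
have L0 : 0 <= L by rewrite !addr_ge0 ?mulr_ge0// ltW.
have lip t q c : t \in `[0, T] -> `|q| < d1 -> `|c| < d1 ->
    `|u (h 0 t *m expm (Lam E q)) t c - u (h 0 t) t 0| <= L * (`|q| + `|c|).
  move=> tT qd cd; have := Hd1 t tT q c qd cd; rewrite mul1r => H.
  exact: affine_approx_norm_le (HM1 t tT) (HM2 t tT) H.
(* [d0] gives access to the chart, 1 keeps |X| at most 2, and d1 / (2 K) places [q] within the
   radius of [lip]. *)
pose rho := Num.min (Num.min d0 1) (d1 / (2 * K)).
have rho0 : 0 < rho by rewrite !lt_min d00 ltr01 divr_gt0// mulr_gt0.
(* The sum of the coefficients of |Z| and of |c| in [T1], [T2] and [T3] below. *)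
pose C := 2 * K ^+ 2 * M3 + 2 * K ^+ 2 * L + 4 * K ^+ 3 * L.
have C0 : 0 <= C by rewrite !addr_ge0// !mulr_ge0// ?exprn_ge0// ltW.
pose Z c t := invmx (h 0 t) *m h c t - 1%:M.
have GZ c t : t \in `[0, T] -> G (invmx (h 0 t) *m h c t).
  by move=> tT; apply: (Lie_groupM HG); [apply: (Lie_groupV HG)|]; exact: Gh.
have chart c t : t \in `[0, T] -> `|Z c t| < rho ->
    exists2 q, invmx (h 0 t) *m h c t = expm (Lam E q) /\ h c t = h 0 t *m expm (Lam E q)
      & `|q| <= 2 * K * `|Z c t| /\ `|q| < d1.
  move=> tT; rewrite !lt_min => /andP[/andP[Zd0 Z1] Zd1].
  have [q qE qZ] := Hchart _ (GZ c t tT) Zd0.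
  exists q.
    by split => //; rewrite -qE mulKVmx//; exact: (Lie_group_unit HG (Gh 0 tT)).
  by split => //; rewrite (le_lt_trans qZ)// mulrC -ltr_pdivlMr// mulr_gt0.
pose k := expR (3 * (m%:R * m%:R) * C * T).
have sk0 : 0 < Num.sqrt k by rewrite sqrtr_gt0 expR_gt0.
pose N := 2 * K * Num.sqrt k.
exists N, (Num.min d1 (rho / Num.sqrt k)); split.
- by rewrite !mulr_ge0// ltW.
- by rewrite lt_min d10 divr_gt0.
move=> c t; rewrite lt_min => /andP[cd1]; rewrite ltr_pdivlMr// => crho tT.
have Zb : `|Z c t| <= `|c| * Num.sqrt k.
  apply: (@gronwall_mx R m m (Z c) (fun s => - (Lam E (u (h 0 s) s 0) *m (invmx (h 0 s) *m h c s))
     + (invmx (h 0 s) *m h c s) *m Lam E (u (h c s) s c)) T rho C `|c|) => //.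
  - exact: ltW.
  - exact: deviation_cont.
  - by rewrite /Z h0 mulVmx ?subrr//; apply: (Lie_group_unit HG); apply: Gh; rewrite in_itv/= lexx ltW.
  move=> s sT; split; first exact: is_derive_deviation.
  move=> Zr; have sI := oo_cc sT.
  have [q [qE hE] [qZ qd]] := chart c s sI Zr.
  set u0 := u (h 0 s) s 0; set u1 := u (h c s) s c; set X := invmx (h 0 s) *m h c s.
  have XE : X = 1%:M + Z c s by rewrite /Z [RHS]addrC subrK.
  have -> : - (Lam E u0 *m X) + X *m Lam E u1 =
    (Z c s *m Lam E u0 - Lam E u0 *m Z c s) + X *m Lam E (u1 - u0).
    rewrite LamB XE; move: (Z c s) (Lam E u0) (Lam E u1) => z a b.
    rewrite !mulmxDr !mulmxDl !mulmxN !mul1mx !mulmx1.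
    move: (z *m a) (a *m z) (z *m b) => v w x.
    by apply/matrixP => i j; rewrite !mxE; ring.
  have Z1 : `|Z c s| <= 1.
    by rewrite ltW// (lt_le_trans Zr)// !ge_min lexx orbT.
  have X2 : `|X| <= 2.
    by rewrite XE (le_trans (ler_normD _ _))//; have := norm_scalar1_le1 R m; lra.
  have u01 : `|u1 - u0| <= L * (2 * K * `|Z c s| + `|c|).
    by rewrite /u1 hE (le_trans (lip s q c sI qd cd1))// ler_wpM2l// lerD2r.
  have Lu0 : `|Lam E u0| <= K * M3 by rewrite (le_trans (KLam _))// ler_wpM2l// HM3.
  have T1 : `|Z c s *m Lam E u0| <= K ^+ 2 * M3 * `|Z c s|.
    rewrite (le_trans (Kmul _ _))//.
    have -> : K ^+ 2 * M3 * `|Z c s| = K * `|Z c s| * (K * M3) by ring.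
    by rewrite ler_wpM2l// mulr_ge0.
  have T2 : `|Lam E u0 *m Z c s| <= K ^+ 2 * M3 * `|Z c s|.
    rewrite (le_trans (Kmul _ _))//.
    have -> : K ^+ 2 * M3 * `|Z c s| = K * (K * M3) * `|Z c s| by ring.
    by rewrite ler_wpM2r// ler_wpM2l.
  have T3 : `|X *m Lam E (u1 - u0)| <= 4 * K ^+ 3 * L * `|Z c s| + 2 * K ^+ 2 * L * `|c|.
    rewrite (le_trans (Kmul _ _))//.
    have -> : 4 * K ^+ 3 * L * `|Z c s| + 2 * K ^+ 2 * L * `|c| =
      K * 2 * (K * (L * (2 * K * `|Z c s| + `|c|))) by ring.
    rewrite ler_pM ?mulr_ge0//; first by rewrite ler_wpM2l.
    by rewrite (le_trans (KLam _))// ler_wpM2l.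
  have H1 := ler_normD (Z c s *m Lam E u0 - Lam E u0 *m Z c s) (X *m Lam E (u1 - u0)).
  have H2 := ler_normB (Z c s *m Lam E u0) (Lam E u0 *m Z c s).
  apply: (le_trans H1); apply: (le_trans (lerD (le_trans H2 (lerD T1 T2)) T3)).
  have e1 : 0 <= 2 * K ^+ 2 * L * `|Z c s| by rewrite !mulr_ge0// exprn_ge0.
  have e2 : 0 <= (2 * K ^+ 2 * M3 + 4 * K ^+ 3 * L) * `|c|.
    by rewrite mulr_ge0// addr_ge0// !mulr_ge0// ?exprn_ge0// ltW.
  rewrite /C; lra.
have Zr : `|Z c t| < rho by exact: le_lt_trans Zb crho.
have [q [_ hE] [qZ _]] := chart c t tT Zr.
exists q => //; rewrite (le_trans qZ)//.
have -> : N * `|c| = 2 * K * (`|c| * Num.sqrt k) by rewrite /N; ring.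
by rewrite ler_wpM2l// mulr_ge0.
Qed.

End perturbation.

Section seg_integral.
Variables (R : realType) (T : R).
Hypothesis T0 : 0 < T.
Notation mu := (@lebesgue_measure R).

Lemma seg_cont_integrable (f : R -> R) : seg_cont T f -> mu.-integrable `[0, T] (EFin \o f).
Proof.
by move=> /within_seg_cont cf; apply: continuous_compact_integrable => //; exact: segment_compact.
Qed.

Lemma seg_cont_integral (f : R -> R) : seg_cont T f ->
  seg_cont T (fun t => Rintegral mu `[0, t] f).
Proof.
move=> cf; apply/within_seg_cont.
by apply: (@parameterized_integral_continuous R 0 T f (ltW T0)); exact: seg_cont_integrable.
Qed.

Lemma is_derive_integral (f : R -> R) t : seg_cont T f -> t \in `]0, T[ ->
  is_derive t (1 : R) (fun t => Rintegral mu `[0, t] f) (f t).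
Proof.
move=> cf; rewrite in_itv/= => /andP[t0 tT].
have tI : t \in `[0, T] by rewrite in_itv/= !ltW.
have ct : {for t, continuous f}.
  apply/cvgrPdist_le => e e0; have [d d0 Hd] := cf t e tI e0.
  apply/nbhs_ballP; exists (Num.min d (Num.min t (T - t))).
    by rewrite /= !lt_min d0 t0 subr_gt0.
  move=> s /=; rewrite /ball/= !lt_min => /andP[sd /andP[]].
  rewrite !ltr_norml => /andP[h1 h2] /andP[h3 h4].
  rewrite distrC; apply: Hd; last by rewrite distrC.
  by rewrite in_itv/=; apply/andP; split; lra.
have [] := continuous_FTC1_closed tT (seg_cont_integrable cf) t0 ct.
by move=> dF FE; split; [exact: dF|rewrite -derive1E; exact: FE].
Qed.

End seg_integral.

(** * The derivative of the cost in a scalar parameter *)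

Section gradient.
Variables (R : realType) (m n : nat) (G : set 'M[R]_m) (E B : 'I_n -> 'M[R]_m) (K : R).
Hypothesis HG : matrix_Lie_group G.
Hypothesis HE : is_basis_of E (lie_algebra G).
Hypothesis EB : forall x, coords B (Lam E x) = x.
Hypothesis HK : chart_const E B K.
Notation mu := (@lebesgue_measure R).

(** Identifies the coefficients that [curve_uniform] obtained by choice: [A] holds the chart
    derivatives that define [dg], and [b] is the derivative in the parameter. *)
Lemma dg_uniform (phi : 'M[R]_m -> R -> R -> R) (g : 'M[R]_m) t (A : 'cV[R]_n) b :
  (forall e, 0 < e -> exists2 d, 0 < d & forall q c, `|q| < d -> `|c| < d ->
     `|phi (g *m expm (Lam E q)) t c - phi g t 0 - (dotv A q + c * b)|
       <= e * (`|q| + `|c|)) ->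
  (forall i, is_derive (0 : 'cV[R]_n) (ev i) (fun q => phi (g *m expm (Lam E q)) t 0) (A i 0)) /\
  is_derive (0 : R) (1 : R) (fun c => phi g t c) b.
Proof.
move=> H; have g0 : g *m expm (Lam E 0) = g by rewrite Lam0 expm0 mulmx1.
split=> [i|]; apply: is_derive_eps => e e0; have [d d0 Hd] := H e e0; exists d => // c cd.
  have evc : `|c *: (ev i : 'cV[R]_n)| <= `|c|.
    rewrite normrZ ler_piMr//.
    by apply: mx_norm_le => // k l; rewrite mxE; case: (_ && _); rewrite ?normr1 ?normr0.
  have := Hd (c *: ev i) 0 (le_lt_trans evc cd); rewrite normr0 => /(_ d0).
  rewrite mul0r !addr0 dotvZr dotv_ev g0 => /le_trans; apply.
  by rewrite ler_wpM2l// ltW.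
have := Hd 0 c; rewrite normr0 dotv0r !add0r addr0 g0 => /(_ d0 cd).
by rewrite [c *: 1]mulr1.
Qed.

Variables (T : R) (h : R -> R -> 'M[R]_m) (u : 'M[R]_m -> R -> R -> 'cV[R]_n).
Hypothesis T0 : 0 < T.
Hypothesis Gh : forall c t, t \in `[0, T] -> G (h c t).
Hypothesis ch : forall c, seg_cont T (h c).
Hypothesis h0 : forall c, h c 0 = h 0 0.
Hypothesis dh : forall c t, t \in `]0, T[ ->
  is_derive t (1 : R) (h c) (h c t *m Lam E (u (h c t) t c)).
Hypothesis su : forall i, group_sdiff G E (fun g t c => u g t c i 0).

Let K1 : 1 <= K. Proof. by case: HK. Qed.
Let K0 : 0 <= K. Proof. exact: le_trans K1. Qed.
Let Kcoords X : `|coords B X| <= K * `|X|. Proof. by case: HK. Qed.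
Let oo_cc t : t \in `]0, T[ -> t \in `[0, T].
Proof. by rewrite !in_itv/= => /andP[/ltW-> /ltW->]. Qed.

Variables (r F : 'M[R]_m -> R -> R -> R) (lam : R -> 'cV[R]_n).
Hypothesis sr : forall c, group_sdiff G E (fun g t c' => r g t (c + c')).
Hypothesis sF : group_sdiff G E F.
Hypothesis clam : seg_cont T lam.
Hypothesis dlam : forall t, t \in `]0, T[ -> is_derive t (1 : R) lam
  (- dg E (fun X => dotv (lam t) (u X t 0) + r X t 0) (h 0 t)
   + (adm E (u (h 0 t) t 0))^T *m lam t).
Hypothesis lamT : lam T = dg E (fun X => F X T 0) (h 0 T).

Lemma cost_gradient :
  is_derive (0 : R) (1 : R)
    (fun c => F (h c T) T c + Rintegral mu `[0, T] (fun s => r (h c s) s c))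
    ('D_1 (fun c => F (h 0 T) T c) 0
     + Rintegral mu `[0, T] (fun t => 'D_1 (fun c => dotv (lam t) (u (h 0 t) t c)) 0
                                   + 'D_1 (fun c => r (h 0 t) t c) 0)).
Proof.
have sum_le (a b c d v w : R) : a <= b -> c <= d -> 0 <= v -> w + a + c <= d + w + b + v.
  by lra.
have TI : T \in `[0, T] by rewrite in_itv/= lexx ltW.
have sr0 : group_sdiff G E r.
  by have := sr 0; under [in X in X -> _]eq_fun do under eq_fun do under eq_fun do rewrite add0r.
have [AU [bU [cAU cbU HU]]] := curve_uniform_vec HG HE EB HK Gh ch su.
have [Ar [br [cAr cbr Hr]]] := curve_uniform HG HE EB HK (@Gh 0) (ch 0) sr0.
have [AF [bF [_ _ HF]]] := curve_uniform HG HE EB HK (@Gh 0) (ch 0) sF.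
have Udir t i : t \in `[0, T] ->
    is_derive (0 : 'cV[R]_n) (ev i) (fun q => u (h 0 t *m expm (Lam E q)) t 0) (col i (AU t)) /\
    is_derive (0 : R) (1 : R) (fun c => u (h 0 t) t c) (bU t).
  move=> tT.
  have Hk k : forall e, 0 < e -> exists2 d, 0 < d & forall q c, `|q| < d -> `|c| < d ->
     `|u (h 0 t *m expm (Lam E q)) t c k 0 - u (h 0 t) t 0 k 0
        - (dotv (row k (AU t))^T q + c * bU t k 0)| <= e * (`|q| + `|c|).
    move=> e e0; have [d d0 Hd] := HU e e0; exists d => // q c qd cd.
    apply: le_trans (Hd t tT q c qd cd).
    apply: le_trans (mx_entry_le _ k 0); rewrite !mxE dotvE.
    by under eq_bigr do rewrite !mxE.
  split; apply/is_derive_mxP => k j; rewrite ord1.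
    have [/(_ i) + _] := dg_uniform (phi := fun g t c => u g t c k 0) (Hk k).
    by rewrite !mxE.
  by have [_] := dg_uniform (phi := fun g t c => u g t c k 0) (Hk k).
have Rdir t : t \in `[0, T] ->
    (forall i, is_derive (0 : 'cV[R]_n) (ev i) (fun q => r (h 0 t *m expm (Lam E q)) t 0) (Ar t i 0)) /\
    is_derive (0 : R) (1 : R) (fun c => r (h 0 t) t c) (br t).
  move=> tT; apply: dg_uniform => e e0; have [d d0 Hd] := Hr e e0.
  by exists d => // q c; exact: Hd.
have [FdirA Fdirb] : (forall i, is_derive (0 : 'cV[R]_n) (ev i)
      (fun q => F (h 0 T *m expm (Lam E q)) T 0) (AF T i 0)) /\
    is_derive (0 : R) (1 : R) (fun c => F (h 0 T) T c) (bF T).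
  apply: dg_uniform => e e0; have [d d0 Hd] := HF e e0.
  by exists d => // q c; exact: Hd.
have lamTE : lam T = AF T.
  by rewrite lamT; apply/colP => i; rewrite mxE; have [_ ->] := FdirA i.
have dgE t : t \in `[0, T] ->
    dg E (fun X => dotv (lam t) (u X t 0) + r X t 0) (h 0 t) = (AU t)^T *m lam t + Ar t.
  move=> tT; apply/colP => i; rewrite mxE.
  have H1 := is_derive_dotv (is_derive_cst (lam t) (0 : 'cV[R]_n) (ev i)) (Udir t i tT).1.
  have [_ ->] := is_deriveD H1 ((Rdir t tT).1 i).
  rewrite dotv0l add0r !mxE dotvE; congr (_ + _); apply: eq_bigr => k _.
  by rewrite !mxE mulrC.
(* The integrand of the claimed derivative, in a form whose continuity in t is visible. *)
pose kappa t := dotv (lam t) (bU t) + br t.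
have kappaE t : t \in `[0, T] ->
   'D_1 (fun c => dotv (lam t) (u (h 0 t) t c)) 0 + 'D_1 (fun c => r (h 0 t) t c) 0 = kappa t.
  move=> tT; have [_ ->] := (Rdir t tT).2.
  have i0 : forall i : 'I_n, is_derive (0 : R) (1 : R) (fun c => u (h 0 t) t c) (bU t).
    by move=> i; exact: (Udir t i tT).2.
  have ub : is_derive (0 : R) (1 : R) (fun c => u (h 0 t) t c) (bU t).
    by apply/is_derive_mxP => i j; have /is_derive_mxP := i0 i; exact.
  have [_ ->] := is_derive_dotv (is_derive_cst (lam t) (0 : R) (1 : R)) ub.
  by rewrite dotv0l add0r.
have -> : Rintegral mu `[0, T] (fun t => 'D_1 (fun c => dotv (lam t) (u (h 0 t) t c)) 0
      + 'D_1 (fun c => r (h 0 t) t c) 0) = Rintegral mu `[0, T] kappa.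
  by apply: eq_Rintegral => t; rewrite inE /= => tT; exact: kappaE.
have [_ ->] := Fdirb.
have ckappa : seg_cont T kappa.
  apply: seg_contD => //; rewrite (_ : (fun t => _) = fun t => \sum_i lam t i 0 * bU t i 0).
    move/seg_cont_mxP : clam => cl; move/seg_cont_mxP : cbU => cb.
    by apply: seg_cont_sum => i; exact: seg_contM.
  by apply/funext => t; rewrite dotvE.
(* Here [sr] is used at every c: the running cost along each perturbed trajectory has to be
   integrable. *)
have crc c : seg_cont T (fun t => r (h c t) t c).
  by have := curve_phi_cont HG HE EB HK (@Gh c) (ch c) (sr c); under eq_fun do rewrite addr0.
have cu : seg_cont T (fun t => u (h 0 t) t 0).
  apply/seg_cont_mxP => i j; rewrite ord1.
  exact: (curve_phi_cont HG HE EB HK (@Gh 0) (ch 0) (su i)).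
have [M1 M10 HM1] := seg_cont_bounded clam; have [M2 M20 HM2] := seg_cont_bounded cAU.
have [M3 M30 HM3] := seg_cont_bounded cAr; have [M4 M40 HM4] := seg_cont_bounded cu.
have [M5 M50 HM5] := seg_cont_bounded cbU.
pose M := Num.max (Num.max M1 M2) (Num.max M3 M4).
have M0 : 0 <= M by rewrite !le_max (ltW M10).
pose L := 1 + n%:R * M2 + M5.
have L0 : 0 <= L by rewrite !addr_ge0// ?mulr_ge0// ltW.
have [N [dN [N0 dN0 HN]]] := state_bound HG HE EB HK T0 Gh ch h0 dh su.
have [W W0 HW] := costate_estimate HG HE EB HK M0 L0 N0.
have [d1 d10 Hd1] := HU 1 ltr01.
apply: is_derive_eps => e e0.
(* The coefficients of [e1 * s] in the final sum: 2 W T from [S T], N + 1 from the expansion of F,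
   and the next term from the replacement of q by its linear coordinates [y]. *)
pose k := T * (2 * W) + N + 1 + n%:R * M * (K * (K * N ^+ 2)) + 1.
have k0 : 0 < k.
  by rewrite ltr_wpDl// !addr_ge0// !mulr_ge0// ?exprn_ge0// ltW.
pose e1 := e / k.
have e10 : 0 < e1 by rewrite divr_gt0.
have [d2 d20 Hd2] := HU e1 e10; have [d3 d30 Hd3] := Hr e1 e10; have [d4 d40 Hd4] := HF e1 e10.
pose d' := Num.min (Num.min 1 d1) (Num.min d2 (Num.min d3 d4)).
have d'0 : 0 < d' by rewrite !lt_min ltr01 d10 d20 d30 d40.
have N10 : 0 < N + 1 by rewrite ltr_wpDl.
(* The bound by [e1] turns s^2 into e1 s; the quotient by N + 1 brings both |c| and |q| <= N |c|
   below [d']. *)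
exists (Num.min dN (Num.min e1 (d' / (N + 1)))).
  by rewrite !lt_min dN0 e10 divr_gt0.
move=> c; rewrite !lt_min => /andP[cdN /andP[ce1]]; rewrite ltr_pdivlMr// => cN.
rewrite [c *: 1]mulr1 addr0; set s := `|c| in cdN ce1 cN *.
have s0 : 0 <= s by exact: normr_ge0.
have sd : s < d' by rewrite (le_lt_trans _ cN)// ler_peMr// lerDr.
have Nsd : N * s < d' by rewrite (le_lt_trans _ cN)// mulrC ler_wpM2l// lerDl.
have d'E : [/\ d' <= 1, d' <= d1, d' <= d2, d' <= d3 & d' <= d4].
  by rewrite /d' !ge_min !lexx /= !orbT.
case: d'E => d'1 d'd1 d'd2 d'd3 d'd4.
have HNc t : t \in `[0, T] -> exists2 q, h c t = h 0 t *m expm (Lam E q) & `|q| <= N * s.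
  exact: HN.
pose Z t := invmx (h 0 t) *m h c t - 1%:M.
pose psi t := r (h c t) t c - r (h 0 t) t 0 - c * kappa t.
have cpsi : seg_cont T psi.
  apply: seg_contD; first apply: seg_contD => //.
    rewrite (_ : (fun t => _) = fun t => -1 * r (h 0 t) t 0); last by apply/funext => t; rewrite mulN1r.
    by apply: seg_contM => //; exact: seg_cont_cst.
  rewrite (_ : (fun t => _) = fun t => - c * kappa t); last by apply/funext => t; rewrite mulNr.
  by apply: seg_contM => //; exact: seg_cont_cst.
(* [S] vanishes at 0, and its derivative [dS] is the quantity estimated by [costate_estimate];
   [MVT_le] therefore makes [S T] negligible compared with |c|. *)
pose S t := dotv (lam t) (coords B (Z t)) + Rintegral mu `[0, t] psi.
pose dS t := dotv (- dg E (fun X => dotv (lam t) (u X t 0) + r X t 0) (h 0 t)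
   + (adm E (u (h 0 t) t 0))^T *m lam t) (coords B (Z t)) + dotv (lam t) (coords B
    (- (Lam E (u (h 0 t) t 0) *m (invmx (h 0 t) *m h c t))
     + (invmx (h 0 t) *m h c t) *m Lam E (u (h c t) t c))) + psi t.
have cZ : seg_cont T Z by exact: (deviation_cont HG HE EB HK Gh ch).
have cS : seg_cont T S.
  apply: seg_contD; last exact: seg_cont_integral.
  rewrite (_ : (fun t => _) = fun t => \sum_i lam t i 0 * (\sum_j \sum_k B i j k * Z t j k)).
    move/seg_cont_mxP : clam => cl; move/seg_cont_mxP : cZ => cz.
    apply: seg_cont_sum => i; apply: seg_contM => //.
    apply: seg_cont_sum => j; apply: seg_cont_sum => l.
    by apply: seg_contM => //; exact: seg_cont_cst.
  by apply/funext => t; rewrite dotvE; apply: eq_bigr => i _; rewrite mxE.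
have Sbound : `|S T - S 0| <= W * (e1 + s) * s * T.
  apply: (@MVT_le R S dS T _ T0) => //.
    by rewrite mulr_ge0// mulr_ge0 ?addr_ge0// ltW.
  move=> t tT; have tI := oo_cc tT; split.
    apply: is_deriveD; last exact: (is_derive_integral cpsi tT).
    apply: is_derive_dotv; first exact: dlam.
    apply: is_derive_coords.
    exact: (is_derive_deviation HG HE EB HK Gh ch dh c tT).
  have [q qE qN] := HNc t tI.
  have qd' : `|q| < d' by exact: le_lt_trans qN Nsd.
  have XE : invmx (h 0 t) *m h c t = expm (Lam E q).
    by rewrite qE mulKmx//; exact: (Lie_group_unit HG (Gh 0 tI)).
  have lip : `|u (h c t) t c - u (h 0 t) t 0| <= L * (`|q| + s).
    have := Hd1 t tI q c (lt_le_trans qd' d'd1) (lt_le_trans sd d'd1).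
    rewrite -qE mul1r => H.
    exact: affine_approx_norm_le (HM2 t tI) (HM5 t tI) H.
  have hU := Hd2 t tI q c (lt_le_trans qd' d'd2) (lt_le_trans sd d'd2).
  have hR := Hd3 t tI q c (lt_le_trans qd' d'd3) (lt_le_trans sd d'd3).
  rewrite -qE in hU hR.
  have lM : `|lam t| <= M by rewrite (le_trans (HM1 t tI))// !le_max lexx ?orbT.
  have AM : `|AU t| <= M by rewrite (le_trans (HM2 t tI))// !le_max lexx ?orbT.
  have ArM : `|Ar t| <= M by rewrite (le_trans (HM3 t tI))// !le_max lexx ?orbT.
  have uM : `|u (h 0 t) t 0| <= M by rewrite (le_trans (HM4 t tI))// !le_max lexx ?orbT.
  have := HW q (u (h 0 t) t 0) (u (h c t) t c) (lam t) (bU t) (Ar t) (AU t) c (br t)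
    (r (h 0 t) t 0) (r (h c t) t c) e1 (ltW e10) lM AM ArM uM qN (ltW (lt_le_trans Nsd d'1))
    lip hU hR _ XE.
  rewrite -/s; congr (`|_| <= _).
  rewrite /dS dgE// /Z /psi /kappa; ring.
have S0 : S 0 = 0.
  rewrite /S /Z h0 mulVmx; last by apply: (Lie_group_unit HG); apply: Gh; rewrite in_itv/= lexx ltW.
  by rewrite subrr coords0 dotv0r add0r set_itv1 Rintegral_set1.
rewrite S0 subr0 in Sbound.
have [q qE qN] := HNc T TI.
have qd' : `|q| < d' by exact: le_lt_trans qN Nsd.
have q1 : `|q| <= 1 by exact: ltW (lt_le_trans qd' d'1).
have hF := Hd4 T TI q c (lt_le_trans qd' d'd4) (lt_le_trans sd d'd4).
rewrite -qE -/s in hF.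
have XE : Z T = expm (Lam E q) - 1%:M.
  by rewrite /Z qE mulKmx//; exact: (Lie_group_unit HG (Gh 0 TI)).
have intE : Rintegral mu `[0, T] psi = Rintegral mu `[0, T] (fun s => r (h c s) s c)
    - Rintegral mu `[0, T] (fun s => r (h 0 s) s 0) - c * Rintegral mu `[0, T] kappa.
  rewrite /psi RintegralB//=; last 2 first.
  - apply: seg_cont_integrable; apply: seg_contD => //.
    rewrite (_ : (fun t => _) = fun t => -1 * r (h 0 t) t 0); last by apply/funext => t; rewrite mulN1r.
    by apply: seg_contM => //; exact: seg_cont_cst.
  - by apply: seg_cont_integrable; apply: seg_contM => //; exact: seg_cont_cst.
  rewrite RintegralB//=; [|exact: seg_cont_integrable|exact: seg_cont_integrable].
  by rewrite RintegralZl//; exact: seg_cont_integrable.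
pose y := coords B (Z T).
have yq : `|dotv (lam T) (q - y)| <= n%:R * M * (K * (K * N ^+ 2)) * s ^+ 2.
  have -> : n%:R * M * (K * (K * N ^+ 2)) * s ^+ 2 = n%:R * M * (K * (K * (N * s) * (N * s))) by ring.
  rewrite (le_trans (dotv_norm_le _ _))// ler_pM ?mulr_ge0//.
    by rewrite ler_wpM2l// (le_trans (HM1 T TI))// !le_max lexx.
  rewrite distrC /y XE -[X in _ - X]EB -coordsB (le_trans (Kcoords _))// ler_wpM2l//.
  rewrite (le_trans (expm_Lam1 HK q1))// ler_pM ?mulr_ge0//.
  by rewrite ler_wpM2l.
set J0 := F (h 0 T) T 0 + _.
(* The terminal condition identifies the differential [AF T] of F with [lam T], so it cancels the
   boundary term of [S T] up to the pairing of [lam T] with q - y, which is of second order. *)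
have -> : F (h c T) T c + Rintegral mu `[0, T] (fun s => r (h c s) s c) - J0
    - c * (bF T + Rintegral mu `[0, T] kappa) =
  (F (h c T) T c - F (h 0 T) T 0 - (dotv (AF T) q + c * bF T)) + dotv (lam T) (q - y) + S T.
  by rewrite /S intE -lamTE dotvBr /J0 /y; ring.
have qs : e1 * (`|q| + s) <= e1 * ((N + 1) * s).
  by rewrite ler_wpM2l ?(ltW e10)// mulrDl mul1r lerD2r.
have H1 := ler_normD (F (h c T) T c - F (h 0 T) T 0 - (dotv (AF T) q + c * bF T)
  + dotv (lam T) (q - y)) (S T).
have H2 := ler_normD (F (h c T) T c - F (h 0 T) T 0 - (dotv (AF T) q + c * bF T))
  (dotv (lam T) (q - y)).
apply: (le_trans H1); apply: (le_trans (lerD (le_trans H2 (lerD (le_trans hF qs) yq)) Sbound)).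
have ek : e = e1 * k by rewrite /e1 divfK// gt_eqF.
have ss : s ^+ 2 <= e1 * s by rewrite expr2 ler_wpM2r// ltW.
have c1 : n%:R * M * (K * (K * N ^+ 2)) * s ^+ 2 <= n%:R * M * (K * (K * N ^+ 2)) * (e1 * s).
  by rewrite ler_wpM2l// !mulr_ge0// exprn_ge0.
have c2 : W * (e1 + s) * s * T <= T * (2 * W) * (e1 * s).
  have -> : W * (e1 + s) * s * T = T * W * (e1 * s) + T * W * s ^+ 2 by ring.
  have -> : T * (2 * W) * (e1 * s) = T * W * (e1 * s) + T * W * (e1 * s) by ring.
  by rewrite lerD2l ler_wpM2l// mulr_ge0// ltW.
have es : 0 <= e1 * s by rewrite mulr_ge0// ltW.
rewrite ek /k.
have -> : e1 * (T * (2 * W) + N + 1 + n%:R * M * (K * (K * N ^+ 2)) + 1) * s =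
  T * (2 * W) * (e1 * s) + e1 * ((N + 1) * s) + n%:R * M * (K * (K * N ^+ 2)) * (e1 * s) + e1 * s.
  by ring.
exact: sum_le c1 c2 es.
Qed.

End gradient.

(** * Reduction of the parameter space to a line *)

Lemma C1_entry (R : realType) (U : normedModType R) m n (phi : U -> 'M[R]_(m, n)) i j :
  C1 phi -> C1 (fun x => phi x i j).
Proof.
move=> Cphi v; have [dphi cphi] := Cphi v.
have dij x : derivable (fun x => phi x i j) x v by have /derivable_mxP := dphi x; exact.
split=> //; apply: continuous_norm => x e e0.
have [d d0 Hd] := continuous_norm_inv x cphi e0; exists d => // y xy.
apply: le_trans (Hd y xy); rewrite !derive_mx//.
by apply: le_trans (mx_entry_le _ i j); rewrite !mxE.
Qed.

Lemma derive_lineE (R : realType) (U V : normedModType R) (f : U -> V) x v :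
  'D_1 (fun c : R => f (x + c *: v)) 0 = 'D_v f x.
Proof.
have E : (fun c => c^-1 *: (((fun c : R => f (x + c *: v)) \o shift 0) (c *: (1 : R))
    - f (x + 0 *: v))) = (fun c => c^-1 *: ((f \o shift x) (c *: v) - f x)).
  by apply/funext => c /=; rewrite addr0 scale0r addr0 [c *: 1]mulr1 [x + c *: v]addrC.
by rewrite /derive E.
Qed.

Lemma is_derive_lineP (R : realType) (U V : normedModType R) (f : U -> V) x v df :
  is_derive (0 : R) (1 : R) (fun c : R => f (x + c *: v)) df -> is_derive x v f df.
Proof.
move=> /is_deriveP H; apply/is_deriveP; move: H.
under eq_fun do rewrite addr0 scale0r addr0 [_ *: 1]mulr1.
by under [in X in _ -> X]eq_fun do rewrite [_ + x]addrC.
Qed.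

Theorem theorem1 (R : realType) (m n ntheta : nat)
  (G : set 'M[R]_m) (E : 'I_n -> 'M[R]_m)
  (f : 'M[R]_m -> R -> 'cV[R]_ntheta -> 'M[R]_m)
  (F : 'M[R]_m -> 'cV[R]_ntheta -> R)
  (r : 'M[R]_m -> 'cV[R]_ntheta -> R -> R)
  (T : R) (g0 : 'M[R]_m)
  (Psi : 'cV[R]_ntheta -> R -> 'M[R]_m)
  (theta : 'cV[R]_ntheta) (lam : R -> 'cV[R]_n) :
  matrix_Lie_group G ->
  is_basis_of E (lie_algebra G) ->
  (* f_theta(g,t) is in T_g G, i.e. g^{-1} f_theta(g,t) is in the Lie algebra *)
  (forall g t th, G g -> lie_algebra G (invmx g *m f g t th)) ->
  C1_on_group G E (fun g (p : R * 'cV[R]_ntheta) => f g p.1 p.2) ->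
  C1_on_group G E F ->
  C1_on_group G E (fun g (p : 'cV[R]_ntheta * R) => r g p.1 p.2) ->
  0 < T -> G g0 ->
  (* Psi th t = Psi^t_{f_th}(g0): the solution of dg/dt = f_th(g,t), g(0) = g0 *)
  (forall th,
     [/\ Psi th 0 = g0,
         (forall t, t \in `[0, T] -> G (Psi th t)),
         {within `[0, T], continuous (Psi th)} &
         (forall t, t \in `]0, T[ -> is_derive t 1 (Psi th) (f (Psi th t) t th))]) ->
  (* the adjoint (co-state) equation along g(t) = Psi theta t *)
  {within `[0, T], continuous lam} ->
  (forall t, t \in `]0, T[ ->
     is_derive t 1 lam
       (- dg E (fun h => dotv (lam t) (Laminv E (invmx h *m f h t theta)) + r h theta t)
              (Psi theta t)
        + (adm E (Laminv E (invmx (Psi theta t) *m f (Psi theta t) t theta)))^T *m lam t)) ->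
  lam T = dg E (fun h => F h theta) (Psi theta T) ->
  (* gradient of the cost, component by component *)
  forall j : 'I_ntheta,
    is_derive theta (ev j)
      (fun th => F (Psi th T) th
                 + Rintegral lebesgue_measure `[0, T] (fun s => r (Psi th s) th s))
      ('D_(ev j) (fun th => F (Psi theta T) th) theta
       + Rintegral lebesgue_measure `[0, T]
           (fun t => 'D_(ev j) (fun th => dotv (lam t)
                                 (Laminv E (invmx (Psi theta t) *m f (Psi theta t) t th))) theta
                     + 'D_(ev j) (fun th => r (Psi theta t) th t) theta)).
Proof.
move=> HG HE flie Cf CF Cr T0 Gg0 HPsi clam dlam lamT j.
have [Einj _] := HE.
have [B EB] := coords_exists Einj; have [K HK] := chart_const_exists E B.
pose th c := theta + c *: ev j : 'cV[R]_ntheta.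
have th0 : th 0 = theta by rewrite /th scale0r addr0.
pose u g t c := Laminv E (invmx g *m f g t (th c)).
have uE g t c : G g -> u g t c = coords B (invmx g *m f g t (th c)).
  by move=> Gg; apply: (Laminv_coords HE EB); exact: flie.
have LamuE g t c : G g -> Lam E (u g t c) = invmx g *m f g t (th c).
  by move=> Gg; rewrite uE//; apply/(lie_algebraP HE EB); exact: flie.
have sf k l : group_sdiff G E (fun g t c => f g t (th c) k l).
  move=> g t0 Gg.
  have := fun w0 vt ve => C1_sdiff3 w0 vt ve (0, t0, 0) (C1_entry k l (Cf g Gg)).
  move=> /(_ (0, theta) (1, 0) (0, ev j)).
  apply: eq_has_sdiff3 => x /=.
  by rewrite /th !scaler0 add0r !addr0 [x.1.2 *: 1]mulr1.
(* By [coords], each coordinate of u is a linear combination of products of an entry of g^-1 and an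
   entry of f. *)
have su i : group_sdiff G E (fun g t c => u g t c i 0).
  move=> g t0 Gg.
  have H k l p : has_sdiff3 (fun x : 'cV[R]_n * R * R =>
      invmx (g *m expm (Lam E x.1.1)) k p * f (g *m expm (Lam E x.1.1)) x.1.2 (th x.2) p l) (0, t0, 0).
    by apply: has_sdiff3M; [exact: (group_sdiff_inv HG HK)|exact: sf].
  have := has_sdiff3_sum (fun=> 1) (fun k => has_sdiff3_sum (B i k)
    (fun l => has_sdiff3_sum (fun=> 1) (fun p => H k l p))).
  apply: eq_has_sdiff3 => x /=.
  rewrite uE ?mxE; last by apply: (Lie_groupM HG) => //; exact: (G_expm_Lam HE).
  apply: eq_bigr => k _; rewrite mul1r; apply: eq_bigr => l _; rewrite mxE.
  by congr (_ * _); apply: eq_bigr => p _; rewrite mul1r.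
have sr c : group_sdiff G E (fun g t c' => r g (th (c + c')) t).
  move=> g t0 Gg.
  have := fun w0 vt ve => C1_sdiff3 w0 vt ve (0, t0, 0) (Cr g Gg).
  move=> /(_ (th c, 0) (0, 1) (ev j, 0)).
  apply: eq_has_sdiff3 => x /=.
  by rewrite /th !scaler0 add0r !addr0 [x.1.2 *: 1]mulr1 -addrA -scalerDl.
have sF : group_sdiff G E (fun g _ c => F g (th c)).
  move=> g t0 Gg.
  have := fun w0 vt ve => C1_sdiff3 w0 vt ve (0, t0, 0) (CF g Gg).
  move=> /(_ theta 0 (ev j)).
  by apply: eq_has_sdiff3 => x /=; rewrite scaler0 addr0.
have Dl (phi : 'cV[R]_ntheta -> R) : 'D_(ev j) phi theta = 'D_1 (fun c => phi (th c)) 0.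
  by rewrite -(derive_lineE phi theta (ev j)).
apply: (@is_derive_lineP _ _ _ _ theta (ev j)).
have := @cost_gradient R m n G E B K HG HE EB HK T (fun c => Psi (th c)) u T0.
move=> /(_ _ _ _ _ su (fun g t c => r g (th c) t) (fun g _ c => F g (th c)) lam sr sF).
rewrite /= !th0 => H.
have -> : (fun t => 'D_(ev j) (fun th => dotv (lam t)
              (Laminv E (invmx (Psi theta t) *m f (Psi theta t) t th))) theta
            + 'D_(ev j) (fun th => r (Psi theta t) th t) theta) =
   (fun t => 'D_1 (fun c => dotv (lam t) (u (Psi theta t) t c)) 0 +
             'D_1 (fun c => r (Psi theta t) (th c) t) 0).
  by apply/funext => t; rewrite (Dl (fun th => dotv _ (Laminv E (_ *m f _ t th))))
    (Dl (fun th => r _ th t)).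
rewrite (Dl (F (Psi theta T))).
have A1 c t : t \in `[0, T] -> G (Psi (th c) t).
  by move=> tT; have [_ GP _ _] := HPsi (th c); exact: GP.
have A2 c : seg_cont T (Psi (th c)).
  by apply/within_seg_cont; have [] := HPsi (th c).
have A3 c : Psi (th c) 0 = Psi theta 0.
  by have [-> _ _ _] := HPsi (th c); have [-> _ _ _] := HPsi theta.
have A4 c t : t \in `]0, T[ ->
    is_derive t (1 : R) (Psi (th c)) (Psi (th c) t *m Lam E (u (Psi (th c) t) t c)).
  move=> tT; have [_ GP _ /(_ t tT)] := HPsi (th c).
  have tI : t \in `[0, T] by move: tT; rewrite !in_itv/= => /andP[/ltW-> /ltW->].
  by rewrite LamuE ?mulKVmx//; [exact: (Lie_group_unit HG (GP t tI))|exact: GP].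
have A5 : seg_cont T lam by exact/within_seg_cont.
have A6 t : t \in `]0, T[ -> is_derive t (1 : R) lam
      (- dg E (fun X => dotv (lam t) (u X t 0) + r X theta t) (Psi theta t)
       + (adm E (u (Psi theta t) t 0))^T *m lam t).
  by move=> tT; have := dlam t tT; rewrite /u th0.
have {}H := H A1 A2 A3 A4 A5 A6 lamT.
rewrite /th in H *.
exact: H.
Qed.
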